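(* Let $k>l\ge 0$ be integers with $k+l\ge 3$, let $\Delta=k-l$, let $\theta\in\mathbb{R}$ and $\xi=e^{i\theta}$, let $f:\mathbb{N}\to[0,\infty)$, and let $A=A_{k,l}(f)=\xi(a^\dagger)^ka^l+\xi^*(a^\dagger)^la^k+f(a^\dagger a)$ with domain $\mathcal{D}_0$. Assume that $f(n)/\beta^{kl}_n$ admits an asymptotic expansion in powers of $n^{-1/2}$, $$\frac{f(n)}{\beta^{kl}_n}\sim \kappa+\frac{L_1}{n^{1/2}}+\frac{L_2}{n}+\cdots$$ with $\kappa<2$. Then $A$ is not essentially self-adjoint and has deficiency indices $n_+=n_-=\Delta$, where $n_\pm=\dim K_\pm$ and $K_\pm=\operatorname{Ran}(A\pm i)^\perp$. Moreover, for each $n_0$ with $l\le n_0<k$, let $(d^{(n_0)}_r)_{r\in\mathbb{N}}$ be a nonzero solution of $$\beta^{kl}_{n_0+r\Delta}\,d^{(n_0)}_{r+1}-\bigl(1+i f(n_0+r\Delta)\bigr)d^{(n_0)}_r-\beta^{lk}_{n_0+r\Delta}\,d^{(n_0)}_{r-1}=0\qquad(r\in\mathbb{N}),$$ (for $r=0$ the term with $d^{(n_0)}_{-1}$ is absent, its coefficient $\beta^{lk}_{n_0}$ being $0$), put $d^{(n_0,+)}_r=d^{(n_0)}_r$, $d^{(n_0,-)}_r=\overline{d^{(n_0)}_r}$, and $$\varphi^\pm_{n_0}=\sum_{r=0}^\infty(\pm i)^r e^{ir\theta}d^{(n_0,\pm)}_r\,\phi_{n_0+r\Delta}.$$ Then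 $K_\pm=\operatorname{span}(\varphi^\pm_{n_0})_{l\le n_0<k}$. The self-adjoint extensions of $A$ are parametrized by $\Delta\times\Delta$ unitary matrices $U=(U_{ij})_{i,j=0}^{\Delta-1}\in\mathrm{U}(\Delta)$ via $U\mapsto A^U$, where $$\mathcal{D}(A^U)=\{\psi+\varphi_U:\ \psi\in\mathcal{D}(\overline{A}),\ \varphi_U\in\mathcal{D}_U\},$$ $$\mathcal{D}_U=\Bigl\{\sum_{i=0}^{\Delta-1}a_i\varphi^+_{l+i}-\sum_{i,j=0}^{\Delta-1}a_iU_{ij}\frac{\|\varphi^+_{l+i}\|}{\|\varphi^+_{l+j}\|}\varphi^-_{l+j}:\ (a_i)_{i=0}^{\Delta-1}\in\mathbb{C}^\Delta\Bigr\},$$ $\overline{A}$ is the closure of $A$, and $A^U\psi=A^*\psi$ for $\psi\in\mathcal{D}(A^U)$. Furthermore, $\{\psi_0+\varphi_U:\ \psi_0\in\mathcal{D}_0,\ \varphi_U\in\mathcal{D}_U\}$ is a core of $A^U$.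
   Context: $\mathbb{N}=\{0,1,2,\dots\}$. $\mathcal{H}$ is a separable complex Hilbert space with orthonormal basis $(\phi_n)_{n\in\mathbb{N}}$ (Fock states); $\mathcal{D}_0$ is the set of finite linear combinations of the $\phi_n$. The operators $a,a^\dagger$ have domain $\mathcal{D}_0$ and act by $a\phi_n=\sqrt{n}\,\phi_{n-1}$ (so $a\phi_0=0$), $a^\dagger\phi_n=\sqrt{n+1}\,\phi_{n+1}$, extended linearly. For $f:\mathbb{N}\to[0,\infty)$, $f(a^\dagger a)$ has domain $\mathcal{D}_0$ and $f(a^\dagger a)\phi_n=f(n)\phi_n$. For integers $x$ and $s\ge0$ the Pochhammer symbol is $(x,s)=x(x+1)\cdots(x+s-1)$ (equal to $1$ if $s=0$), with the convention $(x,s)=0$ whenever $x$ is a negative integer; for integers $n,k,l$ with $k,l\ge0$, $\beta^{kl}_n=\sqrt{(n-l+1,l)(n-l+1,k)}$. A function $g:\mathbb{N}\to\mathbb{C}$ admits the asymptotic expansion $g(n)\sim\sum_{s\ge0}\lambda_s n^{-s/2}$ if for every $S\in\mathbb{N}$ there are $C,N$ with $|g(n)-\sum_{s=0}^S\lambda_s n^{-s/2}|\le C n^{-(S+1)/2}$ for all $n\ge N$ (the series need not converge). *)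

(* Defs.v *)
(* concrete reals R, Coquelicot complex numbers C.
   The Hilbert space H is modelled concretely as l^2(N) (coordinates in the
   Fock basis phi_n = indicator of n); unbounded operators are modelled by
   their graphs (relations on sequences). *)
From Stdlib Require Import Reals ZArith Arith Lia.
From Coquelicot Require Import Coquelicot.

Open Scope R_scope.

Definition seqC := nat -> C.

Fixpoint sumC (d : nat) (F : nat -> C) : C :=
  match d with
  | O => RtoC 0
  | S d' => Cplus (sumC d' F) (F d')
  end.

Fixpoint Cpow (z : C) (r : nat) : C :=
  match r with
  | O => RtoC 1
  | S r' => Cmult z (Cpow z r')
  end.

Definition l2 (u : seqC) : Prop := ex_series (fun n => (Cmod (u n)) ^ 2).

Definition inner (u v : seqC) : C :=
  (Series (fun n => Re (Cmult (Cconj (u n)) (v n))),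
   Series (fun n => Im (Cmult (Cconj (u n)) (v n)))).

Definition nrm (u : seqC) : R := sqrt (Series (fun n => (Cmod (u n)) ^ 2)).

Definition D0 (u : seqC) : Prop := exists N, forall n, (N <= n)%nat -> u n = RtoC 0.

Definition graph := seqC -> seqC -> Prop.

Definition is_operator (G : graph) : Prop :=
  forall x y y', G x y -> G x y' -> y = y'.

Definition dom (G : graph) (x : seqC) : Prop := exists y, G x y.

Definition adjoint (G : graph) : graph := fun x y =>
  l2 x /\ l2 y /\ forall u v, G u v -> inner x v = inner y u.

Definition gclosure (G : graph) : graph := fun x y =>
  l2 x /\ l2 y /\
  forall eps, 0 < eps -> exists u v, G u v /\ l2 u /\ l2 v /\
    nrm (fun n => Cminus (x n) (u n)) < eps /\
    nrm (fun n => Cminus (y n) (v n)) < eps.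

Definition graph_eq (G H : graph) : Prop := forall x y, G x y <-> H x y.

Definition extends (T G : graph) : Prop := forall x y, G x y -> T x y.

(* T = T^* (T an operator; this forces its domain to be dense) *)
Definition self_adjoint (G : graph) : Prop :=
  is_operator G /\ graph_eq G (adjoint G).

Definition ess_self_adjoint (G : graph) : Prop := self_adjoint (gclosure G).

Definition restrict (G : graph) (D : seqC -> Prop) : graph := fun x y => D x /\ G x y.

Definition is_core (T : graph) (D : seqC -> Prop) : Prop :=
  (forall x, D x -> dom T x) /\ graph_eq (gclosure (restrict T D)) T.

Definition in_span (d : nat) (v : nat -> seqC) (x : seqC) : Prop :=
  exists c : nat -> C, forall n, x n = sumC d (fun i => Cmult (c i) (v i n)).

Definition has_dim (K : seqC -> Prop) (d : nat) : Prop :=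
  exists v : nat -> seqC,
    (forall i, (i < d)%nat -> K (v i)) /\
    (forall c : nat -> C,
        (forall n, sumC d (fun i => Cmult (c i) (v i n)) = RtoC 0) ->
        forall i, (i < d)%nat -> c i = RtoC 0) /\
    (forall x, K x -> in_span d v x).

(* a phi_n = sqrt n phi_{n-1}:  (a u)_m = sqrt(m+1) u_{m+1} *)
Definition aop (u : seqC) : seqC := fun m => Cmult (RtoC (sqrt (INR (S m)))) (u (S m)).
(* a^dag phi_n = sqrt(n+1) phi_{n+1}: (a^dag u)_0 = 0, (a^dag u)_{m+1} = sqrt(m+1) u_m *)
Definition adag (u : seqC) : seqC := fun m =>
  match m with O => RtoC 0 | S m' => Cmult (RtoC (sqrt (INR m))) (u m') end.

Definition xi (theta : R) : C := (cos theta, sin theta).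

Definition Aop (k l : nat) (theta : R) (f : nat -> R) (u : seqC) : seqC := fun n =>
  Cplus (Cplus (Cmult (xi theta) (Nat.iter k adag (Nat.iter l aop u) n))
               (Cmult (Cconj (xi theta)) (Nat.iter l adag (Nat.iter k aop u) n)))
        (Cmult (RtoC (f n)) (u n)).

Definition Agraph k l theta f : graph := fun u v => D0 u /\ v = Aop k l theta f u.

Fixpoint poch_pos (x : Z) (s : nat) : R :=
  match s with O => 1 | S s' => poch_pos x s' * IZR (x + Z.of_nat s') end.
Definition poch (x : Z) (s : nat) : R := if (x <? 0)%Z then 0 else poch_pos x s.

Definition beta (k l n : nat) : R :=
  sqrt (poch (Z.of_nat n - Z.of_nat l + 1) l * poch (Z.of_nat n - Z.of_nat l + 1) k).

Definition asymp_expansion (g : nat -> R) (lam : nat -> R) : Prop :=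
  forall S : nat, exists (Cst : R) (N : nat), forall n : nat, (N <= n)%nat ->
    Rabs (g n - sum_f_R0 (fun s => lam s * Rpower (INR n) (- INR s / 2)) S)
      <= Cst * Rpower (INR n) (- INR (S + 1) / 2).

Definition recurrence (k l : nat) (f : nat -> R) (n0 : nat) (dd : nat -> C) : Prop :=
  forall r : nat,
    Cminus (Cminus (Cmult (RtoC (beta k l (n0 + r * (k - l)))) (dd (S r)))
                   (Cmult (Cplus (RtoC 1) (Cmult Ci (RtoC (f (n0 + r * (k - l))%nat)))) (dd r)))
           (match r with
            | O => RtoC 0
            | S r' => Cmult (RtoC (beta l k (n0 + r * (k - l)))) (dd r')
            end) = RtoC 0.

(* sum_r (sgn)^r e^{i r theta} dd_r phi_{n0 + r Delta} *)
Definition phivec (k l : nat) (theta : R) (sgn : C) (n0 : nat) (dd : nat -> C) : seqC :=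
  fun m =>
    if andb (n0 <=? m) ((m - n0) mod (k - l) =? 0) then
      let r := ((m - n0) / (k - l))%nat in
      Cmult (Cmult (Cpow sgn r) (Cpow (xi theta) r)) (dd r)
    else RtoC 0.

Definition phiplus k l theta (d : nat -> nat -> C) n0 : seqC := phivec k l theta Ci n0 (d n0).
Definition phiminus k l theta (d : nat -> nat -> C) n0 : seqC :=
  phivec k l theta (Copp Ci) n0 (fun r => Cconj (d n0 r)).

Definition Kdef (k l : nat) theta f (s : C) (x : seqC) : Prop :=
  l2 x /\ forall u, D0 u ->
    inner x (fun n => Cplus (Aop k l theta f u n) (Cmult s (u n))) = RtoC 0.

Definition unitary (D : nat) (U : nat -> nat -> C) : Prop :=
  forall i i', (i < D)%nat -> (i' < D)%nat ->
    sumC D (fun j => Cmult (U i j) (Cconj (U i' j))) = RtoC (if i =? i' then 1 else 0).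

Definition DUvec k l theta d (U : nat -> nat -> C) (a : nat -> C) : seqC := fun n =>
  let D := (k - l)%nat in
  Cminus (sumC D (fun i => Cmult (a i) (phiplus k l theta d (l + i) n)))
    (sumC D (fun i => sumC D (fun j =>
       Cmult (Cmult (Cmult (a i) (U i j))
          (RtoC (nrm (phiplus k l theta d (l + i)) / nrm (phiplus k l theta d (l + j)))))
          (phiminus k l theta d (l + j) n)))).

Definition domAU k l theta f d U (x : seqC) : Prop :=
  exists psi a, dom (gclosure (Agraph k l theta f)) psi /\
    forall n, x n = Cplus (psi n) (DUvec k l theta d U a n).

Definition AU k l theta f d U : graph := fun x y =>
  domAU k l theta f d U x /\ adjoint (Agraph k l theta f) x y.

Definition coreAU k l theta d U (x : seqC) : Prop :=
  exists psi0 a, D0 psi0 /\ forall n, x n = Cplus (psi0 n) (DUvec k l theta d U a n).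

(* Main.v *)
(* The formal matrix of [A] couples n to n + Delta and n - Delta, so it splits into Delta
   Jacobi matrices with off-diagonal weights a_r = beta(n0 + r Delta) >= r^{3/2} and
   diagonal b_r = f(n0 + r Delta).  The expansion of f / beta, truncated at order 1/n, makes
   b_r / a_r of bounded variation with limit kappa in [0, 2); hence the energy
   a_r (s_{r-1} (p_{r+1}^2 + (b_r / a_r) p_{r+1} p_r) + p_r^2 / s_r), s_r^2 = a_{r+1} / a_r,
   is positive definite and changes by summable relative amounts along any solution of
   (A - z) u = 0.  So |u_r|^2 = O(1 / a_r) is summable: every formal solution is in l^2, and
   the deficiency spaces are spanned by the chain solutions.  Projecting onto the closed
   graph of A gives von Neumann's decomposition D(A^* ) = D(closure A) + K_+ + K_-, on which
   the boundary form is 2i (<a, a'> - <b, b'>) in orthonormal coordinates; self-adjoint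
   extensions are its Lagrangian subspaces, i.e. graphs of unitary matrices. *)
Require Import Defs.
From Stdlib Require Import Reals ZArith Arith Lia Lra.
From Stdlib Require Import FunctionalExtensionality PropExtensionality ClassicalEpsilon.
From Coquelicot Require Import Coquelicot.

(** * Square-summable sequences *)

(** The matrix of A is banded, so its formal action F makes sense on every sequence, and the adjoint
    of A is F restricted to those x for which x and F x are both square summable. Every
    operator-theoretic statement thereby becomes one about F.

    The condition kappa < 2 is the definiteness of p_1^2 + kappa p_1 p_0 + p_0^2, with f >= 0
    handling the other sign. The weights s_r make the p_r^2 terms of consecutive energies cancel
    exactly. Order 1/n suffices because increments of n^{-1/2} and 1/n telescope while the remainder
    n^{-3/2} is summable along a chain. The same exponent explains k + l >= 3: the spectral term z u
    has relative size 1 / a_r = O(r^{-3/2}).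

    The part r of a vector left over by the projection satisfies F (F r) = - r, and F^2 + 1 = (F -
    i)(F + i) splits it. That a Lagrangian subspace is a graph over K_+ needs an argument: were its
    projection to K_+ proper, an annihilator of that projection would be a null vector of a definite
    form. *)

Definition vadd (x y : seqC) : seqC := fun n => Cplus (x n) (y n).
Definition vscal (c : C) (x : seqC) : seqC := fun n => Cmult c (x n).
Definition vzero : seqC := fun _ => RtoC 0.
Definition vlin (d : nat) (c : nat -> C) (v : nat -> seqC) : seqC :=
  fun n => sumC d (fun i => Cmult (c i) (v i n)).
Definition vsub (x y : seqC) : seqC := vadd x (vscal (RtoC (-1)) y).

Lemma RtoC_m1 : RtoC (-1) = Copp (RtoC 1).
Proof. unfold RtoC, Copp; simpl. f_equal; ring. Qed.

Lemma vsub_minus (x y : seqC) : (fun n => Cminus (x n) (y n)) = vsub x y.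
Proof.
  apply functional_extensionality; intro n.
  unfold vsub, vadd, vscal. rewrite RtoC_m1. ring.
Qed.

Lemma ex_series_le_pos (a b : nat -> R) :
  (forall n, Rabs (a n) <= b n) -> ex_series b -> ex_series a.
Proof.
  intros H Hb.
  apply (@ex_series_le R_AbsRing R_CompleteNormedModule a b); auto.
Qed.

Lemma ex_series_extR (a b : nat -> R) :
  (forall n, a n = b n) -> ex_series a -> ex_series b.
Proof. exact (ex_series_ext a b). Qed.

Lemma ex_series_plusR (a b : nat -> R) :
  ex_series a -> ex_series b -> ex_series (fun n => a n + b n).
Proof. intros Ha Hb. exact (ex_series_plus a b Ha Hb). Qed.

Lemma ex_series_scalR (c : R) (a : nat -> R) :
  ex_series a -> ex_series (fun n => c * a n).
Proof. intros Ha. exact (ex_series_scal_l c a Ha). Qed.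

Lemma sqr_nonneg_Cmod (z : C) : 0 <= Cmod z ^ 2.
Proof. apply pow2_ge_0. Qed.

Lemma Cmod_plus_sqr (a b : C) : Cmod (Cplus a b) ^ 2 <= 2 * Cmod a ^ 2 + 2 * Cmod b ^ 2.
Proof.
  rewrite !Cmod2_alt. destruct a as [a1 a2], b as [b1 b2]; unfold Re, Im; simpl.
  pose proof (pow2_ge_0 (a1 - b1)). pose proof (pow2_ge_0 (a2 - b2)). lra.
Qed.

Lemma l2_vadd (x y : seqC) : l2 x -> l2 y -> l2 (vadd x y).
Proof.
  intros Hx Hy. unfold l2.
  apply ex_series_le_pos with (fun n => 2 * Cmod (x n) ^ 2 + 2 * Cmod (y n) ^ 2).
  - intro n. rewrite Rabs_pos_eq by apply sqr_nonneg_Cmod. apply Cmod_plus_sqr.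
  - apply ex_series_plusR; apply ex_series_scalR; assumption.
Qed.

Lemma l2_vscal (c : C) (x : seqC) : l2 x -> l2 (vscal c x).
Proof.
  intros Hx. unfold l2, vscal.
  apply (ex_series_ext (fun n => Cmod c ^ 2 * Cmod (x n) ^ 2)).
  - intro n. rewrite Cmod_mult. simpl; ring.
  - apply ex_series_scalR, Hx.
Qed.

Lemma l2_vsub (x y : seqC) : l2 x -> l2 y -> l2 (vsub x y).
Proof. intros Hx Hy. apply l2_vadd; [| apply l2_vscal]; assumption. Qed.

Lemma is_series_R0 : is_series (fun _ : nat => 0) 0.
Proof.
  change (is_lim_seq (sum_n (fun _ : nat => 0)) 0).
  apply is_lim_seq_ext with (fun _ => 0); [| apply is_lim_seq_const].
  intro n. rewrite sum_n_const. ring.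
Qed.

Lemma Series_R0 (a : nat -> R) : (forall n, a n = 0) -> Series a = 0.
Proof.
  intros H. rewrite (Series_ext a (fun _ => 0) H).
  apply is_series_unique, is_series_R0.
Qed.

Lemma ex_series_finite (a : nat -> R) (N : nat) :
  (forall n, (N <= n)%nat -> a n = 0) -> ex_series a.
Proof.
  intros H. apply (ex_series_incr_n a N).
  apply (ex_series_ext (fun _ => 0)).
  - intro n. rewrite H by lia. reflexivity.
  - exists 0. apply is_series_R0.
Qed.

Lemma l2_D0 (x : seqC) : D0 x -> l2 x.
Proof.
  intros [N H]. apply ex_series_finite with N.
  intros n Hn. rewrite H by assumption. rewrite Cmod_0. ring.
Qed.

Lemma D0_vadd (x y : seqC) : D0 x -> D0 y -> D0 (vadd x y).
Proof.
  intros [N Hx] [M Hy]. exists (max N M). intros n Hn.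
  unfold vadd. rewrite Hx, Hy by lia. ring.
Qed.

Lemma D0_vscal (c : C) (x : seqC) : D0 x -> D0 (vscal c x).
Proof.
  intros [N Hx]. exists N. intros n Hn. unfold vscal. rewrite Hx by lia. ring.
Qed.

Lemma D0_vzero : D0 vzero.
Proof. exists 0%nat. reflexivity. Qed.

Lemma vlin_S (d : nat) (c : nat -> C) (v : nat -> seqC) :
  vlin (S d) c v = vadd (vlin d c v) (vscal (c d) (v d)).
Proof. reflexivity. Qed.

Lemma l2_vzero : l2 vzero.
Proof. apply l2_D0, D0_vzero. Qed.

Lemma l2_vlin (d : nat) (c : nat -> C) (v : nat -> seqC) :
  (forall i, (i < d)%nat -> l2 (v i)) -> l2 (vlin d c v).
Proof.
  induction d as [| d IH]; intros H.
  - apply l2_vzero.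
  - rewrite vlin_S. apply l2_vadd; [apply IH; intros; apply H; lia |].
    apply l2_vscal, H. lia.
Qed.

(** * Inner product and norm *)

Lemma Re_Im_bound (a b : C) :
  Rabs (Re (Cmult (Cconj a) b)) <= Cmod a ^ 2 + Cmod b ^ 2 /\
  Rabs (Im (Cmult (Cconj a) b)) <= Cmod a ^ 2 + Cmod b ^ 2.
Proof.
  rewrite !Cmod2_alt. destruct a as [a1 a2], b as [b1 b2]; unfold Re, Im; simpl.
  pose proof (pow2_ge_0 (a1 - b1)). pose proof (pow2_ge_0 (a2 - b2)).
  pose proof (pow2_ge_0 (a1 + b1)). pose proof (pow2_ge_0 (a2 + b2)).
  pose proof (pow2_ge_0 (a1 - b2)). pose proof (pow2_ge_0 (a2 - b1)).
  pose proof (pow2_ge_0 (a1 + b2)). pose proof (pow2_ge_0 (a2 + b1)).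
  split; apply Rabs_le; lra.
Qed.

Lemma inner_ex (u v : seqC) : l2 u -> l2 v ->
  ex_series (fun n => Re (Cmult (Cconj (u n)) (v n))) /\
  ex_series (fun n => Im (Cmult (Cconj (u n)) (v n))).
Proof.
  intros Hu Hv.
  split; apply ex_series_le_pos with (fun n => Cmod (u n) ^ 2 + Cmod (v n) ^ 2);
    try (intro n; apply Re_Im_bound); apply ex_series_plusR; assumption.
Qed.

Lemma inner_vadd_r (u v w : seqC) : l2 u -> l2 v -> l2 w ->
  inner u (vadd v w) = Cplus (inner u v) (inner u w).
Proof.
  intros Hu Hv Hw.
  destruct (inner_ex u v Hu Hv) as [A1 A2], (inner_ex u w Hu Hw) as [B1 B2].
  unfold inner, Cplus; simpl. f_equal; rewrite <- Series_plus by assumption;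
    apply Series_ext; intro n; unfold vadd; simpl; ring.
Qed.

Lemma inner_vscal_r (u v : seqC) (c : C) : l2 u -> l2 v ->
  inner u (vscal c v) = Cmult c (inner u v).
Proof.
  intros Hu Hv.
  destruct (inner_ex u v Hu Hv) as [A1 A2].
  unfold inner, Cmult at 3; simpl. destruct c as [c1 c2]; simpl.
  f_equal; rewrite <- !Series_scal_l.
  - rewrite <- Series_minus by (apply ex_series_scalR; assumption).
    apply Series_ext; intro n; unfold vscal; simpl; ring.
  - rewrite <- Series_plus by (apply ex_series_scalR; assumption).
    apply Series_ext; intro n; unfold vscal; simpl; ring.
Qed.

Lemma inner_conj (u v : seqC) : inner v u = Cconj (inner u v).
Proof.
  unfold inner, Cconj; simpl. f_equal.
  - apply Series_ext; intro n; simpl; ring.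
  - rewrite <- Series_opp. apply Series_ext; intro n; simpl; ring.
Qed.

Lemma inner_vadd_l (u v w : seqC) : l2 u -> l2 v -> l2 w ->
  inner (vadd v w) u = Cplus (inner v u) (inner w u).
Proof.
  intros. rewrite (inner_conj u), inner_vadd_r, Cplus_conj, <- !inner_conj by assumption.
  reflexivity.
Qed.

Lemma inner_vscal_l (u v : seqC) (c : C) : l2 u -> l2 v ->
  inner (vscal c v) u = Cmult (Cconj c) (inner v u).
Proof.
  intros. rewrite (inner_conj u), inner_vscal_r, Cmult_conj, <- !inner_conj by assumption.
  reflexivity.
Qed.

Lemma inner_vsub_r (u v w : seqC) : l2 u -> l2 v -> l2 w ->
  inner u (vsub v w) = Cminus (inner u v) (inner u w).
Proof.
  intros. unfold vsub. rewrite inner_vadd_r, inner_vscal_r by auto using l2_vscal.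
  rewrite RtoC_m1. ring.
Qed.

Lemma inner_vlin_r (u : seqC) (d : nat) (c : nat -> C) (v : nat -> seqC) :
  l2 u -> (forall i, (i < d)%nat -> l2 (v i)) ->
  inner u (vlin d c v) = sumC d (fun i => Cmult (c i) (inner u (v i))).
Proof.
  intros Hu. induction d as [| d IH]; intros H.
  - unfold inner, vlin; simpl.
    unfold RtoC. f_equal; apply Series_R0; intro n; simpl; ring.
  - rewrite vlin_S, inner_vadd_r, inner_vscal_r, IH; auto.
    + apply l2_vlin. intros; apply H; lia.
    + apply l2_vscal, H; lia.
Qed.

Lemma inner_vlin_l (u : seqC) (d : nat) (c : nat -> C) (v : nat -> seqC) :
  l2 u -> (forall i, (i < d)%nat -> l2 (v i)) ->
  inner (vlin d c v) u = sumC d (fun i => Cmult (Cconj (c i)) (inner (v i) u)).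
Proof.
  intros Hu. induction d as [| d IH]; intros H.
  - rewrite inner_conj, inner_vlin_r by (auto; lia). simpl.
    unfold Cconj, RtoC; simpl. f_equal; ring.
  - rewrite vlin_S, inner_vadd_l, inner_vscal_l, IH; auto.
    + apply l2_vlin. intros; apply H; lia.
    + apply l2_vscal, H; lia.
Qed.

Lemma nrm_ge0 (u : seqC) : 0 <= nrm u.
Proof. apply sqrt_pos. Qed.

Lemma Series_nonneg (a : nat -> R) : (forall n, 0 <= a n) -> ex_series a -> 0 <= Series a.
Proof.
  intros H Ha.
  replace 0 with (Series (fun n => 0 * a n)) by (rewrite Series_scal_l; ring).
  apply Series_le; [| exact Ha]. intro n. specialize (H n). lra.
Qed.

Lemma nrm_sqr (u : seqC) : l2 u -> nrm u ^ 2 = Series (fun n => Cmod (u n) ^ 2).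
Proof.
  intros Hu. unfold nrm. rewrite pow2_sqrt; [reflexivity |].
  apply Series_nonneg; [| exact Hu]. intro; apply sqr_nonneg_Cmod.
Qed.

Lemma inner_self (u : seqC) : l2 u -> inner u u = RtoC (nrm u ^ 2).
Proof.
  intros Hu. rewrite nrm_sqr by assumption. unfold inner, RtoC. f_equal.
  - apply Series_ext; intro n. rewrite Cmod2_alt. destruct (u n); unfold Re, Im; simpl; ring.
  - apply Series_R0; intro n. destruct (u n); unfold Im; simpl; ring.
Qed.

Lemma partial_sum_le_Series (a : nat -> R) (N : nat) :
  (forall n, 0 <= a n) -> ex_series a -> sum_n a N <= Series a.
Proof.
  intros H Ha.
  apply (is_lim_seq_incr_compare (sum_n a)).
  - apply Series_correct, Ha.
  - intro n. rewrite sum_Sn. unfold plus; simpl. specialize (H (S n)). lra.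
Qed.

Lemma coord_le_nrm (u : seqC) (n : nat) : l2 u -> Cmod (u n) <= nrm u.
Proof.
  intros Hu. apply Rsqr_incr_0_var; [| apply nrm_ge0].
  unfold Rsqr. replace (nrm u * nrm u) with (nrm u ^ 2) by ring.
  rewrite nrm_sqr by assumption.
  apply Rle_trans with (sum_n (fun n => Cmod (u n) ^ 2) n).
  - destruct n.
    + rewrite sum_O. simpl; lra.
    + rewrite sum_Sn. unfold plus; simpl.
      assert (0 <= sum_n (fun n => Cmod (u n) ^ 2) n).
      { clear. induction n; [rewrite sum_O | rewrite sum_Sn; unfold plus; cbn -[pow]];
          [| apply Rplus_le_le_0_compat; [assumption |]]; apply sqr_nonneg_Cmod. }
      simpl in H. lra.
  - apply partial_sum_le_Series; [intro; apply sqr_nonneg_Cmod | exact Hu].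
Qed.

Lemma nrm_eq0 (u : seqC) : l2 u -> nrm u = 0 -> u = vzero.
Proof.
  intros Hu H. apply functional_extensionality; intro n.
  apply Cmod_eq_0. pose proof (coord_le_nrm u n Hu). pose proof (Cmod_ge_0 (u n)). lra.
Qed.

Lemma nrm_vzero : nrm vzero = 0.
Proof.
  pose proof (inner_self vzero l2_vzero) as H.
  replace vzero with (vscal (RtoC 0) vzero) in H at 2
    by (apply functional_extensionality; intro n; unfold vscal, vzero; ring).
  rewrite inner_vscal_r in H by apply l2_vzero.
  rewrite Cmult_0_l in H. apply RtoC_inj in H. nra.
Qed.

Lemma nrm_vscal (c : C) (u : seqC) : l2 u -> nrm (vscal c u) = Cmod c * nrm u.
Proof.
  intros Hu. apply Rsqr_inj.
  - apply nrm_ge0.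
  - apply Rmult_le_pos; [apply Cmod_ge_0 | apply nrm_ge0].
  - unfold Rsqr.
    replace (nrm (vscal c u) * nrm (vscal c u)) with (nrm (vscal c u) ^ 2) by ring.
    replace (Cmod c * nrm u * (Cmod c * nrm u)) with (Cmod c ^ 2 * nrm u ^ 2) by ring.
    rewrite !nrm_sqr by (auto using l2_vscal).
    rewrite <- Series_scal_l. apply Series_ext; intro n.
    unfold vscal. rewrite Cmod_mult. ring.
Qed.

Lemma nrm_vadd_sqr (u v : seqC) : l2 u -> l2 v ->
  nrm (vadd u v) ^ 2 = nrm u ^ 2 + nrm v ^ 2 + 2 * Re (inner u v).
Proof.
  intros Hu Hv. apply RtoC_inj.
  rewrite <- inner_self by (auto using l2_vadd).
  rewrite inner_vadd_l, !inner_vadd_r, (inner_conj u v), !inner_self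
    by (auto using l2_vadd).
  destruct (inner u v) as [a b]. unfold Cplus, Cconj, RtoC; simpl. f_equal; ring.
Qed.

(** Nonnegativity of [nrm (t u - conj z v) ^ 2] with [t = nrm v ^ 2] and [z = inner u v]. Scaling by
    [t] avoids division, so that only the cancellation of [t] at the end needs [nrm v] to be
    nonzero. *)
Lemma cauchy_schwarz (u v : seqC) : l2 u -> l2 v -> Cmod (inner u v) <= nrm u * nrm v.
Proof.
  intros Hu Hv.
  pose proof (nrm_ge0 u) as Pu. pose proof (nrm_ge0 v) as Pv.
  destruct (Req_dec (nrm v) 0) as [E | E].
  - rewrite (nrm_eq0 v Hv E).
    replace vzero with (vscal (RtoC 0) vzero)
      by (apply functional_extensionality; intro n; unfold vscal, vzero; ring).
    rewrite inner_vscal_r by (auto using l2_vzero).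
    rewrite Cmult_0_l, Cmod_0. apply Rmult_le_pos; [assumption | apply nrm_ge0].
  - set (t := nrm v ^ 2).
    assert (Ht : 0 < t) by (unfold t; nra).
    set (z := inner u v).
    pose proof (nrm_vadd_sqr (vscal (RtoC t) u) (vscal (Copp (Cconj z)) v)) as H.
    rewrite !nrm_vscal, inner_vscal_l, inner_vscal_r in H by (auto using l2_vscal).
    fold z in H.
    specialize (H (l2_vscal _ _ Hu) (l2_vscal _ _ Hv)).
    rewrite Cmod_opp, Cmod_conj, Cmod_R, (Rabs_pos_eq t) in H by lra.
    replace (Re (Cconj (RtoC t) * (- Cconj z * z))%C) with (- t * Cmod z ^ 2) in H
      by (rewrite Cmod2_alt; destruct z; simpl; ring).
    pose proof (pow2_ge_0 (nrm (vadd (vscal (RtoC t) u) (vscal (- Cconj z)%C v)))) as Q.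
    rewrite H in Q.
    replace ((Cmod z * nrm v) ^ 2) with (Cmod z ^ 2 * t) in Q by (unfold t; ring).
    assert (Q2 : t * (Cmod z ^ 2) <= t * (t * nrm u ^ 2)) by nra.
    apply Rmult_le_reg_l in Q2; [| assumption].
    apply Rsqr_incr_0_var; [| apply Rmult_le_pos; assumption].
    unfold Rsqr. unfold t in Q2. nra.
Qed.

Lemma nrm_triangle (u v : seqC) : l2 u -> l2 v -> nrm (vadd u v) <= nrm u + nrm v.
Proof.
  intros Hu Hv.
  pose proof (nrm_ge0 u). pose proof (nrm_ge0 v).
  apply Rsqr_incr_0_var; [| lra].
  unfold Rsqr.
  replace (nrm (vadd u v) * nrm (vadd u v)) with (nrm (vadd u v) ^ 2) by ring.
  rewrite nrm_vadd_sqr by assumption.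
  pose proof (cauchy_schwarz u v Hu Hv).
  pose proof (re_le_Cmod (inner u v)).
  pose proof (Rle_abs (Re (inner u v))). nra.
Qed.

Lemma nrm_parallelogram (u v : seqC) : l2 u -> l2 v ->
  nrm (vadd u v) ^ 2 + nrm (vsub u v) ^ 2 = 2 * nrm u ^ 2 + 2 * nrm v ^ 2.
Proof.
  intros Hu Hv. unfold vsub.
  rewrite !nrm_vadd_sqr, nrm_vscal, inner_vscal_r by (auto using l2_vscal).
  rewrite RtoC_m1, Cmod_m1. destruct (inner u v); simpl. ring.
Qed.

Lemma vsub_sym_nrm (u v : seqC) : l2 u -> l2 v -> nrm (vsub u v) = nrm (vsub v u).
Proof.
  intros. replace (vsub u v) with (vscal (RtoC (-1)) (vsub v u)).
  - rewrite nrm_vscal by (auto using l2_vsub).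
    rewrite RtoC_m1, Cmod_m1; ring.
  - apply functional_extensionality; intro n. unfold vsub, vadd, vscal.
    rewrite !RtoC_m1. ring.
Qed.

(** * Completeness of the space of square-summable sequences *)

Lemma sum_n_sqr_limit (x : nat -> seqC) (z w : seqC) (M : nat) :
  (forall n, is_lim_seq (fun m => Cmod (Cminus (x m n) (z n))) 0) ->
  is_lim_seq (fun m => sum_n (fun n => Cmod (Cminus (x m n) (w n)) ^ 2) M)
             (sum_n (fun n => Cmod (Cminus (z n) (w n)) ^ 2) M).
Proof.
  intros H.
  assert (K : forall n, is_lim_seq (fun m => Cmod (Cminus (x m n) (w n)) ^ 2)
                (Cmod (Cminus (z n) (w n)) ^ 2)).
  { intro n.
    assert (L : is_lim_seq (fun m => Cmod (Cminus (x m n) (w n)))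
                  (Cmod (Cminus (z n) (w n)))).
    { apply is_lim_seq_spec. intro eps.
      generalize (H n); intro Hn. apply is_lim_seq_spec in Hn.
      destruct (Hn eps) as [N HN]. exists N. intros m Hm. specialize (HN m Hm).
      rewrite Rminus_0_r, Rabs_pos_eq in HN by apply Cmod_ge_0.
      pose proof (Cmod_triangle (Cminus (x m n) (z n)) (Cminus (z n) (w n))) as T1.
      pose proof (Cmod_triangle (Cminus (z n) (x m n)) (Cminus (x m n) (w n))) as T2.
      replace (Cmod (Cminus (z n) (x m n))) with (Cmod (Cminus (x m n) (z n))) in T2
        by (rewrite <- Cmod_opp; f_equal; ring).
      replace (x m n - z n + (z n - w n))%C with (x m n - w n)%C in T1 by ring.
      replace (z n - x m n + (x m n - w n))%C with (z n - w n)%C in T2 by ring.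
      apply Rle_lt_trans with (2 := HN). apply Rabs_le. lra. }
    simpl. apply is_lim_seq_mult'; [assumption |].
    apply is_lim_seq_mult'; [assumption | apply is_lim_seq_const]. }
  induction M as [| M IH].
  - rewrite sum_O. apply is_lim_seq_ext with (2 := K 0%nat).
    intro m; rewrite sum_O; reflexivity.
  - rewrite sum_Sn.
    apply is_lim_seq_ext with
      (fun m => sum_n (fun n => Cmod (Cminus (x m n) (w n)) ^ 2) M +
                Cmod (Cminus (x m (S M)) (w (S M))) ^ 2).
    + intro m; rewrite sum_Sn; reflexivity.
    + apply is_lim_seq_plus'; [exact IH | apply K].
Qed.

Definition cauchy_l2 (x : nat -> seqC) : Prop :=
  forall eps, 0 < eps -> exists N, forall m p, (N <= m)%nat -> (N <= p)%nat ->
    nrm (vsub (x m) (x p)) <= eps.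

Lemma vsub_coord (x y : seqC) (n : nat) : vsub x y n = Cminus (x n) (y n).
Proof. unfold vsub, vadd, vscal. rewrite RtoC_m1. ring. Qed.

Lemma real_cauchy_limit (a : nat -> R) :
  (forall eps, 0 < eps -> exists N, forall m p, (N <= m)%nat -> (N <= p)%nat ->
     Rabs (a m - a p) <= eps) ->
  exists b, is_lim_seq a (Finite b).
Proof.
  intros H. apply (proj2 (ex_lim_seq_cauchy_corr a)).
  intro eps. assert (0 < eps / 2) by (destruct eps; simpl; lra).
  destruct (H _ H0) as [N HN]. exists N. intros n m Hn Hm.
  specialize (HN n m Hn Hm). destruct eps; simpl in *; lra.
Qed.

(** The limit is built coordinatewise. Norm bounds survive because they are imposed on each partial
    sum separately: below a cutoff [M] only finitely many coordinates pass to the limit, and the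
    bound does not depend on [M]. *)
Lemma complete_l2 (x : nat -> seqC) :
  (forall m, l2 (x m)) -> cauchy_l2 x ->
  exists z, l2 z /\
    forall eps, 0 < eps -> exists N, forall m, (N <= m)%nat -> nrm (vsub (x m) z) <= eps.
Proof.
  intros Hl Hc.
  assert (Hlim : forall n, exists zn : C,
            is_lim_seq (fun m => Cmod (Cminus (x m n) zn)) 0).
  { intro n.
    assert (Hcn : forall eps, 0 < eps -> exists N, forall m p,
              (N <= m)%nat -> (N <= p)%nat -> Cmod (Cminus (x m n) (x p n)) <= eps).
    { intros eps He. destruct (Hc eps He) as [N HN]. exists N. intros m p Hm Hp.
      rewrite <- vsub_coord. eapply Rle_trans; [| apply (HN m p Hm Hp)].
      apply coord_le_nrm. auto using l2_vsub. }
    destruct (real_cauchy_limit (fun m => Re (x m n))) as [b1 Hb1].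
    { intros eps He. destruct (Hcn eps He) as [N HN]. exists N. intros m p Hm Hp.
      eapply Rle_trans; [| apply (HN m p Hm Hp)].
      eapply Rle_trans; [| apply re_le_Cmod]. apply Req_le. f_equal. }
    destruct (real_cauchy_limit (fun m => Im (x m n))) as [b2 Hb2].
    { intros eps He. destruct (Hcn eps He) as [N HN]. exists N. intros m p Hm Hp.
      eapply Rle_trans; [| apply (HN m p Hm Hp)].
      eapply Rle_trans; [| apply Rmax_Cmod].
      eapply Rle_trans; [| apply Rmax_r]. apply Req_le. f_equal. }
    exists (b1, b2).
    apply is_lim_seq_le_le with (fun _ => 0)
      (fun m => Rabs (Re (x m n) - b1) + Rabs (Im (x m n) - b2)).
    - intro m. split; [apply Cmod_ge_0 |].
      replace (x m n - (b1, b2))%C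
        with (RtoC (Re (x m n) - b1) + (Ci * RtoC (Im (x m n) - b2)))%C.
      + eapply Rle_trans; [apply Cmod_triangle |].
        rewrite Cmod_mult, Cmod_Ci, !Cmod_R. lra.
      + apply injective_projections; unfold Re, Im; simpl; ring.
    - apply is_lim_seq_const.
    - replace (Finite 0) with (Finite (Rabs (b1 - b1) + Rabs (b2 - b2)))
        by (rewrite !Rminus_diag, Rabs_R0; f_equal; ring).
      apply is_lim_seq_plus'; apply (is_lim_seq_abs _ (Finite _));
        apply is_lim_seq_minus'; auto using is_lim_seq_const. }
  destruct (choice _ Hlim) as [z Hz].
  assert (Hbd : forall eps, 0 < eps -> exists N, forall m, (N <= m)%nat ->
            forall M, sum_n (fun n => Cmod (Cminus (x m n) (z n)) ^ 2) M <= eps ^ 2).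
  { intros eps He. destruct (Hc eps He) as [N HN]. exists N. intros m Hm M.
    pose proof (sum_n_sqr_limit x z (x m) M Hz) as L.
    replace (sum_n (fun n => Cmod (Cminus (x m n) (z n)) ^ 2) M)
      with (sum_n (fun n => Cmod (Cminus (z n) (x m n)) ^ 2) M).
    2:{ apply sum_n_ext; intro n. rewrite <- Cmod_opp. do 2 f_equal. ring. }
    apply (is_lim_seq_le_loc _ (fun _ => eps ^ 2) _ (eps ^ 2)) with (2 := L);
      [| apply is_lim_seq_const].
    exists N. intros p Hp.
    apply Rle_trans with (nrm (vsub (x p) (x m)) ^ 2).
    - rewrite nrm_sqr by auto using l2_vsub.
      rewrite (sum_n_ext _ (fun n => Cmod (vsub (x p) (x m) n) ^ 2))
        by (intro n; rewrite vsub_coord; reflexivity).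
      apply partial_sum_le_Series; [intro; apply sqr_nonneg_Cmod |].
      apply l2_vsub; auto.
    - apply pow_incr. split; [apply nrm_ge0 | apply HN; assumption]. }
  assert (Hsub : forall (y : seqC) (c : R),
            (forall M, sum_n (fun n => Cmod (y n) ^ 2) M <= c) ->
            l2 y /\ nrm y ^ 2 <= c).
  { intros y c Hy.
    assert (Hex : ex_finite_lim_seq (sum_n (fun n => Cmod (y n) ^ 2))).
    { apply ex_finite_lim_seq_incr with c; [| exact Hy].
      intro n. rewrite sum_Sn. unfold plus; cbn -[pow].
      pose proof (sqr_nonneg_Cmod (y (S n))). lra. }
    assert (Hl2 : l2 y) by (destruct Hex as [b Hb]; exists b; exact Hb).
    split; [exact Hl2 |]. rewrite nrm_sqr by assumption.
    apply (is_lim_seq_le (sum_n (fun n => Cmod (y n) ^ 2)) (fun _ => c)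
             (Finite _) (Finite c));
      [exact Hy | apply Series_correct, Hl2 | apply is_lim_seq_const]. }
  assert (Hfin : forall eps, 0 < eps -> exists N, forall m, (N <= m)%nat ->
            l2 (vsub (x m) z) /\ nrm (vsub (x m) z) <= eps).
  { intros eps He. destruct (Hbd eps He) as [N HN]. exists N. intros m Hm.
    destruct (Hsub (vsub (x m) z) (eps ^ 2)) as [S1 S2].
    { intro M. rewrite (sum_n_ext _ (fun n => Cmod (Cminus (x m n) (z n)) ^ 2))
        by (intro n; rewrite vsub_coord; reflexivity). apply HN, Hm. }
    split; [exact S1 |]. apply Rsqr_incr_0_var; [unfold Rsqr; nra | lra]. }
  exists z. split.
  - destruct (Hfin 1 Rlt_0_1) as [N HN]. destruct (HN N (Nat.le_refl N)) as [L _].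
    replace z with (vsub (x N) (vsub (x N) z)).
    + apply l2_vsub; auto.
    + apply functional_extensionality; intro n. rewrite !vsub_coord. ring.
  - intros eps He. destruct (Hfin eps He) as [N HN]. exists N. intros m Hm.
    apply HN, Hm.
Qed.

(** * Projection onto the closed graph *)

Definition delta (m : nat) : seqC := fun n => if n =? m then RtoC 1 else RtoC 0.

Lemma D0_delta (m : nat) : D0 (delta m).
Proof.
  exists (S m). intros n Hn. unfold delta.
  destruct (Nat.eqb_spec n m); [lia | reflexivity].
Qed.

Lemma inner_delta (x : seqC) (m : nat) : inner x (delta m) = Cconj (x m).
Proof.
  assert (K : forall a : nat -> R, (forall n, n <> m -> a n = 0) -> Series a = a m).
  { intros a Ha. destruct m as [| m].
    - rewrite Series_incr_1.
      + rewrite Series_R0; [ring |]. intro n; apply Ha; lia.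
      + apply ex_series_finite with 1%nat. intros n Hn; apply Ha; lia.
    - rewrite (Series_incr_n_aux a (S m)) by (intros; apply Ha; lia).
      rewrite Series_incr_1.
      + rewrite Series_R0; [rewrite Nat.add_0_r; ring |]. intro n; apply Ha; lia.
      + apply ex_series_finite with 1%nat. intros n Hn; apply Ha; lia. }
  unfold inner, delta. rewrite !K.
  - rewrite Nat.eqb_refl. apply injective_projections; simpl; unfold Re, Im; simpl; ring.
  - intros n Hn. apply Nat.eqb_neq in Hn. rewrite Hn. unfold Im; simpl; ring.
  - intros n Hn. apply Nat.eqb_neq in Hn. rewrite Hn. unfold Re; simpl; ring.
Qed.

Lemma sumC_ext (d : nat) (a b : nat -> C) :
  (forall i, (i < d)%nat -> a i = b i) -> sumC d a = sumC d b.
Proof.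
  induction d as [| d IH]; intros H; [reflexivity |]. simpl.
  rewrite IH, H by (intros; try apply H; lia). reflexivity.
Qed.

Lemma sumC_0 (d : nat) (a : nat -> C) :
  (forall i, (i < d)%nat -> a i = RtoC 0) -> sumC d a = RtoC 0.
Proof.
  induction d as [| d IH]; intros H; [reflexivity |]. simpl.
  rewrite IH, H by (intros; try apply H; lia). ring.
Qed.

Lemma sumC_single (d m : nat) (a : nat -> C) : (m < d)%nat ->
  (forall i, (i < d)%nat -> i <> m -> a i = RtoC 0) -> sumC d a = a m.
Proof.
  induction d as [| d IH]; intros Hm H; [lia |]. simpl.
  destruct (Nat.eq_dec m d) as [-> | E].
  - rewrite sumC_0 by (intros; apply H; lia). ring.
  - rewrite IH by (intros; try apply H; lia). rewrite (H d) by lia. ring.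
Qed.

Lemma D0_expand (u : seqC) : D0 u -> exists N, u = vlin N u delta.
Proof.
  intros [N H]. exists N. apply functional_extensionality; intro n. unfold vlin.
  destruct (lt_dec n N) as [L | L].
  - rewrite (sumC_single N n); [| assumption |].
    + unfold delta. rewrite Nat.eqb_refl. ring.
    + intros i Hi Hn. unfold delta. destruct (Nat.eqb_spec n i); [lia | ring].
  - rewrite H by lia. rewrite sumC_0; [reflexivity |].
    intros i Hi. unfold delta. destruct (Nat.eqb_spec n i); [lia | ring].
Qed.

(* The fourth clause identifies the maximal operator [F] on its natural domain
   with the adjoint of the restriction of [F] to [D0]. *)
Definition formally_symmetric (F : seqC -> seqC) : Prop :=
  (forall x y, F (vadd x y) = vadd (F x) (F y)) /\
  (forall c x, F (vscal c x) = vscal c (F x)) /\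
  (forall u, D0 u -> D0 (F u)) /\
  (forall x y, l2 x -> l2 y ->
     ((forall u, D0 u -> inner x (F u) = inner y u) <-> y = F x)).

Definition opgraph (F : seqC -> seqC) : graph := fun u v => D0 u /\ v = F u.

Lemma fs_vsub (F : seqC -> seqC) (x y : seqC) :
  formally_symmetric F -> F (vsub x y) = vsub (F x) (F y).
Proof. intros [H1 [H2 _]]. unfold vsub. rewrite H1, H2. reflexivity. Qed.

Lemma adjoint_opgraph (F : seqC -> seqC) (x y : seqC) : formally_symmetric F ->
  (adjoint (opgraph F) x y <-> l2 x /\ l2 y /\ y = F x).
Proof.
  intros [_ [_ [_ H]]]. split.
  - intros [Hx [Hy K]]. do 2 (split; [assumption |]). apply H; auto.
    intros u Hu. apply K. split; auto.
  - intros [Hx [Hy E]]. do 2 (split; [assumption |]). intros u v [Hu ->].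
    apply (H x y Hx Hy); assumption.
Qed.

Lemma small_eq0 (z : C) (K : R) :
  0 <= K -> (forall eps, 0 < eps -> Cmod z <= eps * K) -> z = RtoC 0.
Proof.
  intros HK H. apply Cmod_eq_0. pose proof (Cmod_ge_0 z).
  destruct (Req_dec (Cmod z) 0) as [| E]; [assumption | exfalso].
  assert (Hp : 0 < Cmod z / (2 * (K + 1))) by (apply Rdiv_lt_0_compat; lra).
  specialize (H _ Hp).
  assert (E2 : Cmod z / (2 * (K + 1)) * (2 * (K + 1)) = Cmod z) by (field; lra).
  nra.
Qed.

(** The identity is exact on the approximating pairs of [G], so Cauchy-Schwarz bounds the defect by
    eps times [nrm x + nrm y] for every eps. *)
Lemma inner_closure_adjoint (G : graph) (u v x y : seqC) :
  gclosure G u v -> adjoint G x y -> inner x v = inner y u.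
Proof.
  intros [Hu [Hv Hc]] [Hx [Hy Ha]].
  apply Ceq_minus. apply small_eq0 with (nrm x + nrm y).
  - pose proof (nrm_ge0 x); pose proof (nrm_ge0 y); lra.
  - intros eps He. destruct (Hc eps He) as (u' & v' & HG & Hu' & Hv' & E1 & E2).
    rewrite vsub_minus in E1, E2.
    replace (inner x v - inner y u)%C with (inner x (vsub v v') - inner y (vsub u u'))%C.
    2:{ rewrite !inner_vsub_r, (Ha u' v' HG) by assumption. ring. }
    eapply Rle_trans; [apply Cmod_triangle |]. rewrite Cmod_opp.
    pose proof (cauchy_schwarz x (vsub v v') Hx (l2_vsub _ _ Hv Hv')).
    pose proof (cauchy_schwarz y (vsub u u') Hy (l2_vsub _ _ Hu Hu')).
    pose proof (nrm_ge0 x); pose proof (nrm_ge0 y). nra.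
Qed.

(** Every [u] in [D0] satisfies [adjoint (opgraph F) u (F u)], so it can be paired with a limit pair
    through [inner_closure_adjoint]. Combined with [adjoint_opgraph], this forces the second
    component of a closure pair to be [F w]. *)
Lemma closure_sub_adjoint (F : seqC -> seqC) (w w' : seqC) : formally_symmetric F ->
  gclosure (opgraph F) w w' -> adjoint (opgraph F) w w'.
Proof.
  intros HF Hw. pose proof HF as (_ & _ & HD & HA).
  destruct Hw as [Hl [Hl' Hc]].
  do 2 (split; [assumption |]). intros u v [Hu ->].
  rewrite (inner_conj _ w), (inner_conj _ w').
  assert (adjoint (opgraph F) u (F u)).
  { apply adjoint_opgraph; auto using l2_D0. }
  rewrite (inner_closure_adjoint (opgraph F) w w' u (F u)); auto.
  split; auto.
Qed.

Lemma graph_sub_closure (G : graph) (u v : seqC) :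
  l2 u -> l2 v -> G u v -> gclosure G u v.
Proof.
  intros Hu Hv HG. do 2 (split; [assumption |]). intros eps He. exists u, v.
  do 3 (split; [assumption |]). rewrite !vsub_minus.
  assert (Z : forall a, vsub a a = vzero).
  { intro a. apply functional_extensionality; intro n. rewrite vsub_coord.
    unfold vzero. ring. }
  rewrite !Z, nrm_vzero. split; assumption.
Qed.

Lemma nrm_lim (a w : seqC) (u : nat -> seqC) : l2 a -> l2 w -> (forall n, l2 (u n)) ->
  is_lim_seq (fun n => nrm (vsub (u n) w)) 0 ->
  is_lim_seq (fun n => nrm (vsub a (u n))) (nrm (vsub a w)).
Proof.
  intros Ha Hw Hu H. apply is_lim_seq_spec. intro eps.
  apply is_lim_seq_spec in H. destruct (H eps) as [N HN]. exists N. intros n Hn.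
  specialize (HN n Hn). rewrite Rminus_0_r, Rabs_pos_eq in HN by apply nrm_ge0.
  apply Rle_lt_trans with (2 := HN).
  assert (T1 : nrm (vsub a (u n)) <= nrm (vsub a w) + nrm (vsub (u n) w)).
  { rewrite (vsub_sym_nrm (u n) w) by auto.
    replace (vsub a (u n)) with (vadd (vsub a w) (vsub w (u n))).
    - apply nrm_triangle; auto using l2_vsub.
    - apply functional_extensionality; intro k. unfold vadd. rewrite !vsub_coord. ring. }
  assert (T2 : nrm (vsub a w) <= nrm (vsub a (u n)) + nrm (vsub (u n) w)).
  { replace (vsub a w) with (vadd (vsub a (u n)) (vsub (u n) w)).
    - apply nrm_triangle; auto using l2_vsub.
    - apply functional_extensionality; intro k. unfold vadd. rewrite !vsub_coord. ring. }
  apply Rabs_le; lra.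
Qed.

Lemma nrm_sqr_lim (a w : seqC) (u : nat -> seqC) : l2 a -> l2 w -> (forall n, l2 (u n)) ->
  is_lim_seq (fun n => nrm (vsub (u n) w)) 0 ->
  is_lim_seq (fun n => nrm (vsub a (u n)) ^ 2) (nrm (vsub a w) ^ 2).
Proof.
  intros Ha Hw Hu H. pose proof (nrm_lim a w u Ha Hw Hu H) as L. simpl.
  apply is_lim_seq_mult'; [exact L |].
  apply is_lim_seq_mult'; [exact L | apply is_lim_seq_const].
Qed.

Lemma nrm_vsub_scal_sqr (a b : seqC) (t : C) : l2 a -> l2 b ->
  nrm (vsub a (vscal t b)) ^ 2 =
  nrm a ^ 2 + Cmod t ^ 2 * nrm b ^ 2 - 2 * Re (Cmult t (inner a b)).
Proof.
  intros Ha Hb. unfold vsub.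
  rewrite nrm_vadd_sqr, !nrm_vscal, !inner_vscal_r by (auto using l2_vscal).
  rewrite RtoC_m1, Cmod_m1. destruct t, (inner a b); unfold Re; simpl; ring.
Qed.

(** Projection theorem in the product space. A minimizing sequence for the distance from [(x, y)] to
    the pairs [(u, F u)] with [u] in [D0] is Cauchy by the parallelogram law, and the first
    variation at its limit is the orthogonality relation. *)
Lemma graph_projection (F : seqC -> seqC) (x y : seqC) :
  formally_symmetric F -> l2 x -> l2 y ->
  exists w w', gclosure (opgraph F) w w' /\
    forall v, D0 v -> Cplus (inner (vsub x w) v) (inner (vsub y w') (F v)) = RtoC 0.
Proof.
  intros HF Hx Hy. pose proof HF as (Fadd & Fscal & FD & _).
  assert (Fl2 : forall u, D0 u -> l2 (F u)) by (intros; apply l2_D0; auto).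
  set (N2 := fun u => nrm (vsub x u) ^ 2 + nrm (vsub y (F u)) ^ 2).
  assert (N2pos : forall u, 0 <= N2 u).
  { intro u. unfold N2. pose proof (pow2_ge_0 (nrm (vsub x u))).
    pose proof (pow2_ge_0 (nrm (vsub y (F u)))). lra. }
  (* The infimum of [N2] on [D0] is obtained as minus the supremum of [- N2 u]. *)
  destruct (completeness (fun r => exists u, D0 u /\ r = - N2 u)) as [m0 [Hub Hlub]].
  { exists 0. intros r [u [_ ->]]. specialize (N2pos u). lra. }
  { exists (- N2 vzero), vzero. split; [apply D0_vzero | reflexivity]. }
  set (m := - m0).
  assert (Hm : forall u, D0 u -> m <= N2 u).
  { intros u Hu. specialize (Hub (- N2 u) (ex_intro _ u (conj Hu eq_refl))).
    unfold m; lra. }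
  assert (Hmin : forall n, exists u, D0 u /\ N2 u <= m + / (INR n + 1)).
  { intro n. assert (P : 0 < / (INR n + 1)) by (apply Rinv_0_lt_compat; pose proof (pos_INR n); lra).
    destruct (classic (exists u, D0 u /\ N2 u <= m + / (INR n + 1))) as [| No]; [assumption |].
    exfalso. assert (m0 <= m0 - / (INR n + 1)); [| lra].
    apply Hlub. intros r [u [Hu ->]].
    destruct (Rle_dec (N2 u) (m + / (INR n + 1))) as [L | L].
    - exfalso; apply No; exists u; auto.
    - unfold m in L; lra. }
  destruct (choice _ Hmin) as [u Hu].
  assert (Hul : forall n, l2 (u n)) by (intro n; apply l2_D0, Hu).
  assert (HFul : forall n, l2 (F (u n))) by (intro n; apply Fl2, Hu).
  (* The midpoint of [a] and [b] lies in [D0], so its squared distance is at least [m]; the identity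
     [Q] is used once in each component. *)
  assert (Hpar : forall a b, D0 a -> D0 b ->
            nrm (vsub a b) ^ 2 + nrm (vsub (F a) (F b)) ^ 2 <= 2 * N2 a + 2 * N2 b - 4 * m).
  { intros a b Ha Hb.
    set (c := vscal (RtoC (/ 2)) (vadd a b)).
    assert (Hc : D0 c) by (apply D0_vscal, D0_vadd; assumption).
    pose proof (Hm c Hc) as Mc. unfold N2 in Mc |- *.
    assert (Q : forall z p q, l2 z -> l2 p -> l2 q ->
              4 * nrm (vsub z (vscal (RtoC (/ 2)) (vadd p q))) ^ 2 + nrm (vsub p q) ^ 2 =
              2 * nrm (vsub z p) ^ 2 + 2 * nrm (vsub z q) ^ 2).
    { intros z p q Hz Hp Hq.
      rewrite <- nrm_parallelogram by (auto using l2_vsub).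
      replace (vadd (vsub z p) (vsub z q))
        with (vscal (RtoC 2) (vsub z (vscal (RtoC (/ 2)) (vadd p q)))).
      - rewrite nrm_vscal by (auto using l2_vsub, l2_vscal, l2_vadd).
        rewrite Cmod_R, (Rabs_pos_eq 2) by lra.
        rewrite (vsub_sym_nrm p q) by assumption.
        replace (vsub (vsub z p) (vsub z q)) with (vsub q p); [ring |].
        apply functional_extensionality; intro k. rewrite !vsub_coord. ring.
      - apply functional_extensionality; intro k.
        unfold vadd, vscal. rewrite !vsub_coord. unfold vadd, vscal.
        apply injective_projections; simpl; field. }
    pose proof (Q x a b Hx (l2_D0 _ Ha) (l2_D0 _ Hb)) as Q1.
    pose proof (Q y (F a) (F b) Hy (Fl2 _ Ha) (Fl2 _ Hb)) as Q2.
    unfold c in Mc. rewrite Fscal, Fadd in Mc. lra. }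
  assert (Hcau : forall eps, 0 < eps -> exists N, forall i j, (N <= i)%nat -> (N <= j)%nat ->
            nrm (vsub (u i) (u j)) <= eps /\ nrm (vsub (F (u i)) (F (u j))) <= eps).
  { intros eps He.
    assert (P : 0 < eps ^ 2 / 4) by nra.
    destruct (INR_unbounded (/ (eps ^ 2 / 4))) as [N HN].
    assert (HK : forall i, (N <= i)%nat -> / (INR i + 1) <= eps ^ 2 / 4).
    { intros i Hi. rewrite <- (Rinv_inv (eps ^ 2 / 4)).
      apply Rinv_le_contravar; [apply Rinv_0_lt_compat; assumption |].
      apply le_INR in Hi. lra. }
    exists N. intros i j Hi Hj.
    pose proof (Hpar (u i) (u j) (proj1 (Hu i)) (proj1 (Hu j))) as B.
    pose proof (HK i Hi). pose proof (HK j Hj).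
    destruct (Hu i) as [_ Bi]. destruct (Hu j) as [_ Bj].
    pose proof (pow2_ge_0 (nrm (vsub (u i) (u j)))).
    pose proof (pow2_ge_0 (nrm (vsub (F (u i)) (F (u j))))).
    split; (apply Rsqr_incr_0_var; [unfold Rsqr; lra | lra]). }
  destruct (complete_l2 u Hul) as (w & Hw & Lw).
  { intros eps He. destruct (Hcau eps He) as [N HN]. exists N. intros i j Hi Hj. exact (proj1 (HN i j Hi Hj)). }
  destruct (complete_l2 (fun n => F (u n)) HFul) as (w' & Hw' & Lw').
  { intros eps He. destruct (Hcau eps He) as [N HN]. exists N. intros i j Hi Hj. exact (proj2 (HN i j Hi Hj)). }
  assert (tolim : forall (a : nat -> seqC) z,
            (forall eps, 0 < eps -> exists N, forall k, (N <= k)%nat -> nrm (vsub (a k) z) <= eps) ->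
            is_lim_seq (fun n => nrm (vsub (a n) z)) 0).
  { intros a z H. apply is_lim_seq_spec. intro eps.
    assert (P : 0 < eps / 2) by (destruct eps; simpl; lra).
    destruct (H _ P) as [N HN]. exists N. intros k Hk. specialize (HN k Hk).
    rewrite Rminus_0_r, Rabs_pos_eq by apply nrm_ge0. destruct eps; simpl in *; lra. }
  pose proof (tolim _ _ Lw) as Tw. pose proof (tolim _ _ Lw') as Tw'.
  exists w, w'. split.
  - do 2 (split; [assumption |]). intros eps He.
    assert (P : 0 < eps / 2) by lra.
    destruct (Lw _ P) as [N1 HN1]. destruct (Lw' _ P) as [N3 HN3].
    set (n := max N1 N3).
    exists (u n), (F (u n)). rewrite !vsub_minus.
    rewrite (vsub_sym_nrm w), (vsub_sym_nrm w') by auto.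
    specialize (HN1 n (Nat.le_max_l _ _)). specialize (HN3 n (Nat.le_max_r _ _)).
    cbv beta in *.
    repeat split; auto; try lra. apply Hu.
  - intros v Hv.
    set (z := Cplus (inner (vsub x w) v) (inner (vsub y w') (F v))).
    set (B := nrm v ^ 2 + nrm (F v) ^ 2).
    assert (Hmw : nrm (vsub x w) ^ 2 + nrm (vsub y w') ^ 2 <= m).
    { apply (is_lim_seq_le (fun n => N2 (u n)) (fun n => m + / (INR n + 1))
               (Finite _) (Finite m)).
      - intro n. apply Hu.
      - apply is_lim_seq_plus'; [exact (nrm_sqr_lim x w u Hx Hw Hul Tw) |].
        exact (nrm_sqr_lim y w' (fun n => F (u n)) Hy Hw' HFul Tw').
      - replace (Finite m) with (Finite (m + 0)) by (f_equal; ring).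
        apply is_lim_seq_plus'; [apply is_lim_seq_const |].
        apply (is_lim_seq_ext (fun n => / INR (S n))).
        + intro n. rewrite S_INR. reflexivity.
        + apply (is_lim_seq_incr_1 (fun n => / INR n)).
          replace (Finite 0) with (Rbar_inv p_infty) by reflexivity.
          apply is_lim_seq_inv; [apply is_lim_seq_INR | discriminate]. }
    assert (Hvar : forall t, m <= nrm (vsub (vsub x (vscal t v)) w) ^ 2
                             + nrm (vsub (vsub y (vscal t (F v))) w') ^ 2).
    { intro t.
      assert (E : forall a b c, vsub (vsub a b) c = vsub a (vadd c b)).
      { intros; apply functional_extensionality; intro k.
        unfold vadd. rewrite !vsub_coord. ring. }
      apply (is_lim_seq_le (fun _ => m) (fun n => N2 (vadd (u n) (vscal t v)))
               (Finite m) (Finite _)).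
      - intro n. apply Hm, D0_vadd; [apply Hu | apply D0_vscal, Hv].
      - apply is_lim_seq_const.
      - unfold N2. apply is_lim_seq_plus'.
        + apply is_lim_seq_ext with (fun n => nrm (vsub (vsub x (vscal t v)) (u n)) ^ 2).
          * intro n. rewrite E. reflexivity.
          * apply nrm_sqr_lim; auto using l2_vsub, l2_vscal, l2_D0.
        + apply is_lim_seq_ext with
            (fun n => nrm (vsub (vsub y (vscal t (F v))) (F (u n))) ^ 2).
          * intro n. rewrite E, Fadd, Fscal. reflexivity.
          * apply (nrm_sqr_lim (vsub y (vscal t (F v))) w' (fun n => F (u n)));
              auto using l2_vsub, l2_vscal. }
    (* Variation along [v] with [t = s conj z]: the linear term becomes [- 2 s |z|^2] and the
       quadratic one [s^2 |z|^2 B]. *)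
    assert (Hineq : forall s, 0 < s -> 2 * s * Cmod z ^ 2 <= s ^ 2 * Cmod z ^ 2 * B).
    { intros s Hs. specialize (Hvar (Cmult (RtoC s) (Cconj z))).
      set (t := Cmult (RtoC s) (Cconj z)) in Hvar.
      assert (E : forall a b c, vsub (vsub a b) c = vsub (vsub a c) b).
      { intros; apply functional_extensionality; intro k. rewrite !vsub_coord. ring. }
      rewrite !(E _ (vscal _ _)), !nrm_vsub_scal_sqr in Hvar
        by (auto using l2_vsub, l2_D0).
      assert (Et : Cmod t ^ 2 = s ^ 2 * Cmod z ^ 2).
      { unfold t. rewrite Cmod_mult, Cmod_conj, Cmod_R, Rabs_pos_eq by lra. ring. }
      rewrite Et in Hvar.
      assert (Er : Re (Cmult t (inner (vsub x w) v)) + Re (Cmult t (inner (vsub y w') (F v)))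
                   = s * Cmod z ^ 2).
      { transitivity (Re (Cmult t z)).
        - unfold z. rewrite Cmult_plus_distr_l. reflexivity.
        - unfold t. rewrite Cmod2_alt. destruct z; unfold Re, Im; simpl; ring. }
      unfold B. nra. }
    apply Cmod_eq_0.
    assert (HB : 0 <= B) by (unfold B; pose proof (pow2_ge_0 (nrm v)); pose proof (pow2_ge_0 (nrm (F v))); lra).
    (* With this step size [s B < 1], so the linear term beats the quadratic one unless [z = 0]. *)
    assert (Hs : 0 < / (B + 1)) by (apply Rinv_0_lt_compat; lra).
    specialize (Hineq _ Hs).
    set (s := / (B + 1)) in *.
    assert (Es : s * (B + 1) = 1) by (unfold s; field; lra).
    assert (s * Cmod z ^ 2 <= 0) by nra.
    assert (Cmod z ^ 2 <= 0) by nra. nra.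
Qed.

(** The residual [r] of the projection satisfies [<r, v> + <F r, F v> = 0] for all [v] in [D0],
    which says that [F r] lies in the domain of the adjoint with image [- r]. The components [p] and
    [q] are then the images of [r] under [(1 - i F) / 2] and [(1 + i F) / 2]. *)
Lemma von_neumann_decomposition (F : seqC -> seqC) (x : seqC) :
  formally_symmetric F -> l2 x -> l2 (F x) ->
  exists w p q, gclosure (opgraph F) w (F w) /\
    l2 p /\ F p = vscal Ci p /\ l2 q /\ F q = vscal (Copp Ci) q /\
    x = vadd w (vadd p q).
Proof.
  intros HF Hx HFx. pose proof HF as (Fadd & Fscal & FD & HA).
  destruct (graph_projection F x (F x) HF Hx HFx) as (w & w' & Hc & Ho).
  pose proof (closure_sub_adjoint F w w' HF Hc) as Hadj.
  apply (adjoint_opgraph F w w' HF) in Hadj. destruct Hadj as (Hw & Hw' & ->).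
  rewrite <- fs_vsub in Ho by assumption.
  set (r := vsub x w) in *.
  assert (Hr : l2 r) by (apply l2_vsub; assumption).
  assert (HFr : l2 (F r)) by (unfold r; rewrite fs_vsub by assumption; apply l2_vsub; assumption).
  assert (E : vscal (RtoC (-1)) r = F (F r)).
  { apply (HA (F r) (vscal (RtoC (-1)) r)); auto using l2_vscal.
    intros u Hu. rewrite inner_vscal_l by (auto using l2_D0).
    specialize (Ho u Hu).
    replace (inner (F r) (F u)) with (inner r u + inner (F r) (F u) - inner r u)%C by ring.
    rewrite Ho. rewrite RtoC_m1.
    apply injective_projections; simpl; ring. }
  exists w, (vscal (RtoC (/ 2)) (vsub r (vscal Ci (F r)))),
    (vscal (RtoC (/ 2)) (vadd r (vscal Ci (F r)))).
  assert (Ci2 : (Ci * Ci = - RtoC 1)%C) by (apply injective_projections; simpl; ring).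
  repeat split; auto using l2_vscal, l2_vsub, l2_vadd; try apply Hc.
  - rewrite Fscal, fs_vsub, Fscal, <- E by assumption.
    apply functional_extensionality; intro n. unfold vscal. rewrite !vsub_coord.
    unfold vscal. rewrite RtoC_m1. apply injective_projections; simpl; ring.
  - rewrite Fscal, Fadd, Fscal, <- E.
    apply functional_extensionality; intro n. unfold vscal, vadd.
    unfold vscal. rewrite RtoC_m1. apply injective_projections; simpl; ring.
  - apply functional_extensionality; intro n. unfold vscal, vadd, r. rewrite !vsub_coord.
    unfold vscal. apply injective_projections; simpl; field.
Qed.

(** * The formal matrix of A *)

Lemma poch_pos_ge1 (x : Z) (s : nat) : (1 <= x)%Z -> 1 <= poch_pos x s.
Proof.
  intros Hx. induction s as [| s IH]; simpl; [lra |].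
  assert (1 <= IZR (x + Z.of_nat s)) by (apply IZR_le; lia). nra.
Qed.

Lemma poch_pos_Sl (x : Z) (s : nat) : poch_pos x (S s) = IZR x * poch_pos (x + 1) s.
Proof.
  induction s as [| s IH].
  - simpl. rewrite Z.add_0_r. ring.
  - change (poch_pos x (S (S s))) with (poch_pos x (S s) * IZR (x + Z.of_nat (S s))).
    rewrite IH. simpl (poch_pos (x + 1) (S s)).
    replace (x + Z.of_nat (S s))%Z with (x + 1 + Z.of_nat s)%Z by lia. ring.
Qed.

Lemma poch_pos_0 (s : nat) : (0 < s)%nat -> poch_pos 0 s = 0.
Proof. destruct s; [lia |]. intros _. rewrite poch_pos_Sl. ring. Qed.

Lemma poch_ge1 (x : Z) (s : nat) : (1 <= x)%Z -> poch x s = poch_pos x s.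
Proof. intros H. unfold poch. destruct (Z.ltb_spec x 0); [lia | reflexivity]. Qed.

(** Two causes of vanishing meet here: the convention for negative arguments when [n + 1 < l], and a
    zero first factor when [n + 1 = l]. *)
Lemma beta_lt (k l n : nat) : (n < l)%nat -> beta k l n = 0.
Proof.
  intros H. unfold beta, poch.
  destruct (Z.ltb_spec (Z.of_nat n - Z.of_nat l + 1) 0).
  - rewrite Rmult_0_l. apply sqrt_0.
  - replace (Z.of_nat n - Z.of_nat l + 1)%Z with 0%Z by lia.
    rewrite poch_pos_0 by lia. rewrite Rmult_0_l. apply sqrt_0.
Qed.

Lemma beta_ge (k l n : nat) : (l <= n)%nat ->
  beta k l n = sqrt (poch_pos (Z.of_nat (n - l) + 1) l) * sqrt (poch_pos (Z.of_nat (n - l) + 1) k).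
Proof.
  intros H. unfold beta. rewrite !poch_ge1 by lia.
  replace (Z.of_nat n - Z.of_nat l + 1)%Z with (Z.of_nat (n - l) + 1)%Z by lia.
  apply sqrt_mult; eapply Rle_trans; try apply poch_pos_ge1; lra || lia.
Qed.

(** Hermitian symmetry of the matrix: the raising coefficient from site [m + l] to site [m + k]
    equals the lowering coefficient back. *)
Lemma beta_swap (k l m : nat) : beta l k (m + k) = beta k l (m + l).
Proof.
  rewrite !beta_ge by lia. rewrite !Nat.add_sub. ring.
Qed.

Lemma iter_aop (l : nat) (u : seqC) (m : nat) :
  Nat.iter l aop u m = Cmult (RtoC (sqrt (poch_pos (Z.of_nat m + 1) l))) (u (m + l)%nat).
Proof.
  revert m. induction l as [| l IH]; intro m.
  - simpl. rewrite sqrt_1, Nat.add_0_r. ring.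
  - change (Nat.iter (S l) aop u) with (aop (Nat.iter l aop u)). unfold aop at 1.
    rewrite IH, poch_pos_Sl.
    rewrite sqrt_mult.
    + rewrite RtoC_mult.
      replace (IZR (Z.of_nat m + 1)) with (INR (S m)) by (rewrite INR_IZR_INZ; f_equal; lia).
      replace (Z.of_nat (S m)) with (Z.of_nat m + 1)%Z by lia.
      replace (S m + l)%nat with (m + S l)%nat by lia. ring.
    + apply IZR_le; lia.
    + eapply Rle_trans; [| apply poch_pos_ge1]; [lra | lia].
Qed.

Lemma iter_adag (k : nat) (u : seqC) (m : nat) :
  Nat.iter k adag u m =
  if (k <=? m)%nat
  then Cmult (RtoC (sqrt (poch_pos (Z.of_nat (m - k) + 1) k))) (u (m - k)%nat)
  else RtoC 0.
Proof.
  revert m. induction k as [| k IH]; intro m.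
  - simpl. rewrite sqrt_1, Nat.sub_0_r. ring.
  - change (Nat.iter (S k) adag u) with (adag (Nat.iter k adag u)).
    destruct m as [| m]; [reflexivity |].
    change (adag (Nat.iter k adag u) (S m))
      with (Cmult (RtoC (sqrt (INR (S m)))) (Nat.iter k adag u m)).
    rewrite IH. simpl (S k <=? S m). destruct (Nat.leb_spec k m) as [L | L]; [| ring].
    simpl (S m - S k)%nat.
    change (poch_pos (Z.of_nat (m - k) + 1) (S k))
      with (poch_pos (Z.of_nat (m - k) + 1) k * IZR (Z.of_nat (m - k) + 1 + Z.of_nat k)).
    rewrite sqrt_mult.
    + replace (IZR (Z.of_nat (m - k) + 1 + Z.of_nat k)) with (INR (S m))
        by (rewrite INR_IZR_INZ; f_equal; lia).
      rewrite RtoC_mult. ring.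
    + eapply Rle_trans; [| apply poch_pos_ge1]; [lra | lia].
    + apply IZR_le; lia.
Qed.

(** The truncated subtraction in the index is harmless, because [beta l k n] is zero for [n < k]. *)
Lemma ladder_formula (k l : nat) (u : seqC) (n : nat) :
  Nat.iter k adag (Nat.iter l aop u) n = Cmult (RtoC (beta l k n)) (u (n - k + l)%nat).
Proof.
  rewrite iter_adag. destruct (Nat.leb_spec k n) as [L | L].
  - rewrite iter_aop, beta_ge, RtoC_mult by assumption. ring.
  - rewrite beta_lt by assumption. ring.
Qed.

Lemma Aop_formula (k l : nat) (theta : R) (f : nat -> R) (u : seqC) (n : nat) :
  Aop k l theta f u n =
  Cplus (Cplus (Cmult (xi theta) (Cmult (RtoC (beta l k n)) (u (n - k + l)%nat)))
               (Cmult (Cconj (xi theta)) (Cmult (RtoC (beta k l n)) (u (n - l + k)%nat))))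
        (Cmult (RtoC (f n)) (u n)).
Proof. unfold Aop. rewrite !ladder_formula. reflexivity. Qed.

Lemma Aop_vadd k l theta f (x y : seqC) :
  Aop k l theta f (vadd x y) = vadd (Aop k l theta f x) (Aop k l theta f y).
Proof.
  apply functional_extensionality; intro n. unfold vadd at 2.
  rewrite !Aop_formula. unfold vadd. ring.
Qed.

Lemma Aop_vscal k l theta f (c : C) (x : seqC) :
  Aop k l theta f (vscal c x) = vscal c (Aop k l theta f x).
Proof.
  apply functional_extensionality; intro n. unfold vscal at 2.
  rewrite !Aop_formula. unfold vscal. ring.
Qed.

Lemma Aop_D0 k l theta f (u : seqC) : D0 u -> D0 (Aop k l theta f u).
Proof.
  intros [N H]. exists (N + k + l)%nat. intros n Hn.
  rewrite Aop_formula, !H by lia. ring.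
Qed.

Lemma Aop_delta k l theta f (m : nat) :
  Aop k l theta f (delta m) =
  vadd (vadd (vscal (Cmult (xi theta) (RtoC (beta k l m))) (delta (m - l + k)))
             (vscal (Cmult (Cconj (xi theta)) (RtoC (beta l k m))) (delta (m - k + l))))
       (vscal (RtoC (f m)) (delta m)).
Proof.
  apply functional_extensionality; intro n.
  rewrite Aop_formula. unfold vadd, vscal.
  (* Both sides vanish unless [n = j + k] and [m = j + l] for a common [j], and there [beta_swap]
     applies. *)
  assert (K : forall k l, Cmult (RtoC (beta l k n)) (delta m (n - k + l)%nat) =
                          Cmult (RtoC (beta k l m)) (delta (m - l + k) n)).
  { clear. intros k l. unfold delta.
    destruct (le_lt_dec k n) as [Hn | Hn]; destruct (le_lt_dec l m) as [Hm | Hm].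
    - destruct (Nat.eqb_spec (n - k + l) m) as [E | E];
        destruct (Nat.eqb_spec n (m - l + k)) as [E' | E']; try lia; [| ring].
      replace n with ((n - k) + k)%nat by lia. rewrite beta_swap.
      replace m with ((n - k) + l)%nat by lia. reflexivity.
    - rewrite (beta_lt k l m) by lia.
      destruct (Nat.eqb_spec (n - k + l) m) as [E | E]; [lia | ring].
    - rewrite (beta_lt l k n) by lia.
      destruct (Nat.eqb_spec n (m - l + k)) as [E | E]; [lia | ring].
    - rewrite !beta_lt by lia. ring. }
  rewrite (K k l), (K l k).
  replace (Cmult (RtoC (f n)) (delta m n)) with (Cmult (RtoC (f m)) (delta m n)).
  - ring.
  - unfold delta. destruct (Nat.eqb_spec n m) as [-> |]; ring.
Qed.

Lemma inner_Aop_delta k l theta f (x : seqC) (m : nat) : l2 x ->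
  inner x (Aop k l theta f (delta m)) = Cconj (Aop k l theta f x m).
Proof.
  intros Hx. pose proof (fun j => l2_D0 _ (D0_delta j)) as Hd.
  rewrite Aop_delta, !inner_vadd_r, !inner_vscal_r, !inner_delta
    by auto using l2_vadd, l2_vscal.
  rewrite Aop_formula, !Cplus_conj, !Cmult_conj, Cconj_conj.
  assert (R : forall r : R, Cconj (RtoC r) = RtoC r)
    by (intro r; apply injective_projections; simpl; ring).
  rewrite !R. ring.
Qed.

(** Testing against the vectors [delta m] reads off the coordinates of [y] one by one, since a
    column of the matrix has finitely many entries and is conjugate to the corresponding row.
    Conversely, these vectors span [D0]. *)
Lemma Aop_formally_symmetric k l theta f : formally_symmetric (Aop k l theta f).
Proof.
  split; [apply Aop_vadd |]. split; [apply Aop_vscal |]. split; [apply Aop_D0 |].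
  intros x y Hx Hy. split.
  - intros K. apply functional_extensionality; intro m.
    specialize (K (delta m) (D0_delta m)).
    rewrite inner_Aop_delta, inner_delta in K by assumption.
    rewrite <- (Cconj_conj (y m)), <- K, Cconj_conj. reflexivity.
  - intros -> u Hu.
    assert (E : forall d c, Aop k l theta f (vlin d c delta) =
                            vlin d c (fun i => Aop k l theta f (delta i))).
    { intros d c. induction d as [| d IH].
      - change (vlin 0 c delta) with vzero.
        replace vzero with (vscal (RtoC 0) vzero)
          by (apply functional_extensionality; intro n; unfold vscal, vzero; ring).
        rewrite Aop_vscal. apply functional_extensionality; intro n.
        unfold vscal, vlin; simpl. ring.
      - rewrite !vlin_S, Aop_vadd, Aop_vscal, IH. reflexivity. }
    destruct (D0_expand u Hu) as [N ->].
    rewrite E, !inner_vlin_r; auto using l2_D0, D0_delta, Aop_D0.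
    apply sumC_ext. intros i _. rewrite inner_Aop_delta, inner_delta by assumption.
    reflexivity.
Qed.

(** * The energy estimate *)

(** The inequality [1 + e <= exp e] turns the product of the growth factors into the exponential of
    a convergent sum. *)
Lemma gronwall_product (h e : nat -> R) :
  (forall r, 0 <= h r) -> (forall r, 0 <= e r) -> ex_series e ->
  (forall r, h (S r) <= (1 + e r) * h r) -> exists M, forall r, h r <= M.
Proof.
  intros Hh He Hs Hstep.
  assert (K : forall r, h (S r) <= h 0%nat * exp (sum_n e r)).
  { induction r as [| r IH].
    - rewrite sum_O. specialize (Hstep 0%nat). pose proof (exp_ineq1_le (e 0%nat)).
      specialize (Hh 0%nat). nra.
    - rewrite sum_Sn. unfold plus; simpl. rewrite exp_plus.
      specialize (Hstep (S r)). pose proof (exp_ineq1_le (e (S r))) as B.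
      pose proof (He (S r)). pose proof (Hh (S r)). pose proof (Hh 0%nat).
      pose proof (exp_pos (sum_n e r)). pose proof (exp_pos (e (S r))).
      apply Rle_trans with (1 := Hstep).
      apply Rle_trans with (exp (e (S r)) * h (S r)); [nra |].
      apply Rle_trans with (exp (e (S r)) * (h 0%nat * exp (sum_n e r))); [nra |].
      apply Req_le; ring. }
  exists (h 0%nat * exp (Series e)). intros [| r].
  - assert (0 <= Series e) by (apply Series_nonneg; assumption).
    pose proof (exp_ineq1_le (Series e)). specialize (Hh 0%nat). nra.
  - eapply Rle_trans; [apply K |]. apply Rmult_le_compat_l; [apply Hh |].
    pose proof (partial_sum_le_Series e r He Hs) as [L | L];
      [left; apply exp_increasing, L | rewrite L; lra].
Qed.

Definition energy (a s0 s1 c p0 p1 : R) : R := a * (s0 * (p1 ^ 2 + c * p1 * p0) + p0 ^ 2 / s1).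

(** The margins are tuned to each other: [/ s1 >= 1 - eta], and the cross term costs at most
    [(1 - 2 eta) (p0^2 + p1^2)], which leaves [eta] in front of [p0^2] and [2 eta] in front of
    [p1^2]. *)
Lemma energy_coercive (a s0 s1 c p0 p1 eta : R) :
  0 < a -> 0 < eta <= 1 -> 1 <= s0 -> 1 <= s1 <= 1 + eta -> 0 <= s0 * c <= 2 - 4 * eta ->
  eta * a * (p0 ^ 2 + p1 ^ 2) <= energy a s0 s1 c p0 p1.
Proof.
  intros Ha He H0 H1 Hc. unfold energy.
  assert (Hi : 1 - eta <= / s1).
  { apply Rmult_le_reg_r with s1; [lra |]. rewrite Rinv_l by lra. nra. }
  replace (eta * a * (p0 ^ 2 + p1 ^ 2)) with (a * (eta * (p0 ^ 2 + p1 ^ 2))) by ring.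
  apply Rmult_le_compat_l; [lra |]. unfold Rdiv.
  assert (p0 ^ 2 * (1 - eta) <= p0 ^ 2 * / s1)
    by (apply Rmult_le_compat_l; [apply pow2_ge_0 | assumption]).
  assert (p1 ^ 2 <= s0 * p1 ^ 2) by (pose proof (pow2_ge_0 p1); nra).
  assert (- ((1 - 2 * eta) * (p1 ^ 2 + p0 ^ 2)) <= s0 * c * (p1 * p0)).
  { set (t := s0 * c) in *. pose proof (pow2_ge_0 (p1 + p0)). pose proof (pow2_ge_0 (p1 - p0)).
    assert (- (p1 ^ 2 + p0 ^ 2) <= 2 * (p1 * p0)) by nra.
    assert (0 <= p1 ^ 2 + p0 ^ 2) by (pose proof (pow2_ge_0 p1); pose proof (pow2_ge_0 p0); lra).
    nra. }
  nra.
Qed.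

(** For [g = 0] the recurrence gives [s1^2 a s1 p2 (p2 + c1 p1) = - a s1 p2 p0 = a (s1 c1 p1 p0 +
    p0^2 / s1)]. The [p0^2] terms of the two energies therefore cancel, and what remains is
    [a p1 p0 (s1 c1 - s0 c0)] and [a p1^2 (s1^2 / s2 - s0)], both governed by the drift of [s] and
    [c]. The inhomogeneity [g] stands for the spectral term and contributes without the factor
    [a]. *)
Lemma energy_step (a s0 s1 s2 c0 c1 p0 p1 p2 g : R) :
  1 <= a -> 1 <= s2 -> s2 <= s1 -> s1 <= s0 -> s0 <= 2 -> 0 <= s1 * c1 <= 2 ->
  s1 ^ 2 * a * p2 + c1 * (s1 ^ 2 * a) * p1 + a * p0 = g ->
  energy (s1 ^ 2 * a) s1 s2 c1 p1 p2 - energy a s0 s1 c0 p0 p1 <=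
  a * (Rabs (s1 * c1 - s0 * c0) + 2 * (s0 - s2)) * (p0 ^ 2 + p1 ^ 2)
  + 4 * (p0 ^ 2 + p1 ^ 2 + g ^ 2).
Proof.
  intros Ha H2 H12 H01 H0 Hc Heq. unfold energy.
  assert (Hp2 : p2 = (g / a - p0) / s1 ^ 2 - c1 * p1) by (rewrite <- Heq; field; lra).
  replace (s1 ^ 2 * a * (s1 * (p2 ^ 2 + c1 * p2 * p1) + p1 ^ 2 / s2)
           - a * (s0 * (p1 ^ 2 + c0 * p1 * p0) + p0 ^ 2 / s1))
    with (a * (p1 * p0 * (s1 * c1 - s0 * c0)) + a * (p1 ^ 2 * (s1 ^ 2 / s2 - s0))
          + (- 2 * (g * p0) * / s1 + g ^ 2 * / (a * s1) - s1 * c1 * (p1 * g)))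
    by (rewrite Hp2; field; lra).
  pose proof (pow2_ge_0 p0). pose proof (pow2_ge_0 p1). pose proof (pow2_ge_0 g).
  assert (T1 : p1 * p0 * (s1 * c1 - s0 * c0) <= Rabs (s1 * c1 - s0 * c0) * (p0 ^ 2 + p1 ^ 2)).
  { pose proof (Rle_abs (s1 * c1 - s0 * c0)).
    pose proof (Rle_abs (- (s1 * c1 - s0 * c0))) as B. rewrite Rabs_Ropp in B.
    set (t := s1 * c1 - s0 * c0) in *. set (T := Rabs t) in *.
    pose proof (pow2_ge_0 (p0 - p1)). pose proof (pow2_ge_0 (p0 + p1)).
    assert (p1 * p0 <= p0 ^ 2 + p1 ^ 2) by nra.
    assert (- (p1 * p0) <= p0 ^ 2 + p1 ^ 2) by nra.
    destruct (Rle_dec 0 (p1 * p0)); nra. }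
  assert (T2 : p1 ^ 2 * (s1 ^ 2 / s2 - s0) <= 2 * (s0 - s2) * (p0 ^ 2 + p1 ^ 2)).
  { assert (s1 ^ 2 / s2 - s0 <= 2 * (s0 - s2)).
    { apply Rmult_le_reg_r with s2; [lra |].
      replace ((s1 ^ 2 / s2 - s0) * s2) with (s1 ^ 2 - s0 * s2) by (field; lra). nra. }
    assert (0 <= 2 * (s0 - s2)) by lra. nra. }
  assert (I1 : 0 < / s1 <= 1).
  { split; [apply Rinv_0_lt_compat; lra |].
    rewrite <- Rinv_1. apply Rinv_le_contravar; lra. }
  assert (I2 : 0 < / (a * s1) <= 1).
  { split; [apply Rinv_0_lt_compat; nra |].
    rewrite <- Rinv_1. apply Rinv_le_contravar; nra. }
  assert (T3 : - 2 * (g * p0) * / s1 <= g ^ 2 + p0 ^ 2).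
  { pose proof (pow2_ge_0 (g + p0)). assert (- 2 * (g * p0) <= g ^ 2 + p0 ^ 2) by nra.
    set (i := / s1) in *. nra. }
  assert (T4 : g ^ 2 * / (a * s1) <= g ^ 2) by nra.
  assert (T5 : - (s1 * c1 * (p1 * g)) <= p1 ^ 2 + g ^ 2).
  { set (t := s1 * c1) in *. pose proof (pow2_ge_0 (p1 + g)). pose proof (pow2_ge_0 (p1 - g)).
    assert (- 2 * (p1 * g) <= p1 ^ 2 + g ^ 2) by nra. nra. }
  set (X := Rabs (s1 * c1 - s0 * c0)) in *. set (N := p0 ^ 2 + p1 ^ 2) in *.
  assert (a * (p1 * p0 * (s1 * c1 - s0 * c0)) <= a * (X * N)) by (apply Rmult_le_compat_l; lra).
  assert (a * (p1 ^ 2 * (s1 ^ 2 / s2 - s0)) <= a * (2 * (s0 - s2) * N))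
    by (apply Rmult_le_compat_l; lra).
  unfold N in *. nra.
Qed.

(** The system is a Jacobi equation with spectral parameter i, split into [p = Re u] and [q = Im u].
    Each real equation has the other part as inhomogeneity, so only the sum of the two energies
    closes up. Coercivity serves twice: it makes the increments relative, and it turns the final
    bound on the energy into decay like [/ a r]. *)
Lemma limit_circle (a s c p q : nat -> R) (eta : R) :
  0 < eta <= 1 -> (forall r, 1 <= a r) -> (forall r, 1 <= s r <= 1 + eta) ->
  (forall r, s (S r) <= s r) -> (forall r, a (S r) = s r ^ 2 * a r) ->
  (forall r, 0 <= s r * c (S r) <= 2 - 4 * eta) ->
  ex_series (fun r => Rabs (s (S r) * c (S (S r)) - s r * c (S r))) ->
  ex_series (fun r => s r - s (S r)) ->
  ex_series (fun r => / a r) ->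
  (forall r, a (S r) * p (S (S r)) + c (S r) * a (S r) * p (S r) + a r * p r = - q (S r)) ->
  (forall r, a (S r) * q (S (S r)) + c (S r) * a (S r) * q (S r) + a r * q r = p (S r)) ->
  ex_series (fun r => p r ^ 2 + q r ^ 2).
Proof.
  intros He Ha Hs Hdec Hsa Hc Sc Ss Sa Hp Hq.
  set (H := fun r => energy (a (S r)) (s r) (s (S r)) (c (S r)) (p (S r)) (p (S (S r)))
                     + energy (a (S r)) (s r) (s (S r)) (c (S r)) (q (S r)) (q (S (S r)))).
  set (N := fun r => p (S r) ^ 2 + q (S r) ^ 2 + (p (S (S r)) ^ 2 + q (S (S r)) ^ 2)).
  assert (HN : forall r, eta * a (S r) * N r <= H r).
  { intro r. unfold H, N.
    pose proof (energy_coercive (a (S r)) (s r) (s (S r)) (c (S r)) (p (S r)) (p (S (S r))) eta) as A1.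
    pose proof (energy_coercive (a (S r)) (s r) (s (S r)) (c (S r)) (q (S r)) (q (S (S r))) eta) as A2.
    pose proof (Ha (S r)). pose proof (Hs r). pose proof (Hs (S r)). pose proof (Hc r).
    assert (0 < a (S r)) by lra.
    specialize (A1 ltac:(lra) He ltac:(lra) ltac:(lra) ltac:(lra)).
    specialize (A2 ltac:(lra) He ltac:(lra) ltac:(lra) ltac:(lra)).
    rewrite !Rmult_plus_distr_l in *. lra. }
  set (x := fun r => Rabs (s (S r) * c (S (S r)) - s r * c (S r)) + 2 * (s r - s (S (S r)))).
  (* The 8 collects 4 from the squares of the solution and 4 from [g ^ 2] in [energy_step], since
     the inhomogeneity of one part is an entry of the other. *)
  assert (HD : forall r, H (S r) - H r <= a (S r) * (x r + 8 * / a (S r)) * N r).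
  { intro r.
    pose proof (Hs r) as B0. pose proof (Hs (S r)) as B1. pose proof (Hs (S (S r))) as B2.
    pose proof (Hdec r) as D0'. pose proof (Hdec (S r)) as D1'. pose proof (Ha (S r)) as Ha'.
    pose proof (Hc (S r)) as Hc'.
    pose proof (energy_step (a (S r)) (s r) (s (S r)) (s (S (S r))) (c (S r)) (c (S (S r)))
                  (p (S r)) (p (S (S r))) (p (S (S (S r)))) (- q (S (S r)))) as E1.
    pose proof (energy_step (a (S r)) (s r) (s (S r)) (s (S (S r))) (c (S r)) (c (S (S r)))
                  (q (S r)) (q (S (S r))) (q (S (S (S r)))) (p (S (S r)))) as E2.
    rewrite <- Hsa in E1, E2.
    specialize (E1 Ha' (proj1 B2) D1' D0' ltac:(lra) ltac:(lra) (Hp (S r))).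
    specialize (E2 Ha' (proj1 B2) D1' D0' ltac:(lra) ltac:(lra) (Hq (S r))).
    unfold H, N.
    fold (x r) in E1, E2.
    replace (a (S r) * (x r + 8 * / a (S r))) with (a (S r) * x r + 8) by (field; lra).
    set (P1 := p (S r) ^ 2 + p (S (S r)) ^ 2) in *.
    set (Q1 := q (S r) ^ 2 + q (S (S r)) ^ 2) in *.
    replace (p (S r) ^ 2 + q (S r) ^ 2 + (p (S (S r)) ^ 2 + q (S (S r)) ^ 2)) with (P1 + Q1)
      by (unfold P1, Q1; ring).
    replace ((- q (S (S r))) ^ 2) with (q (S (S r)) ^ 2) in E1 by ring.
    assert (q (S (S r)) ^ 2 <= Q1) by (unfold Q1; pose proof (pow2_ge_0 (q (S r))); lra).
    assert (p (S (S r)) ^ 2 <= P1) by (unfold P1; pose proof (pow2_ge_0 (p (S r))); lra).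
    rewrite Rmult_plus_distr_l, !Rmult_plus_distr_r.
    lra. }
  assert (xpos : forall r, 0 <= x r).
  { intro r. unfold x. pose proof (Rabs_pos (s (S r) * c (S (S r)) - s r * c (S r))).
    pose proof (Hdec r). pose proof (Hdec (S r)). lra. }
  assert (ipos : forall r, 0 < / a r).
  { intro r. apply Rinv_0_lt_compat. specialize (Ha r); lra. }
  assert (Npos : forall r, 0 <= N r).
  { intro r. unfold N. pose proof (pow2_ge_0 (p (S r))). pose proof (pow2_ge_0 (q (S r))).
    pose proof (pow2_ge_0 (p (S (S r)))). pose proof (pow2_ge_0 (q (S (S r)))). lra. }
  destruct (gronwall_product H (fun r => / eta * (x r + 8 * / a (S r)))) as [M HM].
  - intro r. specialize (HN r). eapply Rle_trans; [| exact HN].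
    specialize (Ha (S r)). specialize (Npos r). apply Rmult_le_pos; nra.
  - intro r. specialize (xpos r). specialize (ipos (S r)).
    apply Rmult_le_pos; [left; apply Rinv_0_lt_compat |]; lra.
  - apply ex_series_scalR, ex_series_plusR.
    + unfold x. apply ex_series_plusR; [exact Sc |]. apply ex_series_scalR.
      apply ex_series_extR with (fun r => (s r - s (S r)) + (s (S r) - s (S (S r)))).
      * intro r. ring.
      * apply ex_series_plusR; [exact Ss |]. apply (ex_series_incr_1 (fun r => s r - s (S r))), Ss.
    + apply ex_series_scalR. apply (ex_series_incr_1 (fun r => / a r)), Sa.
  - intro r. specialize (HD r). specialize (HN r). specialize (xpos r).
    specialize (ipos (S r)). set (y := x r + 8 * / a (S r)) in *.
    assert (Hy : 0 <= y) by (unfold y; lra).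
    assert (a (S r) * y * N r <= / eta * y * H r).
    { replace (a (S r) * y * N r) with (/ eta * y * (eta * a (S r) * N r)) by (field; lra).
      apply Rmult_le_compat_l; [| exact HN].
      apply Rmult_le_pos; [left; apply Rinv_0_lt_compat; lra | assumption]. }
    lra.
  - apply (ex_series_incr_1 (fun r => p r ^ 2 + q r ^ 2)).
    apply ex_series_le_pos with (fun r => (M / eta) * / a (S r)).
    + intro r.
      rewrite Rabs_pos_eq by (pose proof (pow2_ge_0 (p (S r))); pose proof (pow2_ge_0 (q (S r))); lra).
      apply Rle_trans with (N r).
      { unfold N. pose proof (pow2_ge_0 (p (S (S r)))). pose proof (pow2_ge_0 (q (S (S r)))). lra. }
      specialize (HN r). specialize (HM r). specialize (Ha (S r)).
      replace (N r) with ((eta * a (S r) * N r) * (/ eta * / a (S r))) by (field; lra).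
      replace (M / eta * / a (S r)) with (M * (/ eta * / a (S r))) by (field; lra).
      apply Rmult_le_compat_r; [| lra].
      apply Rmult_le_pos; left; apply Rinv_0_lt_compat; lra.
    + apply ex_series_scalR. apply (ex_series_incr_1 (fun r => / a r)), Sa.
Qed.

Lemma ex_series_telescope (u : nat -> R) :
  (forall r, u (S r) <= u r) -> (forall r, 0 <= u r) -> ex_series (fun r => u r - u (S r)).
Proof.
  intros Hd Hp.
  assert (Hex : ex_finite_lim_seq (sum_n (fun r => u r - u (S r)))).
  { assert (E : forall n, @eq R (sum_n (fun r => u r - u (S r)) n) (u 0%nat - u (S n))).
    { induction n; [rewrite sum_O | rewrite sum_Sn, IHn; unfold plus; simpl]; ring. }
    apply ex_finite_lim_seq_incr with (u 0%nat).
    - intro n. rewrite !E. specialize (Hd (S n)). lra.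
    - intro n. rewrite E. specialize (Hp (S n)). lra. }
  destruct Hex as [b Hb]. exists b. exact Hb.
Qed.

(** Comparison with a telescoping series: for [u = sqrt n] and [v = sqrt (n + 1)] one has
    [/ u - / v = / (u v (u + v))], which is at least [/ (2 v^3)]. *)
Lemma ex_series_inv_sqrt3 : ex_series (fun r => (/ sqrt (INR (S r))) ^ 3).
Proof.
  apply (ex_series_incr_1 (fun r => (/ sqrt (INR (S r))) ^ 3)).
  apply ex_series_le_pos with (fun r => 2 * (/ sqrt (INR (S r)) - / sqrt (INR (S (S r))))).
  - intro r.
    assert (P : 0 < INR (S r)) by (apply lt_0_INR; lia).
    assert (Hu : 0 < sqrt (INR (S r))) by (apply sqrt_lt_R0; assumption).
    assert (Hu2 : sqrt (INR (S r)) * sqrt (INR (S r)) = INR (S r)) by (apply sqrt_sqrt; lra).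
    assert (Hv : 0 < sqrt (INR (S (S r)))) by (apply sqrt_lt_R0; rewrite S_INR; lra).
    assert (Hv2 : sqrt (INR (S (S r))) * sqrt (INR (S (S r))) = INR (S r) + 1)
      by (rewrite <- S_INR; apply sqrt_sqrt; rewrite S_INR; lra).
    set (u := sqrt (INR (S r))) in *. set (v := sqrt (INR (S (S r)))) in *.
    assert (Huv : u <= v) by nra.
    rewrite Rabs_pos_eq by (apply pow_le; left; apply Rinv_0_lt_compat; assumption).
    apply Rmult_le_reg_r with (u * v ^ 3 * (u + v)).
    { repeat apply Rmult_lt_0_compat; simpl; try nra. }
    replace ((/ v) ^ 3 * (u * v ^ 3 * (u + v))) with (u * (u + v)) by (field; lra).
    replace (2 * (/ u - / v) * (u * v ^ 3 * (u + v))) with (2 * (v * v) * (v * v - u * u))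
      by (field; lra).
    rewrite Hu2. replace (v * v - INR (S r)) with 1 by lra. nra.
  - apply ex_series_scalR. apply ex_series_telescope.
    + intro r. apply Rinv_le_contravar.
      * apply sqrt_lt_R0, lt_0_INR; lia.
      * apply sqrt_le_1_alt, le_INR; lia.
    + intro r. left. apply Rinv_0_lt_compat, sqrt_lt_R0, lt_0_INR; lia.
Qed.

(** * Growth and regularity of beta *)

Lemma poch_pos_pow (x : Z) (s : nat) : (1 <= x)%Z -> IZR x ^ s <= poch_pos x s.
Proof.
  intros Hx. induction s as [| s IH]; simpl; [lra |].
  assert (1 <= IZR x) by (apply IZR_le; assumption).
  assert (IZR x <= IZR (x + Z.of_nat s)) by (apply IZR_le; lia).
  pose proof (pow_le (IZR x) s). nra.
Qed.

(** Factor by factor this is [(z + 2 D) z <= (z + D)^2]. Through [beta_logconcave] it makes the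
    ratios of consecutive weights nonincreasing, so that the drift of [s] telescopes. *)
Lemma poch_pos_logconcave (x D : Z) (s : nat) : (1 <= x)%Z -> (0 <= D)%Z ->
  poch_pos (x + 2 * D) s * poch_pos x s <= poch_pos (x + D) s ^ 2.
Proof.
  intros Hx HD. induction s as [| s IH]; [simpl; lra | cbn [poch_pos pow]].
  pose proof (poch_pos_ge1 (x + 2 * D) s) as B2. pose proof (poch_pos_ge1 x s) as B0.
  specialize (B2 ltac:(lia)). specialize (B0 Hx).
  rewrite !plus_IZR, mult_IZR. apply IZR_le in Hx, HD.
  pose proof (IZR_le 0 (Z.of_nat s) ltac:(lia)).
  set (y := IZR x) in *. set (E := IZR D) in *. set (t := IZR (Z.of_nat s)) in *.
  set (P2 := poch_pos (x + 2 * D) s) in *. set (P1 := poch_pos (x + D) s) in *.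
  set (P0 := poch_pos x s) in *.
  replace (P2 * (y + 2 * E + t) * (P0 * (y + t)))
    with ((P2 * P0) * ((y + 2 * E + t) * (y + t))) by ring.
  replace (P1 * (y + E + t) * (P1 * (y + E + t) * 1))
    with (P1 ^ 2 * ((y + E + t) * (y + E + t))) by ring.
  apply Rmult_le_compat; [nra | nra | exact IH | nra].
Qed.

Lemma poch_pos_mono (x D : Z) (s : nat) : (1 <= x)%Z -> (0 <= D)%Z ->
  poch_pos x s <= poch_pos (x + D) s.
Proof.
  intros Hx HD. induction s as [| s IH]; simpl; [lra |].
  pose proof (poch_pos_ge1 x s Hx).
  apply Rmult_le_compat; [lra | apply IZR_le; lia | exact IH | apply IZR_le; lia].
Qed.

Lemma poch_pos_ratio (x D : Z) (s : nat) : (1 <= x)%Z -> (0 <= D)%Z ->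
  poch_pos (x + D) s <= (1 + IZR D / IZR x) ^ s * poch_pos x s.
Proof.
  intros Hx HD. induction s as [| s IH]; simpl; [lra |].
  pose proof (poch_pos_ge1 (x + D) s ltac:(lia)) as B.
  rewrite !plus_IZR. apply IZR_le in Hx, HD.
  pose proof (IZR_le 0 (Z.of_nat s) ltac:(lia)).
  set (y := IZR x) in *. set (E := IZR D) in *. set (t := IZR (Z.of_nat s)) in *.
  set (u := 1 + E / y) in *.
  replace (u * u ^ s * (poch_pos x s * (y + t)))
    with ((u ^ s * poch_pos x s) * (u * (y + t))) by ring.
  apply Rmult_le_compat; [lra | lra | exact IH |].
  unfold u. replace ((1 + E / y) * (y + t)) with (y + E + t + E / y * t) by (field; lra).
  assert (0 <= E / y) by (apply Rdiv_le_0_compat; lra). nra.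
Qed.

Lemma beta_sqrt (k l n : nat) : (l <= n)%nat ->
  beta k l n = sqrt (poch_pos (Z.of_nat (n - l) + 1) l * poch_pos (Z.of_nat (n - l) + 1) k).
Proof.
  intros H. rewrite beta_ge by assumption. symmetry.
  apply sqrt_mult; eapply Rle_trans; try apply poch_pos_ge1; lra || lia.
Qed.

(** This is where [k + l >= 3] enters: [beta] grows like [n] to the power [(k + l) / 2], and the
    exponent 3/2 makes its inverse summable along a chain. *)
Lemma beta_lower (k l n : nat) : (3 <= k + l)%nat -> (l <= n)%nat ->
  sqrt (INR (S (n - l))) ^ 3 <= beta k l n.
Proof.
  intros Hs Hn. rewrite beta_sqrt by assumption.
  set (x := (Z.of_nat (n - l) + 1)%Z).
  assert (Hx : (1 <= x)%Z) by (unfold x; lia).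
  replace (INR (S (n - l))) with (IZR x) by (rewrite INR_IZR_INZ; f_equal; lia).
  assert (1 <= IZR x) by (apply IZR_le; assumption).
  rewrite <- (sqrt_pow2 (sqrt (IZR x) ^ 3)) by (apply pow_le, sqrt_pos).
  apply sqrt_le_1_alt.
  replace ((sqrt (IZR x) ^ 3) ^ 2) with ((sqrt (IZR x) * sqrt (IZR x)) ^ 3) by ring.
  rewrite sqrt_sqrt by lra.
  apply Rle_trans with (IZR x ^ (l + k)); [apply Rle_pow; [assumption | lia] |].
  rewrite pow_add. apply Rmult_le_compat; try (apply pow_le; lra); apply poch_pos_pow, Hx.
Qed.

Lemma beta_ge1 (k l n : nat) : (l <= n)%nat -> 1 <= beta k l n.
Proof.
  intros Hn. rewrite beta_sqrt by assumption. rewrite <- sqrt_1. apply sqrt_le_1_alt.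
  pose proof (poch_pos_ge1 (Z.of_nat (n - l) + 1) l ltac:(lia)).
  pose proof (poch_pos_ge1 (Z.of_nat (n - l) + 1) k ltac:(lia)). nra.
Qed.

Lemma beta_mono (k l n D : nat) : (l <= n)%nat -> beta k l n <= beta k l (n + D).
Proof.
  intros Hn. rewrite !beta_sqrt by lia. apply sqrt_le_1_alt.
  replace (Z.of_nat (n + D - l) + 1)%Z with (Z.of_nat (n - l) + 1 + Z.of_nat D)%Z by lia.
  pose proof (poch_pos_ge1 (Z.of_nat (n - l) + 1) l ltac:(lia)).
  pose proof (poch_pos_ge1 (Z.of_nat (n - l) + 1) k ltac:(lia)).
  apply Rmult_le_compat; try lra; apply poch_pos_mono; lia.
Qed.

Lemma beta_logconcave (k l n D : nat) : (l <= n)%nat ->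
  beta k l (n + D + D) * beta k l n <= beta k l (n + D) ^ 2.
Proof.
  intros Hn. rewrite !beta_sqrt by lia.
  replace (Z.of_nat (n + D + D - l) + 1)%Z with (Z.of_nat (n - l) + 1 + 2 * Z.of_nat D)%Z by lia.
  replace (Z.of_nat (n + D - l) + 1)%Z with (Z.of_nat (n - l) + 1 + Z.of_nat D)%Z by lia.
  set (x := (Z.of_nat (n - l) + 1)%Z).
  assert (Hx : (1 <= x)%Z) by (unfold x; lia).
  assert (Pos : forall y s, (1 <= y)%Z -> 0 <= poch_pos y s).
  { intros y s Hy. pose proof (poch_pos_ge1 y s Hy). lra. }
  rewrite pow2_sqrt by (apply Rmult_le_pos; apply Pos; lia).
  rewrite <- sqrt_mult by (apply Rmult_le_pos; apply Pos; lia).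
  rewrite <- (sqrt_pow2 (poch_pos (x + Z.of_nat D) l * poch_pos (x + Z.of_nat D) k))
    by (apply Rmult_le_pos; apply Pos; lia).
  apply sqrt_le_1_alt.
  pose proof (poch_pos_logconcave x (Z.of_nat D) l Hx ltac:(lia)) as A1.
  pose proof (poch_pos_logconcave x (Z.of_nat D) k Hx ltac:(lia)) as A2.
  rewrite Rpow_mult_distr.
  match goal with |- ?p * ?q * (?r * ?t) <= _ =>
    replace (p * q * (r * t)) with ((p * r) * (q * t)) by ring end.
  apply Rmult_le_compat; try assumption; apply Rmult_le_pos; apply Pos; lia.
Qed.

(** The bound is coarse on purpose: the square root would allow the exponent [(k + l) / 2], but only
    the limit 1 of the ratio is wanted. *)
Lemma beta_ratio (k l n D : nat) : (l <= n)%nat ->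
  beta k l (n + D) <= (1 + INR D / INR (S (n - l))) ^ (k + l) * beta k l n.
Proof.
  intros Hn. rewrite !beta_sqrt by lia.
  replace (Z.of_nat (n + D - l) + 1)%Z with (Z.of_nat (n - l) + 1 + Z.of_nat D)%Z by lia.
  set (x := (Z.of_nat (n - l) + 1)%Z).
  assert (Hx : (1 <= x)%Z) by (unfold x; lia).
  replace (INR (S (n - l))) with (IZR x) by (rewrite INR_IZR_INZ; f_equal; lia).
  replace (INR D) with (IZR (Z.of_nat D)) by (rewrite INR_IZR_INZ; reflexivity).
  assert (HD : (0 <= Z.of_nat D)%Z) by lia.
  set (E := Z.of_nat D) in *.
  pose proof (poch_pos_ratio x E l Hx HD) as A1. pose proof (poch_pos_ratio x E k Hx HD) as A2.
  pose proof (poch_pos_ge1 (x + E) l ltac:(lia)). pose proof (poch_pos_ge1 (x + E) k ltac:(lia)).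
  pose proof (poch_pos_ge1 x l Hx). pose proof (poch_pos_ge1 x k Hx).
  apply IZR_le in Hx, HD.
  assert (0 <= IZR E / IZR x) by (apply Rdiv_le_0_compat; lra).
  set (u := 1 + IZR E / IZR x) in *.
  assert (Hu : 1 <= u ^ (k + l)) by (apply pow_R1_Rle; unfold u; lra).
  rewrite <- (sqrt_pow2 (u ^ (k + l))) by lra.
  rewrite <- sqrt_mult by nra.
  apply sqrt_le_1_alt.
  apply Rle_trans with (u ^ (k + l) * (poch_pos x l * poch_pos x k)).
  - rewrite pow_add.
    replace (u ^ k * u ^ l * (poch_pos x l * poch_pos x k))
      with ((u ^ l * poch_pos x l) * (u ^ k * poch_pos x k)) by ring.
    apply Rmult_le_compat; lra.
  - apply Rmult_le_compat_r; nra.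
Qed.

Lemma is_lim_seq_inv_S (D : nat) : is_lim_seq (fun r => 1 + INR D / INR (S r)) 1.
Proof.
  replace (Finite 1) with (Finite (1 + INR D * 0)) by (f_equal; ring).
  apply is_lim_seq_plus'; [apply is_lim_seq_const |].
  apply is_lim_seq_mult'; [apply is_lim_seq_const |].
  apply (is_lim_seq_incr_1 (fun n => / INR n)).
  replace (Finite 0) with (Rbar_inv p_infty) by reflexivity.
  apply is_lim_seq_inv; [apply is_lim_seq_INR | discriminate].
Qed.

Lemma is_lim_seq_pow1 (u : nat -> R) (m : nat) :
  is_lim_seq u 1 -> is_lim_seq (fun r => u r ^ m) 1.
Proof.
  intros H. induction m as [| m IH]; simpl; [apply is_lim_seq_const |].
  replace (Finite 1) with (Finite (1 * 1)) by (f_equal; ring).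
  apply is_lim_seq_mult'; assumption.
Qed.

(** * Consequences of the asymptotic expansion *)

Lemma Rpower_half_pow (n s : nat) : (0 < n)%nat ->
  Rpower (INR n) (- INR s / 2) = (/ sqrt (INR n)) ^ s.
Proof.
  intros Hn. assert (P : 0 < INR n) by (apply lt_0_INR; assumption).
  rewrite <- (Rpower_sqrt (INR n)), <- Rpower_Ropp by assumption.
  rewrite <- Rpower_pow by apply exp_pos. rewrite Rpower_mult. f_equal. field.
Qed.

(** Taken at order 2, the expansion contains multiples of two decreasing powers, whose increments
    are controlled by those of [/ sqrt n] and will telescope, and a remainder of order [n^(-3/2)],
    which is summable in itself. *)
Lemma expansion_increment (c lam : nat -> R) : asymp_expansion c lam ->
  exists (K : R) (N : nat), 0 <= K /\ forall n n', (N <= n)%nat -> (n <= n')%nat ->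
    Rabs (c n' - c n) <= K * (/ sqrt (INR n) - / sqrt (INR n')) + K * (/ sqrt (INR n)) ^ 3.
Proof.
  intros H. destruct (H 2%nat) as (C0 & N & HN).
  set (C := Rabs C0).
  exists (Rabs (lam 1%nat) + 2 * Rabs (lam 2%nat) + 2 * C), (S N). split.
  - unfold C. pose proof (Rabs_pos (lam 1%nat)). pose proof (Rabs_pos (lam 2%nat)).
    pose proof (Rabs_pos C0). lra.
  - intros n n' Hn Hn'.
    pose proof (HN n ltac:(lia)) as B. pose proof (HN n' ltac:(lia)) as B'.
    cbn [sum_f_R0] in B, B'. rewrite !Rpower_half_pow in B, B' by lia.
    change (2 + 1)%nat with 3%nat in B, B'.
    assert (P : 1 <= INR n) by (apply (le_INR 1); lia).
    assert (P' : INR n <= INR n') by (apply le_INR; lia).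
    assert (S1 : 1 <= sqrt (INR n)) by (rewrite <- sqrt_1; apply sqrt_le_1_alt; assumption).
    assert (S2 : sqrt (INR n) <= sqrt (INR n')) by (apply sqrt_le_1_alt; assumption).
    assert (W1 : / sqrt (INR n') <= / sqrt (INR n)) by (apply Rinv_le_contravar; lra).
    assert (W2 : / sqrt (INR n) <= 1) by (rewrite <- Rinv_1; apply Rinv_le_contravar; lra).
    assert (W3 : 0 < / sqrt (INR n')) by (apply Rinv_0_lt_compat; lra).
    set (w := / sqrt (INR n)) in *. set (w' := / sqrt (INR n')) in *.
    pose proof (Rle_abs C0) as HC. fold C in HC.
    assert (Hw3 : 0 <= w' ^ 3 <= w ^ 3) by (split; [apply pow_le; lra | apply pow_incr; lra]).
    assert (B1 : Rabs (c n - (lam 0%nat * w ^ 0 + lam 1%nat * w ^ 1 + lam 2%nat * w ^ 2)) <= C * w ^ 3)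
      by (eapply Rle_trans; [exact B | nra]).
    assert (B1' : Rabs (c n' - (lam 0%nat * w' ^ 0 + lam 1%nat * w' ^ 1 + lam 2%nat * w' ^ 2)) <= C * w ^ 3).
    { eapply Rle_trans; [exact B' |].
      assert (0 <= C) by apply Rabs_pos.
      apply Rle_trans with (C * w' ^ 3); [nra |]. apply Rmult_le_compat_l; lra. }
    replace (c n' - c n)
      with ((c n' - (lam 0%nat * w' ^ 0 + lam 1%nat * w' ^ 1 + lam 2%nat * w' ^ 2))
            - (c n - (lam 0%nat * w ^ 0 + lam 1%nat * w ^ 1 + lam 2%nat * w ^ 2))
            + (lam 1%nat * (w' - w) + lam 2%nat * (w' ^ 2 - w ^ 2))) by ring.
    set (e' := c n' - _) in *. set (e := c n - _) in *.
    assert (A1 : Rabs (lam 1%nat * (w' - w)) <= Rabs (lam 1%nat) * (w - w')).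
    { rewrite Rabs_mult, (Rabs_left1 (w' - w)) by lra. lra. }
    (* The factor 2 bounds [w + w'] in [w^2 - w'^2 = (w + w') (w - w')]. *)
    assert (A2 : Rabs (lam 2%nat * (w' ^ 2 - w ^ 2)) <= 2 * Rabs (lam 2%nat) * (w - w')).
    { rewrite Rabs_mult, (Rabs_left1 (w' ^ 2 - w ^ 2)) by nra.
      pose proof (Rabs_pos (lam 2%nat)).
      replace (2 * Rabs (lam 2%nat) * (w - w')) with (Rabs (lam 2%nat) * (2 * (w - w'))) by ring.
      apply Rmult_le_compat_l; nra. }
    pose proof (Rabs_triang (e' - e) (lam 1%nat * (w' - w) + lam 2%nat * (w' ^ 2 - w ^ 2))).
    pose proof (Rabs_triang (lam 1%nat * (w' - w)) (lam 2%nat * (w' ^ 2 - w ^ 2))).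
    pose proof (Rabs_triang e' (- e)) as T. rewrite Rabs_Ropp in T.
    unfold Rminus at 1 in H0.
    pose proof (Rabs_pos (lam 1%nat)). pose proof (Rabs_pos (lam 2%nat)).
    assert (0 <= C) by apply Rabs_pos.
    unfold Rminus in *. nra.
Qed.

(** Only order 0 of the expansion is used; the threshold on [n] is chosen so that
    [|C0| / sqrt n <= mu - lam 0]. *)
Lemma expansion_bound (c lam : nat -> R) (mu : R) :
  asymp_expansion c lam -> lam 0%nat < mu ->
  exists N, forall n, (N <= n)%nat -> c n <= mu.
Proof.
  intros H Hmu. destruct (H 0%nat) as (C0 & N & HN).
  destruct (INR_unbounded ((Rabs C0 / (mu - lam 0%nat)) ^ 2)) as [M HM].
  exists (S (max N M)). intros n Hn.
  specialize (HN n ltac:(lia)). cbn [sum_f_R0] in HN.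
  rewrite !Rpower_half_pow in HN by lia. change (0 + 1)%nat with 1%nat in HN.
  assert (P : INR M <= INR n) by (apply le_INR; lia).
  assert (P1 : 0 < INR n) by (apply lt_0_INR; lia).
  assert (S1 : 0 < sqrt (INR n)) by (apply sqrt_lt_R0; assumption).
  assert (D : 0 < mu - lam 0%nat) by lra.
  assert (Q : Rabs C0 / (mu - lam 0%nat) <= sqrt (INR n)).
  { rewrite <- (sqrt_pow2 (Rabs C0 / (mu - lam 0%nat)))
      by (apply Rdiv_le_0_compat; [apply Rabs_pos | lra]).
    apply sqrt_le_1_alt. lra. }
  assert (Q2 : Rabs C0 * / sqrt (INR n) <= mu - lam 0%nat).
  { apply Rmult_le_reg_r with (sqrt (INR n)); [assumption |].
    replace (Rabs C0 * / sqrt (INR n) * sqrt (INR n)) with (Rabs C0) by (field; lra).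
    apply Rmult_le_reg_l with (/ (mu - lam 0%nat)); [apply Rinv_0_lt_compat; lra |].
    replace (/ (mu - lam 0%nat) * ((mu - lam 0%nat) * sqrt (INR n))) with (sqrt (INR n))
      by (field; lra).
    unfold Rdiv in Q. lra. }
  pose proof (Rle_abs (c n - lam 0%nat * (/ sqrt (INR n)) ^ 0)) as A.
  pose proof (Rle_abs C0).
  assert (0 < / sqrt (INR n)) by (apply Rinv_0_lt_compat; assumption).
  simpl in HN, A. nra.
Qed.

(** The hypotheses of [limit_circle] are checked on a tail of the chain. The bound on [c] and the
    closeness of [s] to 1 are obtained from limits, hence for large indices, and finitely many terms
    do not affect summability. *)
Lemma chain_square_summable (k l n0 : nat) (f : nat -> R) (p q : nat -> R) :
  (l < k)%nat -> (3 <= k + l)%nat -> (l <= n0)%nat -> (forall n, 0 <= f n) ->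
  (exists lam : nat -> R, lam 0%nat < 2 /\ asymp_expansion (fun n => f n / beta k l n) lam) ->
  let a := fun r => beta k l (n0 + r * (k - l)) in
  let b := fun r => f (n0 + r * (k - l))%nat in
  (forall r, a (S r) * p (S (S r)) + b (S r) * p (S r) + a r * p r = - q (S r)) ->
  (forall r, a (S r) * q (S (S r)) + b (S r) * q (S r) + a r * q r = p (S r)) ->
  ex_series (fun r => p r ^ 2 + q r ^ 2).
Proof.
  intros Hkl Hsum Hn0 Hf (lam & Hlam & Hexp) a b Hp Hq.
  set (D := (k - l)%nat) in *.
  assert (HD : (1 <= D)%nat) by (unfold D; lia).
  set (nn := fun r => (n0 + r * D)%nat).
  assert (Hnn : forall r, (l <= nn r)%nat) by (intro; unfold nn; nia).
  assert (HnS : forall r, nn (S r) = (nn r + D)%nat) by (intro; unfold nn; simpl; lia).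
  assert (Hnr : forall r, (r + l <= nn r)%nat) by (intro; unfold nn; nia).
  set (c := fun r => f (nn r) / beta k l (nn r)).
  assert (Ha1 : forall r, 1 <= a r) by (intro; apply beta_ge1, Hnn).
  set (s := fun r => sqrt (a (S r) / a r)).
  assert (Hrat1 : forall r, 1 <= a (S r) / a r).
  { intro r. apply Rmult_le_reg_r with (a r); [specialize (Ha1 r); lra |].
    replace (a (S r) / a r * a r) with (a (S r)) by (field; specialize (Ha1 r); lra).
    unfold a. fold (nn r) (nn (S r)). rewrite HnS.
    pose proof (beta_mono k l (nn r) D (Hnn r)). lra. }
  assert (Hs1 : forall r, 1 <= s r).
  { intro r. unfold s. rewrite <- sqrt_1. apply sqrt_le_1_alt, Hrat1. }
  assert (Hsdec : forall r, s (S r) <= s r).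
  { intro r. unfold s. apply sqrt_le_1_alt.
    pose proof (Ha1 r). pose proof (Ha1 (S r)).
    apply Rmult_le_reg_r with (a r * a (S r)); [nra |].
    replace (a (S (S r)) / a (S r) * (a r * a (S r))) with (a (S (S r)) * a r) by (field; lra).
    replace (a (S r) / a r * (a r * a (S r))) with (a (S r) ^ 2) by (field; lra).
    unfold a. fold (nn r) (nn (S r)) (nn (S (S r))). rewrite !HnS.
    apply beta_logconcave, Hnn. }
  assert (Hsa : forall r, a (S r) = s r ^ 2 * a r).
  { intro r. unfold s. rewrite pow2_sqrt by (specialize (Hrat1 r); lra).
    field. specialize (Ha1 r); lra. }
  assert (Hslim : is_lim_seq s 1).
  { apply is_lim_seq_le_le with (fun _ => 1) (fun r => (1 + INR D / INR (S r)) ^ (k + l)).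
    - intro r. split; [apply Hs1 |].
      assert (U : a (S r) / a r <= (1 + INR D / INR (S r)) ^ (k + l)).
      { pose proof (Ha1 r).
        apply Rmult_le_reg_r with (a r); [lra |].
        replace (a (S r) / a r * a r) with (a (S r)) by (field; lra).
        eapply Rle_trans.
        - unfold a. fold (nn (S r)). rewrite HnS. apply beta_ratio, Hnn.
        - unfold a. fold (nn r). apply Rmult_le_compat_r; [unfold a in H; fold (nn r) in H; lra |].
          apply pow_incr.
          assert (P : INR (S r) <= INR (S (nn r - l))) by (apply le_INR; specialize (Hnr r); lia).
          assert (P2 : 0 < INR (S r)) by (apply lt_0_INR; lia).
          pose proof (pos_INR D).
          assert (/ INR (S (nn r - l)) <= / INR (S r)) by (apply Rinv_le_contravar; assumption).
          assert (0 < / INR (S (nn r - l))) by (apply Rinv_0_lt_compat; lra).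
          unfold Rdiv. nra. }
      pose proof (Hrat1 r). unfold s.
      rewrite <- (sqrt_pow2 ((1 + INR D / INR (S r)) ^ (k + l))) by lra.
      apply sqrt_le_1_alt. nra.
    - apply is_lim_seq_const.
    - apply is_lim_seq_pow1, is_lim_seq_inv_S. }
  (* Midpoint between the leading coefficient and 2; the maximum with 0 keeps [mu] positive. *)
  set (mu := (Rmax (lam 0%nat) 0 + 2) / 2).
  assert (Hmu : lam 0%nat < mu /\ 0 < mu < 2).
  { unfold mu. pose proof (Rmax_l (lam 0%nat) 0). pose proof (Rmax_r (lam 0%nat) 0).
    assert (Rmax (lam 0%nat) 0 < 2) by (apply Rmax_lub_lt; lra). lra. }
  destruct (expansion_bound _ lam mu Hexp (proj1 Hmu)) as [N1 HN1].
  destruct (expansion_increment _ lam Hexp) as (K & N2 & HK & HN2).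
  (* The 6 yields [(1 + eta) mu <= mu + 2 eta = 2 - 4 eta], the bound on [s c] that coercivity asks
     for. *)
  set (eta := (2 - mu) / 6).
  assert (Heta : 0 < eta <= 1) by (unfold eta; lra).
  destruct (proj2 (is_lim_seq_spec _ _) Hslim (mkposreal eta (proj1 Heta))) as [N3 HN3].
  simpl in HN3.
  (* The successor makes every site [nn (r0 + r)] at least 1, as the inverse square roots below
     require. *)
  set (r0 := S (max N1 (max N2 N3))).
  assert (Hc0 : forall r, 0 <= c r).
  { intro r. unfold c. apply Rdiv_le_0_compat; [apply Hf |].
    pose proof (beta_ge1 k l (nn r) (Hnn r)); lra. }
  assert (Hcmu : forall r, c (r0 + r)%nat <= mu).
  { intro r. unfold c. apply HN1. specialize (Hnr (r0 + r)%nat). unfold r0 in *; lia. }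
  assert (Hs2 : forall r, s (r0 + r)%nat <= 1 + eta).
  { intro r. specialize (HN3 (r0 + r)%nat ltac:(unfold r0; lia)).
    apply Rabs_def2 in HN3. lra. }
  assert (Ss : ex_series (fun r => s (r0 + r)%nat - s (r0 + S r)%nat)).
  { apply (ex_series_telescope (fun r => s (r0 + r)%nat)).
    - intro r. rewrite Nat.add_succ_r. apply Hsdec.
    - intro r. specialize (Hs1 (r0 + r)%nat); lra. }
  assert (Sc : ex_series (fun r => Rabs (c (r0 + S r)%nat - c (r0 + r)%nat))).
  (* Increments between consecutive sites telescope in [w]; since [nn (r0 + r)] is at least [S r],
     the remainders are dominated by the series of [ex_series_inv_sqrt3]. *)
  { set (w := fun r => / sqrt (INR (nn (r0 + r)%nat))).
    assert (Hpos : forall r, 1 <= INR (nn (r0 + r)%nat)).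
    { intro r. apply (le_INR 1). specialize (Hnr (r0 + r)%nat). unfold r0 in *; lia. }
    assert (wpos : forall r, 0 < w r).
    { intro r. apply Rinv_0_lt_compat, sqrt_lt_R0. specialize (Hpos r); lra. }
    apply ex_series_le_pos with
      (fun r => K * (w r - w (S r)) + K * (/ sqrt (INR (S r))) ^ 3).
    - intro r. rewrite Rabs_Rabsolu. unfold c.
      eapply Rle_trans.
      + apply (HN2 (nn (r0 + r)%nat) (nn (r0 + S r)%nat)).
        * specialize (Hnr (r0 + r)%nat). unfold r0 in *; lia.
        * rewrite Nat.add_succ_r, HnS. lia.
      + apply Rplus_le_compat_l. apply Rmult_le_compat_l; [assumption |].
        apply pow_incr. split; [left; apply wpos |].
        apply Rinv_le_contravar; [apply sqrt_lt_R0, lt_0_INR; lia |].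
        apply sqrt_le_1_alt, le_INR. specialize (Hnr (r0 + r)%nat). unfold r0 in *; lia.
    - apply ex_series_plusR; apply ex_series_scalR; [| apply ex_series_inv_sqrt3].
      apply ex_series_telescope; [| intro; left; apply wpos].
      intro r. unfold w. apply Rinv_le_contravar.
      + apply sqrt_lt_R0. specialize (Hpos r); lra.
      + apply sqrt_le_1_alt, le_INR. rewrite Nat.add_succ_r, HnS. lia. }
  apply (ex_series_incr_n (fun r => p r ^ 2 + q r ^ 2) r0).
  apply (limit_circle (fun r => a (r0 + r)%nat) (fun r => s (r0 + r)%nat)
           (fun r => c (r0 + r)%nat) (fun r => p (r0 + r)%nat) (fun r => q (r0 + r)%nat) eta);
    auto.
  - intro r. rewrite Nat.add_succ_r. apply Hsdec.
  - intro r. rewrite Nat.add_succ_r. apply Hsa.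
  - intro r. pose proof (Hs1 (r0 + r)%nat). pose proof (Hs2 r). pose proof (Hcmu (S r)).
    pose proof (Hc0 (r0 + S r)%nat). unfold eta in *. split; nra.
  - apply ex_series_le_pos with
      (fun r => 2 * Rabs (c (r0 + S (S r))%nat - c (r0 + S r)%nat)
                + 2 * (s (r0 + r)%nat - s (r0 + S r)%nat)).
    + intro r. rewrite Rabs_Rabsolu.
      pose proof (Hs1 (r0 + S r)%nat). pose proof (Hs2 (S r)).
      pose proof (Hcmu (S r)). pose proof (Hc0 (r0 + S r)%nat).
      assert (s (r0 + S r)%nat <= s (r0 + r)%nat) by (rewrite Nat.add_succ_r; apply Hsdec).
      (* Discrete product rule, with [s <= 2] and [c <= 2] on the tail. *)
      replace (s (r0 + S r)%nat * c (r0 + S (S r))%nat - s (r0 + r)%nat * c (r0 + S r)%nat)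
        with (s (r0 + S r)%nat * (c (r0 + S (S r))%nat - c (r0 + S r)%nat)
              + - (c (r0 + S r)%nat * (s (r0 + r)%nat - s (r0 + S r)%nat))) by ring.
      eapply Rle_trans; [apply Rabs_triang |].
      rewrite Rabs_Ropp, !Rabs_mult, (Rabs_pos_eq (s (r0 + S r)%nat)),
        (Rabs_pos_eq (c (r0 + S r)%nat)), (Rabs_pos_eq (s (r0 + r)%nat - s (r0 + S r)%nat)) by lra.
      pose proof (Rabs_pos (c (r0 + S (S r))%nat - c (r0 + S r)%nat)).
      apply Rplus_le_compat; apply Rmult_le_compat_r; lra.
    + apply ex_series_plusR; apply ex_series_scalR; [| exact Ss].
      apply (ex_series_incr_1 (fun r => Rabs (c (r0 + S r)%nat - c (r0 + r)%nat))), Sc.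
  - apply (ex_series_incr_n (fun r => / a r) r0).
    apply ex_series_le_pos with (2 := ex_series_inv_sqrt3).
    intro r. pose proof (Ha1 r).
    rewrite Rabs_pos_eq by (left; apply Rinv_0_lt_compat; lra).
    rewrite pow_inv. apply Rinv_le_contravar.
    + apply pow_lt, sqrt_lt_R0, lt_0_INR; lia.
    + eapply Rle_trans; [| apply beta_lower; [assumption | apply Hnn]].
      apply pow_incr. split; [apply sqrt_pos |].
      apply sqrt_le_1_alt, le_INR. fold (nn r). specialize (Hnr r). lia.
  - intro r. rewrite !Nat.add_succ_r, <- Hp. unfold c, b.
    f_equal. f_equal. fold (nn (S (r0 + r))). unfold a. fold (nn (S (r0 + r))).
    field. pose proof (beta_ge1 k l (nn (S (r0 + r))) (Hnn _)). lra.
  - intro r. rewrite !Nat.add_succ_r, <- Hq. unfold c, b.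
    f_equal. f_equal. fold (nn (S (r0 + r))). unfold a. fold (nn (S (r0 + r))).
    field. pose proof (beta_ge1 k l (nn (S (r0 + r))) (Hnn _)). lra.
Qed.

(** * Formal eigenvectors *)

(** Orthogonality to the range of [A + s] says that the adjoint maps [x] to [- conj s x], and
    [- conj s = s] when [s] is imaginary. Thus K_+ belongs to the eigenvalue i and K_- to -i. *)
Lemma Kdef_eigen k l theta f (s : C) (x : seqC) : Cconj s = Copp s ->
  (Kdef k l theta f s x <-> l2 x /\ Aop k l theta f x = vscal s x).
Proof.
  intros Hs. pose proof (Aop_formally_symmetric k l theta f) as (_ & _ & HD & HA).
  assert (E : forall u, l2 x -> D0 u ->
    (inner x (fun n => Cplus (Aop k l theta f u n) (Cmult s (u n))) = RtoC 0 <->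
     inner x (Aop k l theta f u) = inner (vscal s x) u)).
  { intros u Hx Hu. pose proof (l2_D0 _ Hu). pose proof (l2_D0 _ (HD u Hu)).
    change (fun n => Cplus (Aop k l theta f u n) (Cmult s (u n)))
      with (vadd (Aop k l theta f u) (vscal s u)).
    rewrite inner_vadd_r, inner_vscal_r, inner_vscal_l, Hs by auto using l2_vscal.
    rewrite (Ceq_minus (inner x (Aop k l theta f u))).
    replace (inner x (Aop k l theta f u) - - s * inner x u)%C
      with (inner x (Aop k l theta f u) + s * inner x u)%C by ring.
    reflexivity. }
  split.
  - intros [Hx K]. split; [assumption |].
    symmetry. apply (HA x (vscal s x) Hx (l2_vscal s x Hx)).
    intros u Hu. exact (proj1 (E u Hx Hu) (K u Hu)).
  - intros [Hx K]. split; [assumption |]. intros u Hu. apply (proj2 (E u Hx Hu)).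
    exact (proj2 (HA x (vscal s x) Hx (l2_vscal s x Hx)) (eq_sym K) u Hu).
Qed.

Lemma xi_unit (theta : R) : Cmult (xi theta) (Cconj (xi theta)) = RtoC 1.
Proof.
  unfold xi. pose proof (sin2_cos2 theta) as H. unfold Rsqr in H.
  apply injective_projections; simpl; lra.
Qed.

Lemma xi_neq0 (theta : R) : xi theta <> RtoC 0.
Proof.
  intro E. pose proof (xi_unit theta) as H. rewrite E, Cmult_0_l in H.
  apply RtoC_inj in H. lra.
Qed.

Lemma Cmod_xi (theta : R) : Cmod (xi theta) = 1.
Proof.
  pose proof (xi_unit theta) as H. apply (f_equal Cmod) in H.
  rewrite Cmod_mult, Cmod_conj, Cmod_1 in H. pose proof (Cmod_ge_0 (xi theta)). nra.
Qed.

Lemma Cmod_Cpow (z : C) (r : nat) : Cmod (Defs.Cpow z r) = Cmod z ^ r.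
Proof. induction r as [| r IH]; simpl; [apply Cmod_1 | rewrite Cmod_mult, IH; reflexivity]. Qed.

Lemma phivec_on k l theta sgn n0 dd r : (l < k)%nat ->
  phivec k l theta sgn n0 dd (n0 + r * (k - l))%nat =
  Cmult (Cmult (Defs.Cpow sgn r) (Defs.Cpow (xi theta) r)) (dd r).
Proof.
  intros H. unfold phivec.
  rewrite (Nat.add_comm n0), Nat.add_sub, Nat.Div0.mod_mul, Nat.div_mul by lia.
  destruct (Nat.leb_spec n0 (r * (k - l) + n0)) as [| L]; [reflexivity |].
  exfalso. apply (Nat.lt_irrefl n0). eapply Nat.le_lt_trans; [apply Nat.le_add_l | exact L].
Qed.

Lemma phivec_off k l theta sgn n0 dd m : (l < k)%nat ->
  (forall r, m <> n0 + r * (k - l))%nat -> phivec k l theta sgn n0 dd m = RtoC 0.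
Proof.
  intros H Hm. unfold phivec.
  destruct (Nat.leb_spec n0 m) as [L | L]; [| reflexivity].
  destruct (Nat.eqb_spec ((m - n0) mod (k - l)) 0) as [E | E]; [| reflexivity].
  exfalso. apply (Hm ((m - n0) / (k - l))%nat).
  pose proof (Nat.div_mod_eq (m - n0) (k - l)). lia.
Qed.

Lemma chain_exists (k l n : nat) : (l < k)%nat -> (l <= n)%nat ->
  exists n1 r, (l <= n1 < k)%nat /\ n = (n1 + r * (k - l))%nat.
Proof.
  intros H Hn. exists (l + (n - l) mod (k - l))%nat, ((n - l) / (k - l))%nat.
  pose proof (Nat.mod_upper_bound (n - l) (k - l) ltac:(lia)).
  pose proof (Nat.div_mod_eq (n - l) (k - l)). lia.
Qed.

Lemma chain_unique (k l n1 n2 r1 r2 : nat) : (l <= n1 < k)%nat -> (l <= n2 < k)%nat ->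
  (n1 + r1 * (k - l) = n2 + r2 * (k - l))%nat -> n1 = n2 /\ r1 = r2.
Proof.
  intros H1 H2 E. destruct (lt_eq_lt_dec r1 r2) as [[L | ->] | L]; [exfalso | lia | exfalso].
  - pose proof (Nat.mul_le_mono_r (S r1) r2 (k - l) L). simpl in *. lia.
  - pose proof (Nat.mul_le_mono_r (S r2) r1 (k - l) L). simpl in *. lia.
Qed.

(** Between consecutive sites [n0 + r * D] the partial sums of [h] are constant, so they are partial
    sums of [g] and stay bounded. *)
Lemma ex_series_spread (g h : nat -> R) (n0 D : nat) : (0 < D)%nat ->
  (forall r, 0 <= g r) -> ex_series g ->
  (forall r, h (n0 + r * D)%nat = g r) ->
  (forall m, (forall r, m <> n0 + r * D)%nat -> h m = 0) -> ex_series h.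
Proof.
  intros HD Hg Hs Hon Hoff.
  assert (Hpos : forall m, 0 <= h m).
  { intro m. destruct (classic (exists r, m = n0 + r * D)%nat) as [[r ->] | No].
    - rewrite Hon. apply Hg.
    - rewrite Hoff; [lra |]. intros r E. apply No. exists r; exact E. }
  assert (Hskip : forall A B, (A <= B)%nat ->
            (forall m, (A < m <= B)%nat -> h m = 0) -> @eq R (sum_n h B) (sum_n h A)).
  { intros A B HAB. induction HAB as [| B HAB IH]; intros K; [reflexivity |].
    rewrite sum_Sn, IH by (intros; apply K; lia). rewrite K by lia.
    unfold plus; simpl; ring. }
  assert (Hsum : forall r, @eq R (sum_n h (n0 + r * D)) (sum_n g r)).
  { induction r as [| r IH].
    - rewrite sum_O, Nat.add_0_r, <- (Hon 0%nat), Nat.add_0_r.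
      destruct n0 as [| n1]; [apply sum_O |].
      rewrite sum_Sn, (Hskip 0%nat n1), sum_O by
        (try lia; intros m Hm; apply Hoff; intros r; lia).
      rewrite (Hoff 0%nat) by (intros; lia). unfold plus; simpl; ring.
    - rewrite sum_Sn, <- IH, <- (Hon (S r)).
      replace (n0 + S r * D)%nat with (S (n0 + r * D + (D - 1)))%nat by (simpl; lia).
      rewrite sum_Sn, (Hskip (n0 + r * D)%nat (n0 + r * D + (D - 1))%nat); [reflexivity | lia |].
      intros m Hm. apply Hoff. intros r' E. assert (r < r' < S r)%nat; [nia | lia]. }
  assert (Hex : ex_finite_lim_seq (sum_n h)).
  { apply ex_finite_lim_seq_incr with (Series g).
    - intro n. rewrite sum_Sn. unfold plus; simpl. specialize (Hpos (S n)). lra.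
    - intro n. apply Rle_trans with (sum_n h (n0 + n * D)).
      + assert (Hinc : forall A B, (A <= B)%nat -> sum_n h A <= sum_n h B).
        { intros A B HAB. induction HAB as [| B HAB IH]; [lra |].
          rewrite sum_Sn. unfold plus; simpl. specialize (Hpos (S B)). lra. }
        apply Hinc. nia.
      + rewrite Hsum. apply partial_sum_le_Series; assumption. }
  destruct Hex as [b Hb]. exists b. exact Hb.
Qed.

(** The given recurrence with [sgn] in place of i, so that both signs are treated at once, and with
    the backward coefficient rewritten as the forward weight at the previous site. *)
Definition eigen_recurrence (k l : nat) (f : nat -> R) (sgn : C) (n0 : nat) (dd : nat -> C) : Prop :=
  forall r : nat,
    Cminus (Cminus (Cmult (RtoC (beta k l (n0 + r * (k - l)))) (dd (S r)))
                   (Cmult (Cplus (RtoC 1) (Cmult sgn (RtoC (f (n0 + r * (k - l))%nat)))) (dd r)))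
           (match r with
            | O => RtoC 0
            | S r' => Cmult (RtoC (beta k l (n0 + r' * (k - l)))) (dd r')
            end) = RtoC 0.

Lemma beta_lk_chain (k l n0 r : nat) : (l < k)%nat -> (l <= n0)%nat ->
  beta l k (n0 + S r * (k - l)) = beta k l (n0 + r * (k - l)).
Proof.
  intros H Hn.
  pose proof (Nat.le_0_l (r * (k - l))).
  replace (n0 + S r * (k - l))%nat with (n0 + r * (k - l) - l + k)%nat by (simpl; lia).
  rewrite beta_swap. f_equal. lia.
Qed.

Lemma recurrence_plus k l f n0 dd : (l < k)%nat -> (l <= n0)%nat ->
  recurrence k l f n0 dd -> eigen_recurrence k l f Ci n0 dd.
Proof.
  intros H Hn Hr r. specialize (Hr r). destruct r as [| r]; [exact Hr |].
  rewrite beta_lk_chain in Hr by assumption. exact Hr.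
Qed.

Lemma Cconj_RtoC (r : R) : Cconj (RtoC r) = RtoC r.
Proof. apply injective_projections; simpl; ring. Qed.

Lemma Cconj_Ci : Cconj Ci = Copp Ci.
Proof. apply injective_projections; simpl; ring. Qed.

Lemma Cconj_mCi : Cconj (Copp Ci) = Copp (Copp Ci).
Proof. apply injective_projections; simpl; ring. Qed.

(** Complex conjugation of the recurrence: the weights and [f] are real, so only i changes sign. *)
Lemma recurrence_minus k l f n0 dd : (l < k)%nat -> (l <= n0)%nat ->
  recurrence k l f n0 dd -> eigen_recurrence k l f (Copp Ci) n0 (fun r => Cconj (dd r)).
Proof.
  intros H Hn Hr r. pose proof (recurrence_plus k l f n0 dd H Hn Hr r) as E.
  apply (f_equal Cconj) in E.
  rewrite !Cminus_conj, !Cmult_conj, Cplus_conj, Cmult_conj, !Cconj_RtoC, Cconj_Ci in E.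
  destruct r as [| r]; [rewrite Cconj_RtoC in E | rewrite Cmult_conj, Cconj_RtoC in E]; exact E.
Qed.

Lemma Aop_chain_0 k l theta f (x : seqC) (n0 : nat) : (l <= n0 < k)%nat ->
  Aop k l theta f x n0 =
  Cplus (Cmult (Cconj (xi theta)) (Cmult (RtoC (beta k l n0)) (x (n0 + 1 * (k - l))%nat)))
        (Cmult (RtoC (f n0)) (x n0)).
Proof.
  intros H. rewrite Aop_formula, (beta_lt l k) by lia.
  replace (n0 - l + k)%nat with (n0 + 1 * (k - l))%nat by lia. ring.
Qed.

Lemma Aop_chain_S k l theta f (x : seqC) (n0 r : nat) : (l < k)%nat -> (l <= n0)%nat ->
  Aop k l theta f x (n0 + S r * (k - l))%nat =
  Cplus (Cplus (Cmult (xi theta)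
                 (Cmult (RtoC (beta k l (n0 + r * (k - l)))) (x (n0 + r * (k - l))%nat)))
               (Cmult (Cconj (xi theta))
                 (Cmult (RtoC (beta k l (n0 + S r * (k - l)))) (x (n0 + S (S r) * (k - l))%nat))))
        (Cmult (RtoC (f (n0 + S r * (k - l))%nat)) (x (n0 + S r * (k - l))%nat)).
Proof.
  intros H Hn. rewrite Aop_formula, beta_lk_chain by assumption.
  pose proof (Nat.le_0_l (r * (k - l))).
  replace (n0 + S r * (k - l) - k + l)%nat with (n0 + r * (k - l))%nat by (simpl; lia).
  replace (n0 + S r * (k - l) - l + k)%nat with (n0 + S (S r) * (k - l))%nat by (simpl; lia).
  reflexivity.
Qed.

Lemma Aop_low k l theta f (x : seqC) (n : nat) : (l < k)%nat -> (n < l)%nat ->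
  Aop k l theta f x n = Cmult (RtoC (f n)) (x n).
Proof.
  intros H Hn. rewrite Aop_formula, (beta_lt l k), (beta_lt k l) by lia. ring.
Qed.

(** The phase [xi^r] absorbs [xi] and its conjugate in the off-diagonal entries, and [sgn^2 = -1]
    converts the symmetric Jacobi equation into the recurrence, whose two neighbour terms carry
    opposite signs. On the other chains and below [l] both sides vanish. *)
Lemma phivec_eigen k l theta f sgn n0 dd : (l < k)%nat -> (l <= n0 < k)%nat ->
  Cmult sgn sgn = Copp (RtoC 1) -> eigen_recurrence k l f sgn n0 dd ->
  Aop k l theta f (phivec k l theta sgn n0 dd) = vscal sgn (phivec k l theta sgn n0 dd).
Proof.
  intros H Hn Hs Hr. set (v := phivec k l theta sgn n0 dd).
  apply functional_extensionality; intro n. unfold vscal.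
  destruct (le_lt_dec l n) as [L | L].
  2:{ rewrite Aop_low by assumption. unfold v. rewrite phivec_off; [ring | assumption |].
      intros r. pose proof (Nat.le_0_l (r * (k - l))). lia. }
  destruct (chain_exists k l n H L) as (n1 & r & Hn1 & ->).
  pose proof (xi_unit theta) as Hxi.
  destruct (Nat.eq_dec n1 n0) as [-> | Ne].
  - unfold v. specialize (Hr r). destruct r as [| r].
    + rewrite Nat.mul_0_l, Nat.add_0_r in *. rewrite Aop_chain_0 by assumption.
      rewrite phivec_on by assumption.
      pose proof (phivec_on k l theta sgn n0 dd 0 H) as E0.
      rewrite Nat.mul_0_l, Nat.add_0_r in E0. rewrite E0. simpl.
      assert (E : (RtoC (beta k l n0) * dd 1%nat = (1 + sgn * RtoC (f n0)) * dd 0%nat)%C).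
      { apply Ceq_minus. rewrite <- Hr. ring. }
      transitivity (sgn * (xi theta * Cconj (xi theta)) * (RtoC (beta k l n0) * dd 1%nat)
                    + RtoC (f n0) * dd 0%nat)%C; [ring |].
      rewrite Hxi, E.
      transitivity (sgn * dd 0%nat + (sgn * sgn + 1) * RtoC (f n0) * dd 0%nat)%C; [ring |].
      rewrite Hs. ring.
    + rewrite Aop_chain_S by lia. rewrite !phivec_on by assumption. simpl (Defs.Cpow _ _).
      set (w := RtoC (beta k l (n0 + S r * (k - l)))) in *.
      set (w0 := RtoC (beta k l (n0 + r * (k - l)))) in *.
      set (F := RtoC (f (n0 + S r * (k - l))%nat)) in *.
      set (S0 := Defs.Cpow sgn r). set (X0 := Defs.Cpow (xi theta) r).
      assert (E : (w * dd (S (S r)) = (1 + sgn * F) * dd (S r) + w0 * dd r)%C).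
      { apply Ceq_minus. rewrite <- Hr. ring. }
      transitivity (xi theta * X0 * S0 * (w0 * dd r)
         + (xi theta * Cconj (xi theta)) * (sgn * sgn) * S0 * (xi theta * X0) * (w * dd (S (S r)))
         + F * sgn * S0 * (xi theta * X0) * dd (S r))%C; [ring |].
      rewrite Hxi, Hs, E.
      transitivity (- (S0 * (xi theta * X0) * dd (S r)))%C; [ring |].
      transitivity ((sgn * sgn) * S0 * (xi theta * X0) * dd (S r))%C; [rewrite Hs; ring | ring].
  - assert (Z : forall r', v (n1 + r' * (k - l))%nat = RtoC 0).
    { intro r'. apply phivec_off; [assumption |]. intros r'' E.
      apply Ne. apply (chain_unique k l n1 n0 r' r''); assumption. }
    destruct r as [| r].
    + rewrite (Nat.mul_0_l (k - l)), Nat.add_0_r. rewrite Aop_chain_0 by assumption.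
      rewrite Z. pose proof (Z 0%nat) as Z0. rewrite Nat.mul_0_l, Nat.add_0_r in Z0.
      rewrite Z0. ring.
    + rewrite Aop_chain_S by lia. rewrite !Z. ring.
Qed.

(** On a chain the equation can be solved for the next entry, because [beta k l n >= 1]. At the
    starting site the backward weight vanishes, so the value there fixes the whole chain. Below [l]
    the matrix is diagonal and real, and a nonreal eigenvalue leaves only zero. *)
Lemma eigen_unique k l theta f sgn (x : seqC) : (l < k)%nat ->
  Cconj sgn = Copp sgn -> sgn <> RtoC 0 ->
  Aop k l theta f x = vscal sgn x ->
  (forall n0, (l <= n0 < k)%nat -> x n0 = RtoC 0) -> x = vzero.
Proof.
  intros H Hc Hs He H0.
  assert (He' : forall n, Aop k l theta f x n = Cmult sgn (x n)) by (intro; rewrite He; reflexivity).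
  assert (Hxi : Cconj (xi theta) <> RtoC 0).
  { intro E. apply (xi_neq0 theta). rewrite <- (Cconj_conj (xi theta)), E, Cconj_RtoC. reflexivity. }
  assert (Hb : forall n, (l <= n)%nat -> RtoC (beta k l n) <> RtoC 0).
  { intros n Hn E. apply RtoC_inj in E. pose proof (beta_ge1 k l n Hn). lra. }
  assert (cancel : forall a b : C, a <> RtoC 0 -> Cmult a b = RtoC 0 -> b = RtoC 0).
  { intros a b Ha E. replace b with (/ a * (a * b))%C by (field; assumption).
    rewrite E. ring. }
  assert (Hchain : forall n0, (l <= n0 < k)%nat -> forall r,
            x (n0 + r * (k - l))%nat = RtoC 0 /\ x (n0 + S r * (k - l))%nat = RtoC 0).
  { intros n0 Hn0. induction r as [| r [IH1 IH2]].
    - rewrite Nat.mul_0_l, Nat.add_0_r. split; [apply H0, Hn0 |].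
      specialize (He' n0). rewrite Aop_chain_0, (H0 n0) in He' by assumption.
      apply (cancel (RtoC (beta k l n0))); [apply Hb; lia |].
      apply (cancel (Cconj (xi theta))); [assumption |].
      transitivity (sgn * RtoC 0)%C; [rewrite <- He' |]; ring.
    - split; [assumption |].
      specialize (He' (n0 + S r * (k - l))%nat).
      rewrite Aop_chain_S, IH1, IH2 in He' by lia.
      apply (cancel (RtoC (beta k l (n0 + S r * (k - l))))); [apply Hb; lia |].
      apply (cancel (Cconj (xi theta))); [assumption |].
      transitivity (sgn * RtoC 0)%C; [rewrite <- He' |]; ring. }
  apply functional_extensionality; intro n.
  destruct (le_lt_dec l n) as [L | L].
  - destruct (chain_exists k l n H L) as (n1 & r & Hn1 & ->). apply Hchain, Hn1.
  - specialize (He' n). rewrite Aop_low in He' by assumption.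
    apply (cancel (RtoC (f n) - sgn)%C).
    + intro E. apply Hs.
      assert (E2 : sgn = RtoC (f n)) by (symmetry; apply Ceq_minus; exact E).
      rewrite E2, Cconj_RtoC in Hc. rewrite E2.
      apply (f_equal Re) in Hc. simpl in Hc. unfold RtoC; f_equal. lra.
    + transitivity (RtoC (f n) * x n - sgn * x n)%C; [ring | rewrite He'; ring].
Qed.

(** Guarantees nonzero starting entries of the chain vectors, from which both their independence and
    the coefficients of expansions are read off. *)
Lemma recurrence_init_neq0 k l f n0 dd : (l < k)%nat -> (l <= n0)%nat ->
  recurrence k l f n0 dd -> (exists r, dd r <> RtoC 0) -> dd 0%nat <> RtoC 0.
Proof.
  intros H Hn Hr [r Hne] E.
  assert (Hb : forall n, (l <= n)%nat -> RtoC (beta k l n) <> RtoC 0).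
  { intros n Hn' E'. apply RtoC_inj in E'. pose proof (beta_ge1 k l n Hn'). lra. }
  assert (cancel : forall a b : C, a <> RtoC 0 -> Cmult a b = RtoC 0 -> b = RtoC 0).
  { intros a b Ha E'. replace b with (/ a * (a * b))%C by (field; assumption).
    rewrite E'. ring. }
  assert (K : forall r, dd r = RtoC 0 /\ dd (S r) = RtoC 0).
  { induction r0 as [| r0 [IH1 IH2]].
    - split; [assumption |]. specialize (Hr 0%nat). simpl in Hr. rewrite E in Hr.
      apply (cancel (RtoC (beta k l (n0 + 0)))); [apply Hb; lia |].
      rewrite <- Hr. ring.
    - split; [assumption |]. specialize (Hr (S r0)). cbv beta iota in Hr.
      rewrite IH1, IH2 in Hr.
      apply (cancel (RtoC (beta k l (n0 + S r0 * (k - l))))); [apply Hb; lia |].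
      rewrite <- Hr. ring. }
  apply Hne, K.
Qed.

Lemma phivec_l2 k l theta sgn n0 dd : (l < k)%nat -> Cmod sgn = 1 ->
  ex_series (fun r => Cmod (dd r) ^ 2) -> l2 (phivec k l theta sgn n0 dd).
Proof.
  intros H Hsgn Hdd.
  apply (ex_series_spread (fun r => Cmod (dd r) ^ 2) _ n0 (k - l)); [lia | | exact Hdd | |].
  - intro; apply sqr_nonneg_Cmod.
  - intro r. rewrite phivec_on by assumption.
    rewrite !Cmod_mult, !Cmod_Cpow, Hsgn, Cmod_xi, !pow1. ring.
  - intros m Hm. rewrite phivec_off, Cmod_0 by assumption. ring.
Qed.

(** The substitution [z r = i^r dd r] restores the symmetric Jacobi equation with eigenvalue i,
    without changing moduli. Its real and imaginary parts form the coupled system of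
    [chain_square_summable]. *)
Lemma recurrence_square_summable k l f n0 dd :
  (l < k)%nat -> (3 <= k + l)%nat -> (l <= n0)%nat -> (forall n, 0 <= f n) ->
  (exists lam : nat -> R, lam 0%nat < 2 /\ asymp_expansion (fun n => f n / beta k l n) lam) ->
  recurrence k l f n0 dd -> ex_series (fun r => Cmod (dd r) ^ 2).
Proof.
  intros H Hs Hn Hf Hasym Hr.
  set (z := fun r => Cmult (Defs.Cpow Ci r) (dd r)).
  assert (Ci2 : (Ci * Ci = - RtoC 1)%C) by (apply injective_projections; simpl; ring).
  assert (Hz : forall r, (RtoC (beta k l (n0 + S r * (k - l))) * z (S (S r))
             + RtoC (f (n0 + S r * (k - l))%nat) * z (S r)
             + RtoC (beta k l (n0 + r * (k - l))) * z r = Ci * z (S r))%C).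
  { intro r. pose proof (recurrence_plus k l f n0 dd H Hn Hr (S r)) as E. cbv beta iota in E.
    unfold z. simpl (Defs.Cpow _ _). set (S0 := Defs.Cpow Ci r).
    set (w := RtoC (beta k l (n0 + S r * (k - l)))) in *.
    set (w0 := RtoC (beta k l (n0 + r * (k - l)))) in *.
    set (F := RtoC (f (n0 + S r * (k - l))%nat)) in *.
    assert (E2 : (w * dd (S (S r)) = (1 + Ci * F) * dd (S r) + w0 * dd r)%C).
    { apply Ceq_minus. rewrite <- E. ring. }
    transitivity ((Ci * Ci) * S0 * (w * dd (S (S r))) + F * Ci * S0 * dd (S r) + w0 * S0 * dd r)%C;
      [ring |].
    rewrite E2, Ci2.
    transitivity (- RtoC 1 * S0 * dd (S r))%C; [ring |]. rewrite <- Ci2. ring. }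
  apply ex_series_extR with (fun r => Re (z r) ^ 2 + Im (z r) ^ 2).
  - intro r. rewrite <- Cmod2_alt. unfold z. rewrite Cmod_mult, Cmod_Cpow, Cmod_Ci, pow1. ring.
  - apply (chain_square_summable k l n0 f (fun r => Re (z r)) (fun r => Im (z r))); auto;
      intro r; specialize (Hz r).
    + apply (f_equal Re) in Hz. unfold Re, Im in *. simpl in Hz |- *. lra.
    + apply (f_equal Im) in Hz. unfold Re, Im in *. simpl in Hz |- *. lra.
Qed.

(** * Finite-dimensional linear algebra *)

Definition kron (i j : nat) : C := RtoC (if i =? j then 1 else 0).

Definition dotC (D : nat) (a b : nat -> C) : C := sumC D (fun i => Cmult (Cconj (a i)) (b i)).

Lemma sumC_plus (d : nat) (a b : nat -> C) :
  sumC d (fun i => Cplus (a i) (b i)) = Cplus (sumC d a) (sumC d b).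
Proof. induction d as [| d IH]; simpl; [| rewrite IH]; ring. Qed.

Lemma sumC_scal (d : nat) (c : C) (a : nat -> C) :
  sumC d (fun i => Cmult c (a i)) = Cmult c (sumC d a).
Proof. induction d as [| d IH]; simpl; [| rewrite IH]; ring. Qed.

Lemma sumC_scal_r (d : nat) (c : C) (a : nat -> C) :
  sumC d (fun i => Cmult (a i) c) = Cmult (sumC d a) c.
Proof. induction d as [| d IH]; simpl; [| rewrite IH]; ring. Qed.

Lemma sumC_conj (d : nat) (a : nat -> C) :
  Cconj (sumC d a) = sumC d (fun i => Cconj (a i)).
Proof.
  induction d as [| d IH]; simpl; [| rewrite Cplus_conj, IH; reflexivity].
  apply injective_projections; simpl; ring.
Qed.

Lemma sumC_exchange (d d' : nat) (a : nat -> nat -> C) :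
  sumC d (fun i => sumC d' (fun j => a i j)) = sumC d' (fun j => sumC d (fun i => a i j)).
Proof.
  induction d as [| d IH]; simpl.
  - symmetry. apply sumC_0. reflexivity.
  - rewrite IH, <- sumC_plus. reflexivity.
Qed.

Lemma kron_diag (i : nat) : kron i i = RtoC 1.
Proof. unfold kron. rewrite Nat.eqb_refl. reflexivity. Qed.

Lemma kron_off (i j : nat) : i <> j -> kron i j = RtoC 0.
Proof. intros H. unfold kron. apply Nat.eqb_neq in H. rewrite H. reflexivity. Qed.

Lemma kron_sym (i j : nat) : kron i j = kron j i.
Proof. unfold kron. rewrite Nat.eqb_sym. reflexivity. Qed.

Lemma kron_conj (i j : nat) : Cconj (kron i j) = kron i j.
Proof. unfold kron. apply injective_projections; simpl; ring. Qed.

Lemma sumC_kron (d i : nat) (a : nat -> C) : (i < d)%nat ->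
  sumC d (fun j => Cmult (kron i j) (a j)) = a i.
Proof.
  intros H. rewrite (sumC_single d i); [rewrite kron_diag; ring | assumption |].
  intros j _ Hj. rewrite kron_off by auto. ring.
Qed.

Lemma sumC_sqr_eq0 (d : nat) (a : nat -> C) :
  sumC d (fun i => Cmult (a i) (Cconj (a i))) = RtoC 0 ->
  forall i, (i < d)%nat -> a i = RtoC 0.
Proof.
  intros H.
  (* Each partial sum is carried as a nonnegative real, so that a vanishing total forces every term
     to vanish. *)
  assert (K : forall m, exists x, 0 <= x /\ sumC m (fun i => Cmult (a i) (Cconj (a i))) = RtoC x /\
                (x = 0 -> forall i, (i < m)%nat -> a i = RtoC 0)).
  { induction m as [| m (x & Hx & E & Z)].
    - exists 0. repeat split; [lra | intros _ i Hi; lia].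
    - exists (x + Cmod (a m) ^ 2). pose proof (sqr_nonneg_Cmod (a m)) as P. repeat split.
      + lra.
      + cbn [sumC]. rewrite E, RtoC_plus, Cmod2_conj. reflexivity.
      + intros E0 i Hi. destruct (Nat.eq_dec i m) as [-> | Ne].
        * apply Cmod_eq_0. nra.
        * apply Z; [lra | lia]. }
  destruct (K d) as (x & _ & E & Z). rewrite H in E. apply RtoC_inj in E.
  apply Z. auto.
Qed.

Lemma dotC_self_eq0 (d : nat) (a : nat -> C) : dotC d a a = RtoC 0 ->
  forall i, (i < d)%nat -> a i = RtoC 0.
Proof.
  intros H. apply sumC_sqr_eq0. rewrite <- H. apply sumC_ext. intros; ring.
Qed.

(* The Gram matrix [P] of the columns satisfies [sum |P - 1|^2 = D - 2 D + D = 0]. *)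
Lemma unitary_columns (D : nat) (U : nat -> nat -> C) : unitary D U ->
  forall j j', (j < D)%nat -> (j' < D)%nat ->
    sumC D (fun i => Cmult (Cconj (U i j)) (U i j')) = kron j j'.
Proof.
  intros HU.
  set (P := fun j j' => sumC D (fun i => Cmult (Cconj (U i j)) (U i j'))).
  assert (HPc : forall j j', Cconj (P j j') = P j' j).
  { intros j j'. unfold P. rewrite sumC_conj. apply sumC_ext. intros i _.
    rewrite Cmult_conj, Cconj_conj. ring. }
  set (S1 := sumC D (fun _ => RtoC 1)).
  assert (Htr : sumC D (fun j => P j j) = S1).
  { unfold P. rewrite sumC_exchange. apply sumC_ext. intros i Hi.
    rewrite <- (kron_diag i). unfold kron. rewrite <- (HU i i Hi Hi).
    apply sumC_ext. intros; ring. }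
  (* Since the rows are orthonormal, [P] is idempotent; being Hermitian as well, it has [sum |P|^2]
     equal to its trace. *)
  assert (HPP : forall j j', (j < D)%nat -> (j' < D)%nat ->
            sumC D (fun m => Cmult (P j m) (P m j')) = P j j').
  { intros j j' Hj Hj'. unfold P.
    transitivity (sumC D (fun m => sumC D (fun i => sumC D (fun i' =>
      (Cconj (U i j) * U i' j' * (U i m * Cconj (U i' m)))%C)))).
    { apply sumC_ext. intros m _. rewrite <- sumC_scal_r. apply sumC_ext. intros i _.
      rewrite <- sumC_scal. apply sumC_ext. intros i' _. ring. }
    rewrite sumC_exchange. apply sumC_ext. intros i Hi. rewrite sumC_exchange.
    transitivity (sumC D (fun i' => (kron i i' * (Cconj (U i j) * U i' j'))%C)).
    - apply sumC_ext. intros i' Hi'. rewrite sumC_scal, (HU i i' Hi Hi').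
      unfold kron. ring.
    - apply sumC_kron, Hi. }
  assert (Hfro : sumC D (fun j => sumC D (fun j' =>
     ((P j j' - kron j j') * Cconj (P j j' - kron j j'))%C)) = RtoC 0).
  { transitivity (sumC D (fun j => (P j j + - RtoC 1 * P j j + (- RtoC 1 * P j j + RtoC 1))%C)).
    - apply sumC_ext. intros j Hj.
      transitivity (sumC D (fun j' => (P j j' * P j' j + - RtoC 1 * (kron j j' * P j' j)
         + (- RtoC 1 * (kron j j' * P j j') + kron j j' * kron j j'))%C)).
      + apply sumC_ext. intros j' _. rewrite Cminus_conj, HPc, kron_conj. ring.
      + rewrite !sumC_plus, !sumC_scal, HPP, !sumC_kron, kron_diag by assumption. reflexivity.
    - rewrite !sumC_plus, !sumC_scal, Htr. fold S1. ring. }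
  intros j j' Hj Hj'. apply Ceq_minus. fold (P j j').
  set (rowsq := fun j => sumC D (fun j' => ((P j j' - kron j j') * Cconj (P j j' - kron j j'))%C)).
  assert (K : forall d, (d <= D)%nat -> exists x, 0 <= x /\ sumC d rowsq = RtoC x /\
                (x = 0 -> forall i, (i < d)%nat -> rowsq i = RtoC 0)).
  { assert (R : forall i m, exists y, 0 <= y /\
       sumC m (fun j' => ((P i j' - kron i j') * Cconj (P i j' - kron i j'))%C) = RtoC y).
    { intros i m. induction m as [| m (y & Hy & E)].
      - exists 0. split; [lra | reflexivity].
      - exists (y + Cmod (P i m - kron i m)%C ^ 2). split.
        + pose proof (sqr_nonneg_Cmod (P i m - kron i m)%C). lra.
        + cbn [sumC]. rewrite E, RtoC_plus, Cmod2_conj. reflexivity. }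
    induction d as [| d IH]; intros Hd.
    - exists 0. repeat split; [lra | intros _ i Hi; lia].
    - destruct (IH ltac:(lia)) as (x & Hx & E & Z). destruct (R d D) as (y & Hy & E').
      fold (rowsq d) in E'. exists (x + y). repeat split.
      + lra.
      + cbn [sumC]. rewrite E, E', RtoC_plus. reflexivity.
      + intros E0 i Hi. destruct (Nat.eq_dec i d) as [-> | Ne].
        * rewrite E'. f_equal. lra.
        * apply Z; [lra | lia]. }
  destruct (K D (Nat.le_refl D)) as (x & _ & E & Z).
  fold rowsq in Hfro. rewrite Hfro in E. apply RtoC_inj in E.
  pose proof (Z (eq_sym E) j Hj) as R. unfold rowsq in R.
  exact (sumC_sqr_eq0 D (fun j' => (P j j' - kron j j')%C) R j' Hj').
Qed.

(** Gaussian elimination on the last coordinate. If it vanishes on the whole subspace, it is itself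
    an annihilator. Otherwise a vector [p] with last entry 1 reduces everything to the hyperplane
    where that entry is zero, and an annihilator found there extends by requiring the value 0 on
    [p]. Vectors are functions on all of [nat], whence the closure under agreement below [D]. *)
Lemma subspace_full_or_annihilated (D : nat) (P : (nat -> C) -> Prop) :
  (forall a b, P a -> P b -> P (fun i => Cplus (a i) (b i))) ->
  (forall c a, P a -> P (fun i => Cmult c (a i))) ->
  (forall a b, (forall i, (i < D)%nat -> a i = b i) -> P a -> P b) ->
  P (fun _ => RtoC 0) ->
  (forall a, P a) \/
  exists q, (exists i, (i < D)%nat /\ q i <> RtoC 0) /\
    forall a, P a -> sumC D (fun i => Cmult (q i) (a i)) = RtoC 0.
Proof.
  revert P. induction D as [| D IH]; intros P Hadd Hscal Hext H0.
  - left. intro a. apply (Hext (fun _ => RtoC 0)); [intros; lia | assumption].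
  - destruct (classic (exists p, P p /\ p D <> RtoC 0)) as [(p' & Hp' & Hne) | No].
    2:{ right. exists (kron D). split.
        - exists D. split; [lia |]. rewrite kron_diag. apply C1_nz.
        - intros a Ha. rewrite sumC_kron by lia.
          destruct (classic (a D = RtoC 0)); [assumption |].
          exfalso; apply No; exists a; auto. }
    set (p := fun i => Cmult (/ p' D)%C (p' i)).
    assert (Hp : P p) by (apply Hscal, Hp').
    assert (HpD : p D = RtoC 1) by (unfold p; field; assumption).
    set (cut := fun (a : nat -> C) i => if i =? D then RtoC 0 else a i).
    set (red := fun (a : nat -> C) i => Cplus (a i) (Cmult (Copp (a D)) (p i))).
    assert (Hred : forall a i, cut (red a) i = red a i).
    { intros a i. unfold cut. destruct (Nat.eqb_spec i D) as [-> |]; [| reflexivity].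
      unfold red. rewrite HpD. ring. }
    destruct (IH (fun a => P (cut a))) as [All | (q & (i & Hi & Hqi) & Hq)].
    + intros a b Ha Hb. apply (Hext (fun i => Cplus (cut a i) (cut b i))); [| auto].
      intros i _. unfold cut. destruct (i =? D); ring.
    + intros c a Ha. apply (Hext (fun i => Cmult c (cut a i))); [| auto].
      intros i _. unfold cut. destruct (i =? D); ring.
    + intros a b Hab. apply Hext. intros i Hi. unfold cut.
      destruct (Nat.eqb_spec i D); [reflexivity | apply Hab; lia].
    + apply (Hext (fun _ => RtoC 0)); [| assumption].
      intros i _. unfold cut. destruct (i =? D); reflexivity.
    + left. intro a.
      apply (Hext (fun i => Cplus (cut (red a) i) (Cmult (a D) (p i)))).
      * intros i _. rewrite Hred. unfold red. ring.
      * apply Hadd; [apply All | apply Hscal, Hp].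
    + right.
      exists (fun i => if i =? D then Copp (sumC D (fun j => Cmult (q j) (p j))) else q i).
      split.
      * exists i. split; [lia |]. destruct (Nat.eqb_spec i D); [lia | assumption].
      * intros a Ha. cbn [sumC]. rewrite Nat.eqb_refl.
        assert (E : sumC D (fun i => Cmult (q i) (red a i)) = RtoC 0).
        { apply Hq. apply (Hext (red a)); [intros; symmetry; apply Hred |].
          apply Hadd; [assumption | apply Hscal, Hp]. }
        unfold red in E.
        rewrite (sumC_ext D _ (fun i => (q i * a i + - a D * (q i * p i))%C)) in E
          by (intros; ring).
        rewrite sumC_plus, sumC_scal in E.
        rewrite (sumC_ext D _ (fun i => (q i * a i)%C)).
        -- rewrite <- E. ring.
        -- intros j Hj. destruct (Nat.eqb_spec j D); [lia | reflexivity].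
Qed.

(** * Self-adjoint extensions in orthonormal deficiency bases *)

(** Isolates what the extension theory takes from the concrete operator. The span clauses say that
    the eigenspaces of i and -i of the maximal operator are exhausted. *)
Record deficiency_bases (F : seqC -> seqC) (D : nat) (e g : nat -> seqC) : Prop := {
  db_fs : formally_symmetric F;
  db_e_l2 : forall i, (i < D)%nat -> l2 (e i);
  db_g_l2 : forall i, (i < D)%nat -> l2 (g i);
  db_e_eig : forall i, (i < D)%nat -> F (e i) = vscal Ci (e i);
  db_g_eig : forall i, (i < D)%nat -> F (g i) = vscal (Copp Ci) (g i);
  db_e_orth : forall i j, (i < D)%nat -> (j < D)%nat -> inner (e i) (e j) = kron i j;
  db_g_orth : forall i j, (i < D)%nat -> (j < D)%nat -> inner (g i) (g j) = kron i j;
  db_e_span : forall p, l2 p -> F p = vscal Ci p -> exists c, p = vlin D c e;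
  db_g_span : forall p, l2 p -> F p = vscal (Copp Ci) p -> exists c, p = vlin D c g
}.

Lemma vlin_ext (D : nat) (a b : nat -> C) (v : nat -> seqC) :
  (forall i, (i < D)%nat -> a i = b i) -> vlin D a v = vlin D b v.
Proof.
  intros H. apply functional_extensionality; intro n. apply sumC_ext.
  intros i Hi. rewrite H by assumption. reflexivity.
Qed.

Lemma vlin_add (D : nat) (a b : nat -> C) (v : nat -> seqC) :
  vlin D (fun i => Cplus (a i) (b i)) v = vadd (vlin D a v) (vlin D b v).
Proof.
  apply functional_extensionality; intro n. unfold vadd, vlin.
  rewrite <- sumC_plus. apply sumC_ext. intros; ring.
Qed.

Lemma vlin_scal (D : nat) (c : C) (a : nat -> C) (v : nat -> seqC) :
  vlin D (fun i => Cmult c (a i)) v = vscal c (vlin D a v).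
Proof.
  apply functional_extensionality; intro n. unfold vscal, vlin.
  rewrite <- sumC_scal. apply sumC_ext. intros; ring.
Qed.

Lemma vlin_0 (D : nat) (v : nat -> seqC) : vlin D (fun _ => RtoC 0) v = vzero.
Proof.
  apply functional_extensionality; intro n. unfold vlin, vzero.
  apply sumC_0. intros; ring.
Qed.

Lemma fs_vzero (F : seqC -> seqC) : formally_symmetric F -> F vzero = vzero.
Proof.
  intros (_ & Hs & _).
  replace vzero with (vscal (RtoC 0) vzero)
    by (apply functional_extensionality; intro n; unfold vscal, vzero; ring).
  rewrite Hs. apply functional_extensionality; intro n. unfold vscal, vzero. ring.
Qed.

Lemma vlin_eigen (F : seqC -> seqC) (s : C) (D : nat) (c : nat -> C) (v : nat -> seqC) :
  formally_symmetric F -> (forall i, (i < D)%nat -> F (v i) = vscal s (v i)) ->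
  F (vlin D c v) = vscal s (vlin D c v).
Proof.
  intros HF. pose proof HF as (Ha & Hs & _). induction D as [| D IH]; intros H.
  - change (vlin 0 c v) with vzero. rewrite fs_vzero by assumption.
    apply functional_extensionality; intro n. unfold vscal, vzero. ring.
  - rewrite vlin_S, Ha, Hs, IH, H by (try (intros; apply H); lia).
    apply functional_extensionality; intro n. unfold vadd, vscal. ring.
Qed.

Lemma inner_vlin_orthonormal (D : nat) (a b : nat -> C) (v : nat -> seqC) :
  (forall i, (i < D)%nat -> l2 (v i)) ->
  (forall i j, (i < D)%nat -> (j < D)%nat -> inner (v i) (v j) = kron i j) ->
  inner (vlin D a v) (vlin D b v) = dotC D a b.
Proof.
  intros Hl Ho. rewrite inner_vlin_l by (auto using l2_vlin). unfold dotC.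
  apply sumC_ext. intros i Hi. f_equal.
  rewrite inner_vlin_r by auto.
  rewrite (sumC_ext D _ (fun j => Cmult (kron i j) (b j))).
  - apply sumC_kron, Hi.
  - intros j Hj. rewrite Ho by assumption. ring.
Qed.

Definition dvec (D : nat) (e g : nat -> seqC) (a b : nat -> C) : seqC :=
  vadd (vlin D a e) (vlin D b g).

(** The boundary form of the adjoint: a restriction of the adjoint is symmetric exactly when this
    form vanishes on its domain. *)
Definition bform (F : seqC -> seqC) (x y : seqC) : C :=
  Cminus (inner x (F y)) (inner (F x) y).

Lemma dvec_ext D e g a b a' b' : (forall i, (i < D)%nat -> a i = a' i) ->
  (forall i, (i < D)%nat -> b i = b' i) -> dvec D e g a b = dvec D e g a' b'.
Proof. intros H H'. unfold dvec. f_equal; apply vlin_ext; assumption. Qed.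

Lemma dvec_add D e g a b a' b' :
  vadd (dvec D e g a b) (dvec D e g a' b') =
  dvec D e g (fun i => Cplus (a i) (a' i)) (fun i => Cplus (b i) (b' i)).
Proof.
  unfold dvec. rewrite !vlin_add. apply functional_extensionality; intro n.
  unfold vadd. ring.
Qed.

Lemma dvec_scal D e g c a b :
  vscal c (dvec D e g a b) = dvec D e g (fun i => Cmult c (a i)) (fun i => Cmult c (b i)).
Proof.
  unfold dvec. rewrite !vlin_scal. apply functional_extensionality; intro n.
  unfold vadd, vscal. ring.
Qed.

Lemma dvec_l2 F D e g a b : deficiency_bases F D e g -> l2 (dvec D e g a b).
Proof.
  intros H. apply l2_vadd; apply l2_vlin; intros i Hi;
    [apply (db_e_l2 _ _ _ _ H) | apply (db_g_l2 _ _ _ _ H)]; assumption.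
Qed.

Lemma dvec_F F D e g a b : deficiency_bases F D e g ->
  F (dvec D e g a b) = vadd (vscal Ci (vlin D a e)) (vscal (Copp Ci) (vlin D b g)).
Proof.
  intros H. pose proof (db_fs _ _ _ _ H) as HF. unfold dvec.
  rewrite (proj1 HF).
  rewrite (vlin_eigen F Ci D a e HF (db_e_eig _ _ _ _ H)).
  rewrite (vlin_eigen F (Copp Ci) D b g HF (db_g_eig _ _ _ _ H)). reflexivity.
Qed.

Lemma dvec_F_l2 F D e g a b : deficiency_bases F D e g -> l2 (F (dvec D e g a b)).
Proof.
  intros H. rewrite (dvec_F F) by assumption.
  apply l2_vadd; apply l2_vscal, l2_vlin; intros i Hi;
    [apply (db_e_l2 _ _ _ _ H) | apply (db_g_l2 _ _ _ _ H)]; assumption.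
Qed.

Lemma dvec_adjoint F D e g a b : deficiency_bases F D e g ->
  adjoint (opgraph F) (dvec D e g a b) (F (dvec D e g a b)).
Proof.
  intros H. apply (adjoint_opgraph F); [apply H |].
  repeat split; [apply (dvec_l2 F) | apply dvec_F_l2]; assumption.
Qed.

(** Membership in the domain of the closure without an existential, the image being forced to equal
    [F w]. *)
Definition closure_dom (F : seqC -> seqC) (w : seqC) : Prop := gclosure (opgraph F) w (F w).

Lemma closure_dom_iff F w : formally_symmetric F ->
  (dom (gclosure (opgraph F)) w <-> closure_dom F w).
Proof.
  intros HF. split.
  - intros [w' Hw]. pose proof (closure_sub_adjoint F w w' HF Hw) as Ha.
    apply (adjoint_opgraph F) in Ha; [| assumption].
    destruct Ha as (_ & _ & ->). exact Hw.
  - intros H. exists (F w). exact H.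
Qed.

Lemma closure_dom_adjoint F w : formally_symmetric F -> closure_dom F w ->
  adjoint (opgraph F) w (F w).
Proof. intros HF H. apply closure_sub_adjoint; assumption. Qed.

Lemma D0_closure_dom F w : formally_symmetric F -> D0 w -> closure_dom F w.
Proof.
  intros HF H. pose proof HF as (_ & _ & HD & _).
  apply graph_sub_closure; auto using l2_D0. split; auto.
Qed.

Lemma adjoint_F_l2 F x y : formally_symmetric F -> adjoint (opgraph F) x y ->
  l2 x /\ l2 (F x) /\ y = F x.
Proof.
  intros HF H. apply (adjoint_opgraph F) in H; [| assumption].
  destruct H as (A & B & ->). auto.
Qed.

Lemma adjoint_decomposition F D e g x : deficiency_bases F D e g -> l2 x -> l2 (F x) ->
  exists w a b, closure_dom F w /\ x = vadd w (dvec D e g a b).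
Proof.
  intros H Hx HFx.
  destruct (von_neumann_decomposition F x (db_fs _ _ _ _ H) Hx HFx)
    as (w & p & q & Hw & Hp & Ep & Hq & Eq & ->).
  destruct (db_e_span _ _ _ _ H p Hp Ep) as [a ->].
  destruct (db_g_span _ _ _ _ H q Hq Eq) as [b ->].
  exists w, a, b. split; [exact Hw | reflexivity].
Qed.

Lemma bform_closure F w x : formally_symmetric F -> closure_dom F w ->
  l2 x -> l2 (F x) -> bform F w x = RtoC 0 /\ bform F x w = RtoC 0.
Proof.
  intros HF Hw Hx HFx.
  assert (Ha : adjoint (opgraph F) x (F x)) by (apply adjoint_opgraph; auto).
  pose proof (inner_closure_adjoint _ _ _ _ _ Hw Ha) as E. unfold bform. split.
  - rewrite (inner_conj (F x) w), (inner_conj x (F w)), E. ring.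
  - rewrite E. ring.
Qed.

Lemma bform_vadd F x x' y y' : formally_symmetric F ->
  l2 x -> l2 (F x) -> l2 x' -> l2 (F x') -> l2 y -> l2 (F y) -> l2 y' -> l2 (F y') ->
  bform F (vadd x x') (vadd y y') =
  Cplus (Cplus (bform F x y) (bform F x y')) (Cplus (bform F x' y) (bform F x' y')).
Proof.
  intros (Ha & _). intros. unfold bform. rewrite !Ha.
  rewrite !inner_vadd_r, !inner_vadd_l by auto using l2_vadd. ring.
Qed.

(** The mixed terms cancel without [e] and [g] being orthogonal to each other: for [p] in K_+ and
    [q] in K_-, [<p, F q> - <F p, q> = - i <p, q> + i <p, q>]. *)
Lemma bform_dvec F D e g a b a' b' : deficiency_bases F D e g ->
  bform F (dvec D e g a b) (dvec D e g a' b') =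
  Cmult (Cmult (RtoC 2) Ci) (Cminus (dotC D a a') (dotC D b b')).
Proof.
  intros H. unfold bform. rewrite !(dvec_F F) by assumption. unfold dvec.
  pose proof (fun c => l2_vlin D c e (db_e_l2 _ _ _ _ H)) as HE.
  pose proof (fun c => l2_vlin D c g (db_g_l2 _ _ _ _ H)) as HG.
  rewrite !inner_vadd_r, !inner_vadd_l, !inner_vscal_r, !inner_vscal_l
    by auto using l2_vadd, l2_vscal.
  rewrite !(inner_vlin_orthonormal D _ _ e), !(inner_vlin_orthonormal D _ _ g)
    by (apply H).
  assert (E1 : Cconj Ci = Copp Ci) by (apply injective_projections; simpl; ring).
  assert (E2 : Cconj (Copp Ci) = Ci) by (apply injective_projections; simpl; ring).
  rewrite E1, E2.
  replace (RtoC 2) with (1 + 1)%C by (apply injective_projections; simpl; ring).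
  ring.
Qed.

Lemma bform_decomposed F D e g w w' a b a' b' : deficiency_bases F D e g ->
  closure_dom F w -> closure_dom F w' ->
  bform F (vadd w (dvec D e g a b)) (vadd w' (dvec D e g a' b')) =
  Cmult (Cmult (RtoC 2) Ci) (Cminus (dotC D a a') (dotC D b b')).
Proof.
  intros H Hw Hw'. pose proof (db_fs _ _ _ _ H) as HF.
  assert (L : forall w, closure_dom F w -> l2 w /\ l2 (F w))
    by (intros ? K; split; apply K).
  destruct (L w Hw), (L w' Hw').
  pose proof (fun a b => dvec_l2 F D e g a b H) as L1.
  pose proof (fun a b => dvec_F_l2 F D e g a b H) as L2.
  rewrite bform_vadd, <- (bform_dvec F D e g) by auto.
  rewrite (proj1 (bform_closure F w w' HF Hw ltac:(auto) ltac:(auto))).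
  rewrite (proj1 (bform_closure F w _ HF Hw (L1 a' b') (L2 a' b'))).
  rewrite (proj2 (bform_closure F w' _ HF Hw' (L1 a b) (L2 a b))). ring.
Qed.

Lemma two_Ci_cancel (z : C) : Cmult (Cmult (RtoC 2) Ci) z = RtoC 0 -> z = RtoC 0.
Proof.
  intros H. destruct z as [z1 z2].
  pose proof (f_equal Re H) as A. pose proof (f_equal Im H) as B.
  unfold Re, Im in *. simpl in A, B. unfold RtoC. f_equal; lra.
Qed.

(** The K_- coordinates attached to K_+ coordinates [a]; the sign and the row convention [a_i U_ij]
    are those of [DUvec]. *)
Definition unitary_coef (D : nat) (U : nat -> nat -> C) (a : nat -> C) : nat -> C :=
  fun j => Copp (sumC D (fun i => Cmult (a i) (U i j))).

(* The extension of [opgraph F] attached to the partial isometry [e_i -> - sum_j U_ij g_j]. *)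
Definition ext_graph F D e g U : graph := fun x y =>
  (exists w a, closure_dom F w /\ x = vadd w (dvec D e g a (unitary_coef D U a))) /\
  adjoint (opgraph F) x y.

Lemma dotC_unitary D U a a' : unitary D U ->
  dotC D (unitary_coef D U a) (unitary_coef D U a') = dotC D a a'.
Proof.
  intros HU. unfold dotC, unitary_coef.
  transitivity (sumC D (fun j => sumC D (fun i => sumC D (fun i' =>
     (Cconj (a i) * a' i' * (U i' j * Cconj (U i j)))%C)))).
  - apply sumC_ext. intros j _.
    rewrite Copp_conj, sumC_conj.
    transitivity (sumC D (fun i => Cconj (a i * U i j)) * sumC D (fun i => a' i * U i j))%C; [ring |].
    rewrite <- sumC_scal_r. apply sumC_ext. intros i _.
    rewrite <- sumC_scal. apply sumC_ext. intros i' _. rewrite Cmult_conj. ring.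
  - rewrite sumC_exchange. apply sumC_ext. intros i Hi. rewrite sumC_exchange.
    rewrite <- (sumC_kron D i (fun i' => (Cconj (a i) * a' i')%C) Hi).
    apply sumC_ext. intros i' Hi'. rewrite sumC_scal, (HU i' i Hi' Hi).
    rewrite kron_sym. unfold kron. ring.
Qed.

Lemma ext_graph_extends F D e g U : deficiency_bases F D e g ->
  extends (ext_graph F D e g U) (opgraph F).
Proof.
  intros H u v [Hu ->]. pose proof (db_fs _ _ _ _ H) as HF. split.
  - exists u, (fun _ => RtoC 0). split; [apply D0_closure_dom; assumption |].
    unfold dvec.
    rewrite (vlin_ext D (unitary_coef D U (fun _ => RtoC 0)) (fun _ => RtoC 0)), !vlin_0.
    + apply functional_extensionality; intro n. unfold vadd, vzero. ring.
    + intros j _. unfold unitary_coef. rewrite sumC_0; [ring | intros; ring].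
  - apply closure_dom_adjoint; [assumption |]. apply D0_closure_dom; assumption.
Qed.

(** Symmetry holds because a unitary preserves [dotC]. For maximality, a vector of the adjoint is
    paired with the test vector built from each [kron i], which expresses [a i] through [b];
    orthonormality of the columns of [U] inverts this relation. *)
Lemma ext_graph_selfadjoint F D e g U : deficiency_bases F D e g -> unitary D U ->
  self_adjoint (ext_graph F D e g U).
Proof.
  intros H HU. pose proof (db_fs _ _ _ _ H) as HF. split.
  - intros x y y' [_ Hy] [_ Hy'].
    apply (adjoint_F_l2 F) in Hy; [| assumption]. apply (adjoint_F_l2 F) in Hy'; [| assumption].
    destruct Hy as (_ & _ & ->), Hy' as (_ & _ & ->). reflexivity.
  - intros x y. split.
    + intros [(w & a & Hw & ->) Ha].
      apply (adjoint_F_l2 F) in Ha; [| assumption]. destruct Ha as (Hx & HFx & ->).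
      do 2 (split; [assumption |]). intros u v [(w' & a' & Hw' & ->) Hu].
      apply (adjoint_F_l2 F) in Hu; [| assumption]. destruct Hu as (Hu & HFu & ->).
      apply Ceq_minus.
      change (bform F (vadd w (dvec D e g a (unitary_coef D U a)))
                (vadd w' (dvec D e g a' (unitary_coef D U a'))) = RtoC 0).
      rewrite (bform_decomposed F D e g) by assumption.
      rewrite dotC_unitary by assumption. ring.
    + intros Ha.
      assert (Hadj : adjoint (opgraph F) x y).
      { destruct Ha as (Hx & Hy & K). do 2 (split; [assumption |]).
        intros u v Huv. apply K, (ext_graph_extends F D e g U H u v Huv). }
      split; [| exact Hadj].
      apply (adjoint_F_l2 F) in Hadj; [| assumption]. destruct Hadj as (Hx & HFx & ->).
      destruct (adjoint_decomposition F D e g x H Hx HFx) as (w & a & b & Hw & ->).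
      exists w, a. split; [assumption |]. f_equal.
      apply dvec_ext; [reflexivity |].
      assert (Hai : forall i, (i < D)%nat -> a i = Copp (sumC D (fun j => Cmult (b j) (Cconj (U i j))))).
      { intros i Hi.
        set (V := dvec D e g (kron i) (unitary_coef D U (kron i))).
        assert (EV : vadd vzero V = V)
          by (apply functional_extensionality; intro n; unfold vadd, vzero; ring).
        assert (Z : closure_dom F vzero) by (apply D0_closure_dom; [assumption | apply D0_vzero]).
        assert (E : bform F (vadd w (dvec D e g a b)) (vadd vzero V) = RtoC 0).
        { rewrite EV. destruct Ha as (_ & _ & K). unfold bform.
          rewrite (K V (F V)); [ring |]. split.
          - exists vzero, (kron i). split; [exact Z | symmetry; exact EV].
          - apply (dvec_adjoint F); assumption. }
        unfold V in E. rewrite (bform_decomposed F D e g) in E by assumption.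
        apply two_Ci_cancel, Ceq_minus in E. unfold dotC in E.
        rewrite (sumC_ext D _ (fun j => Cmult (kron i j) (Cconj (a j)))) in E by (intros; ring).
        rewrite sumC_kron in E by assumption.
        rewrite <- (Cconj_conj (a i)), E, sumC_conj.
        replace (Copp (sumC D (fun j => Cmult (b j) (Cconj (U i j)))))
          with (Cmult (Copp (RtoC 1)) (sumC D (fun j => Cmult (b j) (Cconj (U i j))))) by ring.
        rewrite <- sumC_scal. apply sumC_ext. intros j Hj.
        rewrite Cmult_conj, Cconj_conj. unfold unitary_coef.
        rewrite sumC_kron by assumption. rewrite Copp_conj. ring. }
      intros j' Hj'. unfold unitary_coef.
      rewrite <- (sumC_kron D j' b Hj').
      transitivity (sumC D (fun j => sumC D (fun i => (b j * (Cconj (U i j) * U i j'))%C))).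
      * apply sumC_ext. intros j Hj. rewrite sumC_scal, unitary_columns by assumption.
        rewrite kron_sym. ring.
      * rewrite sumC_exchange.
        replace (Copp (sumC D (fun i => Cmult (a i) (U i j'))))
          with (Cmult (Copp (RtoC 1)) (sumC D (fun i => Cmult (a i) (U i j')))) by ring.
        rewrite <- sumC_scal. apply sumC_ext. intros i Hi. rewrite (Hai i Hi).
        replace (Copp (RtoC 1) * (Copp (sumC D (fun j => Cmult (b j) (Cconj (U i j)))) * U i j'))%C
          with (sumC D (fun j => Cmult (b j) (Cconj (U i j))) * U i j')%C by ring.
        rewrite <- sumC_scal_r. apply sumC_ext. intros; ring.
Qed.

(** Otherwise [e 0] would lie in the domain of the closure, where the boundary form vanishes,
    whereas its value on [(e 0, e 0)] is [2 i]. *)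
Lemma not_selfadjoint_closure F D e g : deficiency_bases F D e g -> (0 < D)%nat ->
  ~ self_adjoint (gclosure (opgraph F)).
Proof.
  intros H HD [_ Hs]. pose proof (db_fs _ _ _ _ H) as HF.
  pose proof (db_e_l2 _ _ _ _ H 0%nat HD) as Hl.
  pose proof (db_e_eig _ _ _ _ H 0%nat HD) as He.
  assert (HFl : l2 (F (e 0%nat))) by (rewrite He; apply l2_vscal, Hl).
  assert (Ha : adjoint (opgraph F) (e 0%nat) (F (e 0%nat))) by (apply adjoint_opgraph; auto).
  assert (Hc : closure_dom F (e 0%nat)).
  { apply Hs. do 2 (split; [assumption |]). intros u v Huv.
    apply (inner_closure_adjoint _ _ _ _ _ Huv Ha). }
  destruct (bform_closure F _ _ HF Hc Hl HFl) as [E _].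
  unfold bform in E. rewrite He, inner_vscal_r, inner_vscal_l, (db_e_orth _ _ _ _ H), kron_diag in E
    by assumption.
  apply (f_equal Im) in E. unfold Im in E. simpl in E. lra.
Qed.

(** Linearity is not built into graphs; a self-adjoint graph inherits it from being equal to an
    adjoint. *)
Lemma selfadjoint_vadd T x y x' y' : self_adjoint T -> T x y -> T x' y' ->
  T (vadd x x') (vadd y y').
Proof.
  intros [_ Hs] Hx Hx'. apply Hs.
  apply Hs in Hx. apply Hs in Hx'. destruct Hx as (A1 & A2 & A3), Hx' as (B1 & B2 & B3).
  split; [auto using l2_vadd |]. split; [auto using l2_vadd |].
  intros u v Huv. pose proof (proj1 (Hs u v) Huv) as (C1 & C2 & _).
  rewrite !inner_vadd_l, (A3 u v Huv), (B3 u v Huv) by assumption. reflexivity.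
Qed.

Lemma selfadjoint_vscal T c x y : self_adjoint T -> T x y -> T (vscal c x) (vscal c y).
Proof.
  intros [_ Hs] Hx. apply Hs. apply Hs in Hx. destruct Hx as (A1 & A2 & A3).
  split; [auto using l2_vscal |]. split; [auto using l2_vscal |].
  intros u v Huv. pose proof (proj1 (Hs u v) Huv) as (C1 & C2 & _).
  rewrite !inner_vscal_l, (A3 u v Huv) by assumption. reflexivity.
Qed.

Lemma selfadjoint_closed T x y : self_adjoint T -> gclosure T x y -> T x y.
Proof.
  intros [_ Hs] Hc. apply Hs. pose proof Hc as (Hx & Hy & _).
  do 2 (split; [assumption |]). intros u v Huv. apply Hs in Huv.
  pose proof (inner_closure_adjoint _ _ _ _ _ Hc Huv) as E.
  rewrite (inner_conj v x), (inner_conj u y), E. reflexivity.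
Qed.

Lemma selfadjoint_sub_adjoint T G x y : self_adjoint T -> extends T G -> T x y -> adjoint G x y.
Proof.
  intros [_ Hs] He Hx. apply Hs in Hx. destruct Hx as (A1 & A2 & A3).
  do 2 (split; [assumption |]). intros u v Huv. apply A3, He, Huv.
Qed.

Lemma gclosure_mono G G' x y : (forall u v, G u v -> G' u v) -> gclosure G x y -> gclosure G' x y.
Proof.
  intros H (Hx & Hy & K). do 2 (split; [assumption |]). intros eps He.
  destruct (K eps He) as (u & v & HG & R). exists u, v. auto.
Qed.

(** [L] records the part of [T] in K_+ + K_-, and it determines [T] because [T] contains the
    closure. Symmetry makes [L] isotropic for the boundary form ([Liso]) and self-adjointness makes
    it maximal ([Lmax]). Maximality leaves the K_+ coordinates arbitrary, and isotropy makes the K_-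
    coordinates an isometric function of them. *)
Lemma selfadjoint_classification F D e g T : deficiency_bases F D e g ->
  self_adjoint T -> extends T (opgraph F) ->
  exists U, unitary D U /\ graph_eq T (ext_graph F D e g U).
Proof.
  intros H HT HE. pose proof (db_fs _ _ _ _ H) as HF. pose proof HF as (Fadd & Fscal & _ & _).
  assert (TF : forall x y, T x y -> l2 x /\ l2 (F x) /\ y = F x).
  { intros x y Hx. apply (adjoint_F_l2 F); [assumption |].
    apply (selfadjoint_sub_adjoint T); assumption. }
  assert (TC : forall w, closure_dom F w -> T w (F w)).
  { intros w Hw. apply selfadjoint_closed; [assumption |].
    apply (gclosure_mono (opgraph F)); assumption. }
  assert (TB : forall x x' y y', T x y -> T x' y' -> bform F x x' = RtoC 0).
  { intros x x' y y' Hx Hx'. pose proof (TF x y Hx) as (_ & _ & ->).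
    pose proof (TF x' y' Hx') as (_ & _ & ->).
    apply (proj2 HT) in Hx. destruct Hx as (_ & _ & K).
    unfold bform. rewrite (K x' (F x') Hx'). ring. }
  set (V := dvec D e g).
  set (L := fun a b => T (V a b) (F (V a b))).
  assert (Ladd : forall a b a' b', L a b -> L a' b' ->
            L (fun i => Cplus (a i) (a' i)) (fun i => Cplus (b i) (b' i))).
  { intros a b a' b' K K'. unfold L, V. rewrite <- dvec_add, Fadd.
    apply selfadjoint_vadd; assumption. }
  assert (Lscal : forall c a b, L a b -> L (fun i => Cmult c (a i)) (fun i => Cmult c (b i))).
  { intros c a b K. unfold L, V. rewrite <- dvec_scal, Fscal.
    apply selfadjoint_vscal; assumption. }
  assert (Lext : forall a b a' b', (forall i, (i < D)%nat -> a i = a' i) ->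
            (forall i, (i < D)%nat -> b i = b' i) -> L a b -> L a' b').
  { intros a b a' b' K K' HL. unfold L, V. rewrite (dvec_ext D e g a' b' a b); auto;
      intros; symmetry; auto. }
  assert (L0 : L (fun _ => RtoC 0) (fun _ => RtoC 0)).
  { unfold L, V, dvec. rewrite !vlin_0.
    replace (vadd vzero vzero) with vzero
      by (apply functional_extensionality; intro n; unfold vadd, vzero; ring).
    apply TC, D0_closure_dom; [assumption | apply D0_vzero]. }
  assert (Liso : forall a b a' b', L a b -> L a' b' -> dotC D a a' = dotC D b b').
  { intros a b a' b' K K'. pose proof (TB _ _ _ _ K K') as E. unfold V in E.
    rewrite (bform_dvec F) in E by assumption. apply Ceq_minus, two_Ci_cancel, E. }
  assert (Tdec : forall x y, T x y -> exists w a b, closure_dom F w /\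
            x = vadd w (V a b) /\ L a b).
  { intros x y Hx. pose proof (TF x y Hx) as (Hl & HFl & ->).
    destruct (adjoint_decomposition F D e g x H Hl HFl) as (w & a & b & Hw & ->).
    exists w, a, b. repeat split; try apply Hw. unfold L. fold (V a b) in Hx.
    pose proof (selfadjoint_vadd T _ _ _ _ HT Hx
                  (selfadjoint_vscal T (RtoC (-1)) _ _ HT (TC w Hw))) as K.
    rewrite <- Fscal, <- Fadd in K.
    replace (vadd (vadd w (V a b)) (vscal (RtoC (-1)) w)) with (V a b) in K; [exact K |].
    apply functional_extensionality; intro n. unfold vadd, vscal. rewrite RtoC_m1. ring. }
  assert (Lmax : forall a b, (forall a' b', L a' b' -> dotC D a a' = dotC D b b') -> L a b).
  { intros a b K. unfold L. apply (proj2 HT).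
    split; [apply (dvec_l2 F); assumption |]. split; [apply dvec_F_l2; assumption |].
    intros u v Huv. pose proof (TF u v Huv) as (Hu & HFu & ->).
    destruct (Tdec u (F u) Huv) as (w & a' & b' & Hw & -> & HL).
    apply Ceq_minus.
    change (bform F (V a b) (vadd w (V a' b')) = RtoC 0).
    replace (V a b) with (vadd vzero (V a b))
      by (apply functional_extensionality; intro n; unfold vadd, vzero; ring).
    unfold V. rewrite (bform_decomposed F D e g); auto.
    - rewrite (K a' b' HL). ring.
    - apply D0_closure_dom; [assumption | apply D0_vzero]. }
  (* If the K_+ coordinates missed a direction, an annihilator [q] would make [(conj q, 0)]
     boundary-orthogonal to all of [L], hence a member of it by [Lmax]; isotropy then reads
     [|q|^2 = 0]. *)
  assert (Lfull : forall a, exists b, L a b).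
  { destruct (subspace_full_or_annihilated D (fun a => exists b, L a b)) as [All | (q & Hne & Hq)].
    - intros a a' [b K] [b' K']. eexists. apply (Ladd _ _ _ _ K K').
    - intros c a [b K]. eexists. apply (Lscal c _ _ K).
    - intros a a' E [b K]. exists b. apply (Lext a b); auto.
    - exists (fun _ => RtoC 0). exact L0.
    - exact All.
    - exfalso. destruct Hne as (i & Hi & Hqi). apply Hqi.
      assert (K : L (fun i => Cconj (q i)) (fun _ => RtoC 0)).
      { apply Lmax. intros a' b' K. unfold dotC. symmetry.
        rewrite sumC_0.
        - symmetry. rewrite <- (Hq a' (ex_intro _ b' K)). apply sumC_ext. intros j _.
          rewrite Cconj_conj. reflexivity.
        - intros j _. apply injective_projections; simpl; ring. }
      assert (E : dotC D (fun i => Cconj (q i)) (fun i => Cconj (q i)) = RtoC 0).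
      { rewrite (Liso _ _ _ _ K K). apply sumC_0. intros j _.
        apply injective_projections; simpl; ring. }
      pose proof (dotC_self_eq0 D _ E i Hi) as Z. cbv beta in Z.
      rewrite <- (Cconj_conj (q i)), Z. apply injective_projections; simpl; ring. }
  destruct (choice _ (fun i => Lfull (kron i))) as [B HB].
  (* The sign compensates the one built into [unitary_coef]. *)
  set (U := fun i j => Copp (B i j)).
  assert (LU : forall a, L a (unitary_coef D U a)).
  { intro a.
    assert (K : forall d, L (fun j => sumC d (fun i => Cmult (a i) (kron i j)))
                            (fun j => sumC d (fun i => Cmult (a i) (B i j)))).
    { induction d as [| d IH]; [exact L0 |]. cbn [sumC].
      apply Ladd; [exact IH |]. apply Lscal, HB. }
    apply (Lext _ _ _ _) with (3 := K D).
    - intros i Hi. rewrite <- (sumC_kron D i a Hi). apply sumC_ext. intros j _.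
      rewrite kron_sym. ring.
    - intros j Hj. unfold unitary_coef, U.
      transitivity (Copp (Cmult (Copp (RtoC 1)) (sumC D (fun i => Cmult (a i) (B i j))))); [ring |].
      rewrite <- sumC_scal. f_equal. apply sumC_ext. intros; ring. }
  exists U. split.
  - intros i i' Hi Hi'.
    pose proof (Liso _ _ _ _ (HB i') (HB i)) as E. unfold dotC in E.
    rewrite (sumC_ext D (fun j => (Cconj (kron i' j) * kron i j)%C) (fun j => Cmult (kron i j) (kron i' j))) in E
      by (intros; rewrite kron_conj; ring).
    rewrite sumC_kron in E by assumption. rewrite kron_sym in E. fold (kron i i').
    rewrite E. apply sumC_ext. intros j _. unfold U. rewrite Copp_conj. ring.
  - intros x y. split.
    + intros Hx. split; [| apply (selfadjoint_sub_adjoint T); assumption].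
      destruct (Tdec x y Hx) as (w & a & b & Hw & -> & HL).
      exists w, a. split; [assumption |]. f_equal. apply dvec_ext; [reflexivity |].
      (* The difference of [(a, b)] and [(a, unitary_coef D U a)] has zero K_+ part, so isotropy
         kills its K_- part. *)
      pose proof (Ladd _ _ _ _ HL (Lscal (Copp (RtoC 1)) _ _ (LU a))) as K.
      pose proof (Liso _ _ _ _ K K) as E.
      symmetry in E. unfold dotC at 2 in E. rewrite sumC_0 in E.
      * intros j Hj. pose proof (dotC_self_eq0 D _ E j Hj) as Z. cbv beta in Z.
        apply Ceq_minus. rewrite <- Z. ring.
      * intros i _. ring.
    + intros [(w & a & Hw & ->) Ha]. apply (adjoint_F_l2 F) in Ha; [| assumption].
      destruct Ha as (_ & _ & ->). rewrite Fadd.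
      apply selfadjoint_vadd; [assumption | apply TC, Hw | apply LU].
Qed.

(** Equal graphs make the test vectors of row [i] for [U] and [U'] boundary-orthogonal, so the two
    rows have inner product 1. Being unit vectors, they coincide, as the expansion of
    [|U_i - U'_i|^2] shows. *)
Lemma ext_graph_injective F D e g U U' : deficiency_bases F D e g ->
  unitary D U -> unitary D U' -> graph_eq (ext_graph F D e g U) (ext_graph F D e g U') ->
  forall i j, (i < D)%nat -> (j < D)%nat -> U i j = U' i j.
Proof.
  intros H HU HU' HE i j Hi Hj. pose proof (db_fs _ _ _ _ H) as HF.
  assert (Z : closure_dom F vzero) by (apply D0_closure_dom; [assumption | apply D0_vzero]).
  assert (EV : forall V, vadd vzero V = V)
    by (intro; apply functional_extensionality; intro n; unfold vadd, vzero; ring).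
  assert (K : forall W, ext_graph F D e g W (dvec D e g (kron i) (unitary_coef D W (kron i)))
                          (F (dvec D e g (kron i) (unitary_coef D W (kron i))))).
  { intro W. split.
    - exists vzero, (kron i). split; [exact Z | symmetry; apply EV].
    - apply (dvec_adjoint F); assumption. }
  pose proof (ext_graph_selfadjoint F D e g U' H HU') as [_ Hs].
  pose proof (proj1 (Hs _ _) (K U')) as (_ & _ & Hadj).
  specialize (Hadj _ _ (proj1 (HE _ _) (K U))). apply Ceq_minus in Hadj.
  change (bform F (dvec D e g (kron i) (unitary_coef D U' (kron i)))
            (dvec D e g (kron i) (unitary_coef D U (kron i))) = RtoC 0) in Hadj.
  rewrite (bform_dvec F) in Hadj by assumption. apply two_Ci_cancel, Ceq_minus in Hadj.
  rewrite <- (dotC_unitary D U (kron i) (kron i) HU) in Hadj.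
  assert (N1 : sumC D (fun j => Cmult (U i j) (Cconj (U i j))) = kron i i) by (apply HU; assumption).
  assert (N2 : sumC D (fun j => Cmult (U' i j) (Cconj (U' i j))) = kron i i) by (apply HU'; assumption).
  assert (EU : forall W j, (j < D)%nat -> unitary_coef D W (kron i) j = Copp (W i j)).
  { intros W j' Hj'. unfold unitary_coef. rewrite sumC_kron by assumption. reflexivity. }
  unfold dotC in Hadj.
  rewrite (sumC_ext D (fun i0 => (Cconj (unitary_coef D U (kron i) i0) * unitary_coef D U (kron i) i0)%C)
             (fun j => Cmult (U i j) (Cconj (U i j)))) in Hadj
    by (intros m Hm; rewrite EU by assumption; rewrite Copp_conj; ring).
  rewrite (sumC_ext D (fun i0 => (Cconj (unitary_coef D U' (kron i) i0) * unitary_coef D U (kron i) i0)%C)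
             (fun j => Cmult (Cconj (U' i j)) (U i j))) in Hadj
    by (intros m Hm; rewrite !EU by assumption; rewrite Copp_conj; ring).
  rewrite N1 in Hadj.
  assert (Hadj' : sumC D (fun j => Cmult (U' i j) (Cconj (U i j))) = kron i i).
  { rewrite <- (kron_conj i i), Hadj, sumC_conj. apply sumC_ext. intros m _.
    rewrite Cmult_conj, Cconj_conj. reflexivity. }
  apply Ceq_minus.
  apply (sumC_sqr_eq0 D (fun j => (U i j - U' i j)%C)); [| assumption].
  transitivity (sumC D (fun j => (U i j * Cconj (U i j) + - RtoC 1 * (Cconj (U' i j) * U i j)
     + (- RtoC 1 * (U' i j * Cconj (U i j)) + U' i j * Cconj (U' i j)))%C)).
  - apply sumC_ext. intros m _. rewrite Cminus_conj. ring.
  - rewrite !sumC_plus, !sumC_scal, N1, N2, Hadj', <- Hadj. ring.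
Qed.

(** The deficiency part is kept fixed, and only the component in the domain of the closure is
    approximated from [D0]. *)
Lemma ext_graph_core F D e g U : deficiency_bases F D e g -> unitary D U ->
  is_core (ext_graph F D e g U)
    (fun x => exists u a, D0 u /\ x = vadd u (dvec D e g a (unitary_coef D U a))).
Proof.
  intros H HU. pose proof (db_fs _ _ _ _ H) as HF. pose proof HF as (Fadd & _ & HD & _).
  assert (K : forall w a, closure_dom F w ->
    ext_graph F D e g U (vadd w (dvec D e g a (unitary_coef D U a)))
      (F (vadd w (dvec D e g a (unitary_coef D U a))))).
  { intros w a Hw. split; [exists w, a; auto |].
    apply adjoint_opgraph; [assumption |].
    rewrite Fadd. pose proof (dvec_F_l2 F D e g a (unitary_coef D U a) H).
    pose proof (dvec_l2 F D e g a (unitary_coef D U a) H).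
    destruct Hw as (L1 & L2 & _). auto using l2_vadd. }
  split.
  - intros x (u & a & Hu & ->). eexists. apply K, D0_closure_dom; assumption.
  - intros x y. split.
    + intros Hc. apply selfadjoint_closed; [apply ext_graph_selfadjoint; assumption |].
      apply gclosure_mono with (2 := Hc). intros u v [_ Huv]. exact Huv.
    + intros [(w & a & Hw & ->) Ha].
      apply (adjoint_F_l2 F) in Ha; [| assumption]. destruct Ha as (Hx & HFx & ->).
      do 2 (split; [assumption |]). intros eps He.
      set (V := dvec D e g a (unitary_coef D U a)) in *.
      destruct Hw as (Lw & LFw & Happ). destruct (Happ eps He) as (u & v & [Hu ->] & Hul & Hvl & E1 & E2).
      assert (LV : l2 V) by (apply (dvec_l2 F); assumption).
      assert (LFV : l2 (F V)) by (apply dvec_F_l2; assumption).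
      exists (vadd u V), (F (vadd u V)). rewrite !vsub_minus in *.
      assert (Es : forall p q r, vsub (vadd p r) (vadd q r) = vsub p q).
      { intros; apply functional_extensionality; intro n. rewrite !vsub_coord. unfold vadd. ring. }
      rewrite !Fadd, !Es. repeat split; auto using l2_vadd.
      * exists u, a. auto.
      * exists u, a. split; [apply D0_closure_dom; assumption | reflexivity].
      * auto using l2_vadd.
      * auto using l2_vadd.
      * intros u' v' Hu'.
        assert (Hadj : adjoint (opgraph F) (vadd u V) (F (vadd u V))).
        { apply adjoint_opgraph; [assumption |]. rewrite Fadd. auto using l2_vadd. }
        rewrite <- Fadd. apply Hadj, Hu'.
Qed.

(** * The chain vectors as deficiency bases *)

Lemma phivec_orthogonal k l theta s s' n0 n1 dd dd' : (l < k)%nat ->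
  (l <= n0 < k)%nat -> (l <= n1 < k)%nat -> n0 <> n1 ->
  inner (phivec k l theta s n0 dd) (phivec k l theta s' n1 dd') = RtoC 0.
Proof.
  intros H H0 H1 Hne.
  assert (K : forall n, Cmult (Cconj (phivec k l theta s n0 dd n)) (phivec k l theta s' n1 dd' n)
                        = RtoC 0).
  { intro n. destruct (classic (exists r, n = n0 + r * (k - l))%nat) as [[r ->] | No].
    - rewrite (phivec_off k l theta s' n1); [ring | assumption |].
      intros r' E. apply Hne. apply (chain_unique k l n0 n1 r r'); assumption.
    - rewrite (phivec_off k l theta s n0).
      + apply injective_projections; simpl; ring.
      + assumption.
      + intros r E. apply No. exists r; exact E. }
  unfold inner, RtoC. f_equal; apply Series_R0; intro n; rewrite K; reflexivity.
Qed.

Lemma phivec_first k l theta s n0 dd : (l < k)%nat -> phivec k l theta s n0 dd n0 = dd 0%nat.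
Proof.
  intros H. pose proof (phivec_on k l theta s n0 dd 0 H) as E.
  rewrite Nat.mul_0_l, Nat.add_0_r in E. rewrite E. simpl. ring.
Qed.

Lemma phivec_first_other k l theta s n0 n1 dd : (l < k)%nat ->
  (l <= n0 < k)%nat -> (l <= n1 < k)%nat -> n0 <> n1 -> phivec k l theta s n0 dd n1 = RtoC 0.
Proof.
  intros H H0 H1 Hne. apply phivec_off; [assumption |]. intros r E.
  apply Hne. apply (chain_unique k l n0 n1 r 0); [assumption | assumption |]. lia.
Qed.

(** Conjugation and the change from i to -i preserve moduli, so the norms of [phiplus] appearing in
    [DUvec] also normalize [phiminus]. *)
Lemma nrm_phivec_conj k l theta n0 dd : (l < k)%nat ->
  nrm (phivec k l theta (Copp Ci) n0 (fun r => Cconj (dd r))) = nrm (phivec k l theta Ci n0 dd).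
Proof.
  intros H. unfold nrm. f_equal. apply Series_ext. intro n.
  destruct (classic (exists r, n = n0 + r * (k - l))%nat) as [[r ->] | No].
  - rewrite !phivec_on by assumption.
    rewrite !Cmod_mult, !Cmod_Cpow, Cmod_conj, Cmod_opp. reflexivity.
  - rewrite !phivec_off; auto; intros r E; apply No; exists r; exact E.
Qed.

(** The coefficients are read off at the starting sites [l + i], where the family is diagonal. The
    difference vanishes at all of them, and [eigen_unique] applies to it. *)
Lemma eigen_span k l theta f s (v : nat -> seqC) (x : seqC) : (l < k)%nat ->
  Cconj s = Copp s -> s <> RtoC 0 ->
  (forall i, (i < k - l)%nat -> Aop k l theta f (v i) = vscal s (v i)) ->
  (forall i, (i < k - l)%nat -> v i (l + i)%nat <> RtoC 0) ->
  (forall i j, (i < k - l)%nat -> (j < k - l)%nat -> i <> j -> v i (l + j)%nat = RtoC 0) ->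
  Aop k l theta f x = vscal s x ->
  exists c, x = vlin (k - l) c v.
Proof.
  intros H Hc Hs Hv Hd Ho Hx.
  pose proof (Aop_formally_symmetric k l theta f) as HF.
  set (c := fun i => Cdiv (x (l + i)%nat) (v i (l + i)%nat)). exists c.
  assert (E : vsub x (vlin (k - l) c v) = vzero).
  { apply (eigen_unique k l theta f s); auto.
    - rewrite fs_vsub, Hx, (vlin_eigen _ s) by assumption.
      apply functional_extensionality; intro n. unfold vscal. rewrite !vsub_coord. ring.
    - intros n0 Hn0. rewrite vsub_coord. unfold vlin.
      set (i := (n0 - l)%nat). replace n0 with (l + i)%nat by (unfold i; lia).
      assert (Hi : (i < k - l)%nat) by (unfold i; lia).
      rewrite (sumC_single _ i); [| assumption |].
      + unfold c. field. apply Hd, Hi.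
      + intros j Hj Hji. rewrite Ho by auto. ring. }
  apply functional_extensionality; intro n.
  apply Ceq_minus. rewrite <- vsub_coord, E. reflexivity.
Qed.

Lemma vlin_independent (D l : nat) (v : nat -> seqC) (c : nat -> C) :
  (forall i, (i < D)%nat -> v i (l + i)%nat <> RtoC 0) ->
  (forall i j, (i < D)%nat -> (j < D)%nat -> i <> j -> v i (l + j)%nat = RtoC 0) ->
  (forall n, sumC D (fun i => Cmult (c i) (v i n)) = RtoC 0) ->
  forall i, (i < D)%nat -> c i = RtoC 0.
Proof.
  intros Hd Ho Hz i Hi. specialize (Hz (l + i)%nat).
  rewrite (sumC_single _ i) in Hz; [| assumption |].
  - replace (c i) with (Cmult (Cmult (c i) (v i (l + i)%nat)) (/ v i (l + i)%nat)%C)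
      by (field; apply Hd, Hi).
    rewrite Hz. ring.
  - intros j Hj Hji. rewrite Ho by auto. ring.
Qed.

Lemma Kdef_span k l theta f s (v : nat -> seqC) : (l < k)%nat ->
  Cconj s = Copp s -> s <> RtoC 0 ->
  (forall i, (i < k - l)%nat -> l2 (v i)) ->
  (forall i, (i < k - l)%nat -> Aop k l theta f (v i) = vscal s (v i)) ->
  (forall i, (i < k - l)%nat -> v i (l + i)%nat <> RtoC 0) ->
  (forall i j, (i < k - l)%nat -> (j < k - l)%nat -> i <> j -> v i (l + j)%nat = RtoC 0) ->
  (forall x, Kdef k l theta f s x <-> in_span (k - l) v x) /\
  has_dim (Kdef k l theta f s) (k - l).
Proof.
  intros H Hc Hs Hl Hv Hd Ho.
  assert (Span : forall x, Kdef k l theta f s x <-> in_span (k - l) v x).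
  { intro x. rewrite Kdef_eigen by assumption. split.
    - intros [_ Hx]. destruct (eigen_span k l theta f s v x) as [c ->]; auto.
      exists c. reflexivity.
    - intros [c Hcx]. assert (E : x = vlin (k - l) c v)
        by (apply functional_extensionality; exact Hcx).
      subst x. split; [apply l2_vlin, Hl |].
      apply vlin_eigen; [apply Aop_formally_symmetric | assumption]. }
  split; [exact Span |]. exists v. split; [| split].
  - intros i Hi. apply (proj2 (Kdef_eigen k l theta f s (v i) Hc)). auto.
  - intros c Hz. apply (vlin_independent _ l v c); assumption.
  - intros x Hx. apply Span, Hx.
Qed.

Theorem theorem4p16 (k l : nat) (theta : R) (f : nat -> R)
  (Hkl : (l < k)%nat) (Hsum : (3 <= k + l)%nat)
  (Hf : forall n, 0 <= f n)
  (Hasym : exists lam : nat -> R, lam 0%nat < 2 /\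
             asymp_expansion (fun n => f n / beta k l n) lam)
  (d : nat -> nat -> C)
  (Hd : forall n0, (l <= n0 < k)%nat ->
          recurrence k l f n0 (d n0) /\ exists r, d n0 r <> RtoC 0) :
  let A := Agraph k l theta f in
  let D := (k - l)%nat in
  ~ ess_self_adjoint A /\
  has_dim (Kdef k l theta f Ci) D /\
  has_dim (Kdef k l theta f (Copp Ci)) D /\
  (forall x, Kdef k l theta f Ci x <->
     in_span D (fun i => phiplus k l theta d (l + i)) x) /\
  (forall x, Kdef k l theta f (Copp Ci) x <->
     in_span D (fun i => phiminus k l theta d (l + i)) x) /\
  (forall U, unitary D U ->
     self_adjoint (AU k l theta f d U) /\ extends (AU k l theta f d U) A) /\
  (forall T, self_adjoint T -> extends T A ->
     exists U, unitary D U /\ graph_eq T (AU k l theta f d U)) /\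
  (forall U U', unitary D U -> unitary D U' ->
     graph_eq (AU k l theta f d U) (AU k l theta f d U') ->
     forall i j, (i < D)%nat -> (j < D)%nat -> U i j = U' i j) /\
  (forall U, unitary D U -> is_core (AU k l theta f d U) (coreAU k l theta d U)).
Proof.
  intros A D.
  set (F := Aop k l theta f).
  set (vp := fun i => phiplus k l theta d (l + i)).
  set (vm := fun i => phiminus k l theta d (l + i)).
  assert (Hr : forall i, (i < D)%nat -> (l <= l + i < k)%nat) by (intros; unfold D in *; lia).
  assert (Hrec : forall i, (i < D)%nat -> recurrence k l f (l + i) (d (l + i)%nat))
    by (intros i Hi; apply (Hd _ (Hr i Hi))).
  assert (Hsq : forall i, (i < D)%nat -> ex_series (fun r => Cmod (d (l + i)%nat r) ^ 2)).
  { intros i Hi. apply (recurrence_square_summable k l f (l + i)); auto; lia. }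
  assert (Hp2 : forall i, (i < D)%nat -> l2 (vp i)).
  { intros i Hi. apply phivec_l2; auto. apply Cmod_Ci. }
  assert (Hm2 : forall i, (i < D)%nat -> l2 (vm i)).
  { intros i Hi. apply phivec_l2; auto.
    - rewrite Cmod_opp. apply Cmod_Ci.
    - apply ex_series_extR with (2 := Hsq i Hi). intro r. rewrite Cmod_conj. reflexivity. }
  assert (Ci2 : (Ci * Ci = - RtoC 1)%C) by (apply injective_projections; simpl; ring).
  assert (Hpe : forall i, (i < D)%nat -> F (vp i) = vscal Ci (vp i)).
  { intros i Hi. apply phivec_eigen; auto. apply recurrence_plus; auto; lia. }
  assert (Hme : forall i, (i < D)%nat -> F (vm i) = vscal (Copp Ci) (vm i)).
  { intros i Hi. apply phivec_eigen; auto.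
    - rewrite <- Ci2. ring.
    - apply recurrence_minus; auto; lia. }
  assert (Hd0 : forall i, (i < D)%nat -> d (l + i)%nat 0%nat <> RtoC 0).
  { intros i Hi. apply (recurrence_init_neq0 k l f (l + i)); auto; [lia |].
    apply (Hd _ (Hr i Hi)). }
  assert (Hpd : forall i, (i < D)%nat -> vp i (l + i)%nat <> RtoC 0).
  { intros i Hi. unfold vp, phiplus. rewrite phivec_first by assumption. auto. }
  assert (Hmd : forall i, (i < D)%nat -> vm i (l + i)%nat <> RtoC 0).
  { intros i Hi. unfold vm, phiminus. rewrite phivec_first by assumption.
    intro E. apply (Hd0 i Hi). rewrite <- (Cconj_conj (d (l + i)%nat 0%nat)), E.
    apply Cconj_RtoC. }
  assert (Hpo : forall i j, (i < D)%nat -> (j < D)%nat -> i <> j -> vp i (l + j)%nat = RtoC 0)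
    by (intros; apply phivec_first_other; auto; lia).
  assert (Hmo : forall i j, (i < D)%nat -> (j < D)%nat -> i <> j -> vm i (l + j)%nat = RtoC 0)
    by (intros; apply phivec_first_other; auto; lia).
  assert (mCi_nz : Copp Ci <> RtoC 0).
  { intro E. apply Ci_nz. replace Ci with (Copp (Copp Ci)) by ring. rewrite E. ring. }
  destruct (Kdef_span k l theta f Ci vp Hkl Cconj_Ci Ci_nz Hp2 Hpe Hpd Hpo) as [SP DP].
  destruct (Kdef_span k l theta f (Copp Ci) vm Hkl Cconj_mCi mCi_nz Hm2 Hme Hmd Hmo) as [SM DM].
  set (nu := fun i => nrm (vp i)).
  assert (Hnu : forall i, (i < D)%nat -> 0 < nu i).
  { intros i Hi. eapply Rlt_le_trans; [| apply (coord_le_nrm (vp i) (l + i)%nat), Hp2, Hi].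
    apply Cmod_gt_0, Hpd, Hi. }
  assert (Hnum : forall i, nrm (vm i) = nu i) by (intro i; apply nrm_phivec_conj, Hkl).
  set (e := fun i => vscal (RtoC (/ nu i)) (vp i)).
  set (g := fun i => vscal (RtoC (/ nu i)) (vm i)).
  assert (Hnui : forall i, (i < D)%nat -> RtoC (nu i) <> RtoC 0).
  { intros i Hi E. apply RtoC_inj in E. specialize (Hnu i Hi). lra. }
  assert (Hrescale : forall v c, (forall i, (i < D)%nat -> nu i <> 0) ->
            vlin D c v = vlin D (fun i => Cmult (c i) (RtoC (nu i)))
                           (fun i => vscal (RtoC (/ nu i)) (v i))).
  { intros v c Hn. apply functional_extensionality; intro n. apply sumC_ext.
    intros i Hi. unfold vscal. rewrite RtoC_inv by (apply Hn, Hi). field. apply Hnui, Hi. }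
  assert (Hnz : forall i, (i < D)%nat -> nu i <> 0) by (intros i Hi; specialize (Hnu i Hi); lra).
  assert (Horth : forall v, (forall i, (i < D)%nat -> l2 (v i)) ->
            (forall i, (i < D)%nat -> nrm (v i) = nu i) ->
            (forall i j, (i < D)%nat -> (j < D)%nat -> i <> j -> inner (v i) (v j) = RtoC 0) ->
            forall i j, (i < D)%nat -> (j < D)%nat ->
              inner (vscal (RtoC (/ nu i)) (v i)) (vscal (RtoC (/ nu j)) (v j)) = kron i j).
  { intros v Hv Hn Ho i j Hi Hj.
    rewrite inner_vscal_l, inner_vscal_r, Cconj_RtoC by auto using l2_vscal.
    destruct (Nat.eq_dec i j) as [<- | Ne].
    - rewrite inner_self, Hn, kron_diag by auto. rewrite <- !RtoC_mult. f_equal.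
      field. apply Hnz, Hi.
    - rewrite Ho, kron_off by auto. ring. }
  assert (HB : deficiency_bases F D e g).
  { pose proof (Aop_formally_symmetric k l theta f) as HF. fold F in HF.
    constructor.
    - exact HF.
    - intros i Hi. apply l2_vscal, Hp2, Hi.
    - intros i Hi. apply l2_vscal, Hm2, Hi.
    - intros i Hi. unfold e. rewrite (proj1 (proj2 HF)), Hpe by assumption.
      apply functional_extensionality; intro n. unfold vscal. ring.
    - intros i Hi. unfold g. rewrite (proj1 (proj2 HF)), Hme by assumption.
      apply functional_extensionality; intro n. unfold vscal. ring.
    - apply Horth; auto. intros. apply phivec_orthogonal; auto; lia.
    - apply Horth; auto. intros. apply phivec_orthogonal; auto; lia.
    - intros p _ Ep. destruct (eigen_span k l theta f Ci vp p) as [c ->]; auto using Cconj_Ci, Ci_nz.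
      eexists. apply (Hrescale vp c Hnz).
    - intros p _ Ep. destruct (eigen_span k l theta f (Copp Ci) vm p) as [c ->]; auto using Cconj_mCi.
      eexists. apply (Hrescale vm c Hnz). }
  (* The substitution of [a i * nu i] for [a i] removes the ratio of norms:
     [a_i U_ij (nu i / nu j) vm j] equals [(a_i nu i) U_ij g j]. *)
  assert (HDU : forall U a, DUvec k l theta d U a =
            dvec D e g (fun i => Cmult (a i) (RtoC (nu i)))
              (unitary_coef D U (fun i => Cmult (a i) (RtoC (nu i))))).
  { intros U a. apply functional_extensionality; intro n. unfold DUvec, dvec, vadd.
    fold D.
    change (sumC D (fun i => Cmult (a i) (phiplus k l theta d (l + i) n))) with (vlin D a vp n).
    rewrite (Hrescale vp a Hnz). fold e.
    unfold Cminus. f_equal.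
    rewrite sumC_exchange. unfold vlin.
    transitivity (Copp (sumC D (fun j => sumC D (fun i =>
      (a i * U i j * RtoC (nu i / nu j) * vm j n)%C)))); [reflexivity |].
    transitivity (Cmult (Copp (RtoC 1)) (sumC D (fun j => sumC D (fun i =>
      (a i * U i j * RtoC (nu i / nu j) * vm j n)%C)))); [ring |].
    rewrite <- sumC_scal. apply sumC_ext. intros j Hj. unfold unitary_coef, g, vscal.
    rewrite sumC_scal_r.
    transitivity (- sumC D (fun i => a i * U i j * RtoC (nu i / nu j)) * vm j n)%C; [ring |].
    transitivity (- (sumC D (fun i => a i * RtoC (nu i) * U i j) * RtoC (/ nu j)) * vm j n)%C; [| ring].
    rewrite <- sumC_scal_r. do 2 f_equal. apply sumC_ext. intros i Hi.
    unfold Rdiv. rewrite RtoC_mult. ring. }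
  (* The norms being nonzero, the substitution is invertible, and both parametrizations sweep out
     the same space. *)
  assert (Hback : forall U a, exists a', dvec D e g a (unitary_coef D U a) = DUvec k l theta d U a').
  { intros U a. exists (fun i => Cmult (a i) (RtoC (/ nu i))). rewrite HDU.
    assert (E : forall i, (i < D)%nat -> a i = Cmult (Cmult (a i) (RtoC (/ nu i))) (RtoC (nu i))).
    { intros i Hi. rewrite RtoC_inv by (apply Hnz, Hi). field. apply Hnui, Hi. }
    apply dvec_ext; [exact E |]. intros j _. unfold unitary_coef. f_equal.
    apply sumC_ext. intros i Hi. rewrite <- (E i Hi). reflexivity. }
  assert (HAU : forall U, AU k l theta f d U = ext_graph F D e g U).
  { intro U. apply functional_extensionality; intro x. apply functional_extensionality; intro y.
    apply propositional_extensionality. unfold AU, ext_graph. split; intros [Hx Hy]; split; auto.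
    - destruct Hx as (w & a & Hw & E). rewrite HDU in E.
      eexists w, _. split; [apply closure_dom_iff; [apply HB | exact Hw] |].
      apply functional_extensionality. exact E.
    - destruct Hx as (w & a & Hw & ->). destruct (Hback U a) as [a' ->].
      exists w, a'. split; [apply closure_dom_iff in Hw; [exact Hw | apply HB] |].
      reflexivity. }
  assert (Hcore : forall U, coreAU k l theta d U =
            (fun x => exists u a, D0 u /\ x = vadd u (dvec D e g a (unitary_coef D U a)))).
  { intro U. apply functional_extensionality; intro x.
    apply propositional_extensionality. split.
    - intros (w & a & Hw & E). rewrite HDU in E. eexists w, _. split; [exact Hw |].
      apply functional_extensionality. exact E.
    - intros (w & a & Hw & ->). destruct (Hback U a) as [a' ->].
      exists w, a'. split; [exact Hw | reflexivity]. }
  assert (HD : (0 < D)%nat) by (unfold D; lia).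
  split; [exact (not_selfadjoint_closure F D e g HB HD) |].
  split; [exact DP |]. split; [exact DM |]. split; [exact SP |]. split; [exact SM |].
  split; [| split; [| split]].
  - intros U HU. rewrite HAU. split; [apply ext_graph_selfadjoint; assumption |].
    apply (ext_graph_extends F D e g U HB).
  - intros T HT HE. destruct (selfadjoint_classification F D e g T HB HT HE) as (U & HU & E).
    exists U. rewrite HAU. auto.
  - intros U U' HU HU'. rewrite !HAU. apply (ext_graph_injective F D e g); assumption.
  - intros U HU. rewrite HAU, Hcore. apply ext_graph_core; assumption.
Qed.
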